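(* Let $d\in\mathbb{N}$, $\sigma_0>0$, $U(x)=\frac{1}{2\sigma_0^2}|x|^2$ on $\mathbb{R}^d$, so that the target is $\pi=\mathcal{N}(0,\sigma_0^2I_d)$, and let $\sigma=\varsigma\sigma_0$ for any $\varsigma>0$. Let $P$ be the Random Walk Metropolis kernel targeting $\pi$ with Gaussian proposal $\mathcal{N}(x,\sigma^2d^{-1}I_d)$ from $x$. Then the conductance satisfies $$\kappa(0)\ge 0.00216\,\exp\left\{-\varsigma^2\left[1+2d^{-1/2}+2d^{-1}\right]\right\}\cdot\varsigma d^{-1/2},$$ and hence $$\mathrm{Gap}(P)=\mathrm{Gap}_{\mathrm R}(P)\ge 5.83\times10^{-7}\cdot\exp\left\{-2\varsigma^2\left[1+2d^{-1/2}+2d^{-1}\right]\right\}\cdot\varsigma^2d^{-1}.$$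
   Context: $|\cdot|$ is the Euclidean norm on $\mathbb{R}^d$; $\pi$ denotes both the target probability measure and its Lebesgue density. Random Walk Metropolis kernel: with $Q=\mathcal{N}(0,\sigma^2 I_d)$, $\alpha(x,z)=\min\{1,\pi(x+z)/\pi(x)\}$ and $\alpha(x)=\int\alpha(x,d^{-1/2}z)\,Q(\mathrm{d}z)$, $$P(x,A)=\int \mathbf{1}_A(x+d^{-1/2}z)\,\alpha(x,d^{-1/2}z)\,Q(\mathrm{d}z)+\mathbf{1}_A(x)\,[1-\alpha(x)]$$ for $x\in\mathbb{R}^d$ and $A$ Borel. $P$ is $\pi$-reversible. Conductance: $\kappa(0)=\inf_{A}\dfrac{\pi\otimes P(A\times A^{\complement})}{\pi\otimes\pi(A\times A^{\complement})}$, the infimum being over Borel sets $A$ with $\pi(A)\pi(A^{\complement})>0$, where $\pi\otimes P(A\times B)=\int_A\pi(\mathrm{d}x)P(x,B)$. Spectral gaps: let $L^2_0(\pi)$ be the space of real square-integrable functions with $\pi(f)=0$. The right spectral gap is $\mathrm{Gap}_{\mathrm R}(P)=\inf_{0\neq g\in L^2_0(\pi)}\langle(\mathrm{Id}-P)g,g\rangle/\|g\|_2^2$, and $\mathrm{Gap}(P)=1-\sup\{|\lambda|:\lambda\in\sigma_0(P)\}$ is the (absolute) spectral gap, where $\sigma_0(P)$ is the spectrum of $P$ restricted to $L^2_0(\pi)$. *)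

(* Defs.v *)
From HB Require Import structures.
From mathcomp Require Import all_boot all_order all_algebra.
From mathcomp Require Import all_classical all_reals all_analysis.
From mathcomp Require Import measurable_realfun.

Set Implicit Arguments.
Unset Strict Implicit.
Unset Printing Implicit Defensive.

Import Order.TTheory GRing.Theory Num.Theory.
Import numFieldNormedType.Exports.

Local Open Scope classical_set_scope.
Local Open Scope ring_scope.

(* R^d is d.-tuple R with the product sigma-algebra of the library, which is
   the Borel sigma-algebra. *)

Section vectors.
Context {R : realType} {d : nat}.
Implicit Types x z : d.-tuple R.

Definition tadd x z : d.-tuple R := [tuple tnth x i + tnth z i | i < d].

Definition tscale (c : R) z : d.-tuple R := [tuple c * tnth z i | i < d].

Definition enorm x : R := Num.sqrt (\sum_(i < d) tnth x i ^+ 2).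

Lemma measurable_tadd x : measurable_fun setT (tadd x).
Proof.
apply/measurable_fun_tnthP => i.
rewrite (_ : _ \o _ = fun z => tnth x i + tnth z i); last first.
  by apply/funext => z /=; rewrite tnth_mktuple.
by apply: measurable_funD => //; exact: measurable_tnth.
Qed.

Lemma measurable_tscale c : measurable_fun setT (tscale c).
Proof.
apply/measurable_fun_tnthP => i.
rewrite (_ : _ \o _ = fun z => c * tnth z i); last first.
  by apply/funext => z /=; rewrite tnth_mktuple.
by apply: measurable_funM => //; exact: measurable_tnth.
Qed.

End vectors.

Definition tcons {R : realType} {n : nat} (xt : measurableTypeR R * n.-tuple R) :
  n.+1.-tuple R := [tuple of xt.1 :: xt.2].

Lemma measurable_tcons {R : realType} {n : nat} :
  measurable_fun setT (@tcons R n).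
Proof.
by apply: measurable_cons; [exact: measurable_fst|exact: measurable_snd].
Qed.

Definition cons_measure {R : realType} {n : nat}
    (m : {sigma_finite_measure set (n.-tuple R) -> \bar R}) :
  set (n.+1.-tuple R) -> \bar R :=
  pushforward (@lebesgue_measure R \x m)%E tcons.

Section cons_measure.
Context {R : realType} {n : nat}.
Variable m : {sigma_finite_measure set (n.-tuple R) -> \bar R}.

Let prod_measure :
    {measure set (measurableTypeR R * n.-tuple R)%type -> \bar R} :=
  (@lebesgue_measure R \x m)%E.

Let image_measure : {measure set (n.+1.-tuple R) -> \bar R} :=
  measure_function_pushforward__canonical__measure_function_Measure
    prod_measure measurable_tcons.

HB.instance Definition _ := isMeasure.Build _ _ _ (cons_measure m)
  (measure0 image_measure) (measure_ge0 image_measure)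
  (@measure_semi_sigma_additive _ _ _ image_measure).

Let cons_measure_sigma_finite : sigma_finite setT (cons_measure m).
Proof.
have /sigma_finiteP[F [FT ndF Foo]] := sigma_finiteT (@lebesgue_measure R).
have /sigma_finiteP[G [GT ndG Goo]] := sigma_finiteT m.
pose u (t : n.+1.-tuple R) : measurableTypeR R * n.-tuple R :=
  (tnth t ord0, [tuple of behead t]).
have mu : measurable_fun setT u.
  by apply: measurable_fun_pair; [exact: measurable_tnth|exact: measurable_behead].
have uK xt : u (tcons xt) = xt.
  by case: xt => x t; rewrite /u /=; congr pair; apply/val_inj.
exists (fun k => u @^-1` (F k `*` G k)).
  rewrite -preimage_bigcup (_ : \bigcup_k _ = setT) ?preimage_setT//.
  apply/seteqP; split => // -[x t] _.
  have [i _ Fix] : (\bigcup_k F k) x by rewrite -FT.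
  have [j _ Gjt] : (\bigcup_k G k) t by rewrite -GT.
  exists (maxn i j) => //; split => /=.
    by move: Fix; apply/subsetPset/ndF/leq_maxl.
  by move: Gjt; apply/subsetPset/ndG/leq_maxr.
move=> k; have [mF Fk] := Foo k; have [mG Gk] := Goo k; split.
  by rewrite -[X in measurable X]setTI; apply: mu => //; exact: measurableX.
rewrite /= /cons_measure /pushforward (_ : _ @^-1` _ = F k `*` G k).
  by rewrite product_measure1E// lte_mul_pinfty// ge0_fin_numE.
by rewrite -comp_preimage (_ : u \o tcons = id) ?preimage_id//; exact/funext.
Qed.

HB.instance Definition _ :=
  Measure_isSigmaFinite.Build _ _ _ (cons_measure m) cons_measure_sigma_finite.

End cons_measure.

(* Lebesgue measure on R^d, as an iterated product. *)
Fixpoint lebesgue_tuple (R : realType) (d : nat) :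
    {sigma_finite_measure set (d.-tuple R) -> \bar R} :=
  match d with
  | 0 => @dirac _ _ [tuple] R
  | d'.+1 => cons_measure (lebesgue_tuple R d')
  end.

Section lebesgue_tuple_prod.
Context {R : realType} (g : R -> R).
Hypotheses (mg : measurable_fun setT g) (g0 : forall x, 0 <= g x).

Lemma measurable_tuple_prod n :
  measurable_fun setT (fun t : n.-tuple R => \prod_(i < n) g (tnth t i)).
Proof.
apply: measurable_prod => i _.
by apply: (measurableT_comp mg); exact: measurable_tnth.
Qed.

Let measurable_EFin_tuple_prod n : measurable_fun setT
  (fun t : n.-tuple R => (\prod_(i < n) g (tnth t i))%:E).
Proof. by apply: measurableT_comp => //; exact: measurable_tuple_prod. Qed.

Lemma integral_tuple_prod n :
  (\int[lebesgue_tuple R n]_t (\prod_(i < n) g (tnth t i))%:E =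
   (\int[lebesgue_measure]_x (g x)%:E) ^+ n)%E.
Proof.
have mEg : measurable_fun setT (fun x => (g x)%:E) by exact: measurableT_comp.
elim: n => [|n ih].
  rewrite expe0 [LHS]integral_dirac//; last exact: measurable_EFin_tuple_prod.
  by rewrite diracT mul1e big_ord0.
have prod0 k (t : k.-tuple R) : (0 <= (\prod_(i < k) g (tnth t i))%:E)%E.
  by rewrite lee_fin prodr_ge0.
transitivity (\int[@lebesgue_measure R \x lebesgue_tuple R n]_xt
    (\prod_(i < n.+1) g (tnth (tcons xt) i))%:E)%E.
  rewrite [LHS](ge0_integral_pushforward measurable_tcons)//.
  exact: measurable_EFin_tuple_prod.
transitivity (\int[@lebesgue_measure R]_x \int[lebesgue_tuple R n]_t
    (\prod_(i < n.+1) g (tnth (tcons (x, t)) i))%:E)%E.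
  rewrite fubini_tonelli1//.
  exact: (measurableT_comp (@measurable_EFin_tuple_prod n.+1) measurable_tcons).
transitivity (\int[lebesgue_measure]_x ((g x)%:E *
    (\int[lebesgue_measure]_x (g x)%:E) ^+ n))%E.
  apply: eq_integral => x _; rewrite -ih -ge0_integralZl//.
  - apply: eq_integral => t _; rewrite big_ord_recl EFinM; congr (_ * _%:E)%E.
    by apply: eq_bigr => i _; rewrite tnthS.
  - exact: measurable_EFin_tuple_prod.
  - by rewrite lee_fin.
rewrite ge0_integralZr// ?expeS//.
- by move=> x _; rewrite lee_fin.
- by apply: expe_ge0; apply: integral_ge0 => x _; rewrite lee_fin.
Qed.

End lebesgue_tuple_prod.

Section gaussian.
Context {R : realType} {d : nat}.
Implicit Types (s : R) (x z : d.-tuple R).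

Definition gauss_potential s x : R := enorm x ^+ 2 / (2 * s ^+ 2).

Definition gauss_pdf s x : R :=
  expR (- gauss_potential s x) / Num.sqrt (2 * pi * s ^+ 2) ^+ d.

Lemma gauss_pdf_prod s x :
  gauss_pdf s x = \prod_(i < d) (normal_peak s * normal_fun 0 s (tnth x i)).
Proof.
rewrite big_split/= prodr_const card_ord /gauss_pdf mulrC; congr (_ * _).
  by rewrite -exprVn /normal_peak -[in RHS]mulr_natl [s ^+ 2 * pi]mulrC [in RHS]mulrA.
rewrite /normal_fun -expR_sum; congr expR; rewrite /gauss_potential /enorm sqr_sqrtr; last first.
  by apply: sumr_ge0 => i _; exact: sqr_ge0.
rewrite mulr_suml -sumrN; apply: eq_bigr => i _.
by rewrite subr0 mulNr -[s ^+ 2 *+ 2]mulr_natl.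
Qed.

Lemma gauss_pdf_ge0 s x : 0 <= gauss_pdf s x.
Proof. by rewrite divr_ge0 ?expR_ge0// exprn_ge0. Qed.

Lemma measurable_gauss_pdf s : measurable_fun setT (gauss_pdf s).
Proof.
rewrite (funext (gauss_pdf_prod s)).
apply: (@measurable_tuple_prod R (fun y => normal_peak s * normal_fun 0 s y)).
by apply: measurable_funM => //; exact: measurable_normal_fun.
Qed.

(* N(0, s^2 I_d), for s != 0; when s = 0 the junk value Num.sqrt 0 ^-1 = 0 makes
   the density vanish (for d > 0), so the total mass is at most 1 in all cases. *)
Definition gauss s (A : set (d.-tuple R)) : \bar R :=
  (\int[lebesgue_tuple R d]_(x in A) (gauss_pdf s x)%:E)%E.

Let gauss0 s : gauss s set0 = 0%E.
Proof. by rewrite /gauss integral_set0. Qed.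

Let gauss_ge0 s A : (0 <= gauss s A)%E.
Proof. by apply: integral_ge0 => x _; rewrite lee_fin gauss_pdf_ge0. Qed.

Let gauss_sigma_additive s : semi_sigma_additive (gauss s).
Proof.
move=> F mF tF mUF; rewrite /gauss ge0_integral_bigcup//=.
- by apply: is_cvg_ereal_nneg_natsum_cond => n _ _; exact: gauss_ge0.
- apply: measurable_funTS; apply: measurableT_comp => //.
  exact: measurable_gauss_pdf.
- by move=> x _; rewrite lee_fin gauss_pdf_ge0.
Qed.

HB.instance Definition _ s := isMeasure.Build _ _ _ (gauss s)
  (gauss0 s) (@gauss_ge0 s) (@gauss_sigma_additive s).

Lemma gauss_setT s : s != 0 -> gauss s setT = 1%E.
Proof.
move=> s0; rewrite /gauss; under eq_integral do rewrite gauss_pdf_prod.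
rewrite (@integral_tuple_prod R (fun y => normal_peak s * normal_fun 0 s y)).
- have := integral_normal_pdf 0 s; rewrite normal_pdfE// => ->.
  by rewrite -EFin_expe expr1n.
- by apply: measurable_funM => //; exact: measurable_normal_fun.
- by move=> y; rewrite mulr_ge0 ?normal_peak_ge0 ?normal_fun_ge0.
Qed.

Lemma gauss_setT_le1 s : (gauss s setT <= 1)%E.
Proof.
have [->|s0] := eqVneq s 0; last by rewrite gauss_setT.
rewrite /gauss; under eq_integral do rewrite gauss_pdf_prod.
rewrite (@integral_tuple_prod R (fun y => normal_peak 0 * normal_fun 0 0 y)).
- rewrite integral0_eq => [|x _].
    by rewrite -EFin_expe lee_fin expr0n lern1 leq_b1.
  by rewrite /normal_peak expr0n/= mul0r mul0rn sqrtr0 invr0 mul0r.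
- by apply: measurable_funM => //; exact: measurable_normal_fun.
- by move=> y; rewrite mulr_ge0 ?normal_peak_ge0 ?normal_fun_ge0.
Qed.

End gaussian.

Section random_walk_metropolis.
Context {R : realType} {d : nat}.
Implicit Types (p : d.-tuple R -> R) (s : R) (x z : d.-tuple R).

(* p is the target density; the increment z is already scaled by d^(-1/2), see
   rwm_step. *)
Definition rwm_accept p x z : R := Num.min 1 (p (tadd x z) / p x).

Definition rwm_step z : d.-tuple R := tscale (Num.sqrt d%:R)^-1 z.

Definition rwm_accept_rate p s x : R :=
  \int[gauss s]_z rwm_accept p x (rwm_step z).

Definition rwm p s x (A : set (d.-tuple R)) : \bar R :=
  (\int[gauss s]_z (\1_A (tadd x (rwm_step z)) * rwm_accept p x (rwm_step z))%:E
   + (\1_A x * (1 - rwm_accept_rate p s x))%:E)%E.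

Section rwm_measure.
Variables (s0 s : R) (x : d.-tuple R).

Let prop z := tadd x (rwm_step z).

Let acc z : R := rwm_accept (gauss_pdf s0) x (rwm_step z).

Let measurable_prop : measurable_fun setT prop.
Proof.
exact: (measurableT_comp (measurable_tadd x) (measurable_tscale _)).
Qed.

Let acc_ge0 z : 0 <= acc z.
Proof. by rewrite le_min ler01 divr_ge0 ?gauss_pdf_ge0. Qed.

Let acc_le1 z : acc z <= 1.
Proof. by rewrite ge_min lexx. Qed.

Let measurable_acc : measurable_fun setT acc.
Proof.
apply: measurable_minr => //; apply: measurable_funM => //.
exact: (measurableT_comp (measurable_gauss_pdf s0) measurable_prop).
Qed.

Let integral_acc :
  (\int[gauss s]_z (acc z)%:E = (rwm_accept_rate (gauss_pdf s0) s x)%:E)%E.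
Proof.
rewrite /rwm_accept_rate /Rintegral fineK// ge0_fin_numE.
  apply: (@le_lt_trans _ _ (\int[gauss s]_(z in [set: d.-tuple R]) 1)%E).
    apply: ge0_le_integral => //.
    - by move=> z _; rewrite lee_fin acc_ge0.
    - exact: measurableT_comp.
    - by move=> z _; rewrite lee_fin acc_le1.
  by rewrite integral_cst// mul1e (le_lt_trans (gauss_setT_le1 s))// ltry.
by apply: integral_ge0 => z _; rewrite lee_fin acc_ge0.
Qed.

Let rate_le1 : rwm_accept_rate (gauss_pdf s0) s x <= 1.
Proof.
rewrite -lee_fin -integral_acc.
apply: (@le_trans _ _ (\int[gauss s]_(z in [set: d.-tuple R]) 1)%E).
  apply: ge0_le_integral => //.
  - by move=> z _; rewrite lee_fin acc_ge0.
  - exact: measurableT_comp.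
  - by move=> z _; rewrite lee_fin acc_le1.
by rewrite integral_cst// mul1e gauss_setT_le1.
Qed.

Local Notation P := (rwm (gauss_pdf s0) s x).

Let move A z := (\1_A (prop z) * acc z)%:E.

Let stay A := (\1_A x * (1 - rwm_accept_rate (gauss_pdf s0) s x))%:E.

Let move_ge0 A z : (0 <= move A z)%E.
Proof. by rewrite lee_fin mulr_ge0. Qed.

Let stay_ge0 A : (0 <= stay A)%E.
Proof. by rewrite lee_fin mulr_ge0// subr_ge0. Qed.

Let measurable_move A : measurable A -> measurable_fun setT (move A).
Proof.
move=> mA; apply: measurableT_comp => //; apply: measurable_funM => //.
by apply: (measurableT_comp _ measurable_prop); exact: measurable_indic.
Qed.

Let rwm0 : P set0 = 0%E.
Proof.
rewrite /rwm indic0 mul0r adde0; apply: integral0_eq => z _.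
by rewrite mul0r.
Qed.

Let rwm_ge0 A : (0 <= P A)%E.
Proof.
apply: adde_ge0; last exact: stay_ge0.
by apply: integral_ge0 => z _; exact: move_ge0.
Qed.

Let indic_series (F : (set (d.-tuple R))^nat) y : (forall i, measurable (F i)) ->
  trivIset setT F ->
  (\sum_(k <oo) (\1_(F k) y)%:E = (\1_(\bigcup_k F k) y)%:E :> \bar R)%E.
Proof.
move=> mF tF; have mUF : measurable (\bigcup_k F k) by exact: bigcupT_measurable.
have /cvg_lim := @measure_semi_sigma_additive _ _ _ (@dirac _ _ y R) F mF tF mUF.
by move=> /(_ (@ereal_hausdorff R)) h; rewrite -[RHS]h.
Qed.

Let rwm_sigma_additive : semi_sigma_additive P.
Proof.
move=> F mF tF mUF.
rewrite [X in _ --> X](_ : _ = \sum_(k <oo) P (F k))%E.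
  by apply/cvg_closeP; split; [exact: is_cvg_nneseries|rewrite closeE].
rewrite nneseriesD; last 2 first.
- by move=> k _ _; apply: integral_ge0 => z _; exact: move_ge0.
- by move=> k _ _; exact: stay_ge0.
congr (_ + _)%E.
  rewrite -(integral_nneseries _ _ (fun k => measurable_move (mF k)))//.
  apply: eq_integral => z _; rewrite EFinM -indic_series//.
  rewrite muleC -nneseriesZl; last by move=> *; rewrite lee_fin.
  by apply: eq_eseriesr => k _; rewrite muleC.
rewrite EFinM -indic_series// muleC -nneseriesZl; last by move=> *; rewrite lee_fin.
by apply: eq_eseriesr => k _; rewrite muleC.
Qed.

HB.instance Definition _ := isMeasure.Build _ _ _ P
  rwm0 rwm_ge0 rwm_sigma_additive.

Let rwm_setT : P setT = 1%E.
Proof.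
rewrite /rwm indicT mul1r.
under eq_integral do rewrite mul1r.
by rewrite integral_acc -EFinD addrC subrK.
Qed.

HB.instance Definition _ := Measure_isProbability.Build _ _ _ P rwm_setT.

End rwm_measure.

End random_walk_metropolis.

(* Random Walk Metropolis with target N(0, s0^2 I_d) and proposal
   N(x, s^2 d^-1 I_d), as a family of measures. *)
Definition rwm_gauss (R : realType) (d : nat) (s0 s : R) (x : d.-tuple R) :
  {measure set (d.-tuple R) -> \bar R} := rwm (gauss_pdf s0) s x.

Section gaps.
Context d (T : measurableType d) (R : realType).
Variables (mu : {measure set T -> \bar R}).
Variable (P : T -> {measure set T -> \bar R}).
Implicit Types (f g h : T -> R) (lambda : R).

(* (mu \otimes K)(A x B); mu \otimes mu is the case of the constant kernel. *)
Definition otimes (K : T -> {measure set T -> \bar R}) (A B : set T) : \bar R :=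
  (\int[mu]_(x in A) K x B)%E.

Definition conductance : \bar R :=
  ereal_inf [set (otimes P A (~` A) / otimes (fun=> mu) A (~` A))%E |
    A in [set A | measurable A /\ (0 < mu A * mu (~` A))%E]].

(* An element of L^2_0(mu) is represented by any of its measurable
   representatives; equality in L^2_0(mu) is mu-a.e. equality. *)
Definition L20 : set (T -> R) :=
  [set f | f \in Lfun mu 2%:E /\ \int[mu]_x f x = 0].

Definition l2dot f g : R := \int[mu]_x (f x * g x).

Definition l2norm f : R := fine ('N[mu]_2%:E[EFin \o f])%E.

(* Where f is not P x-integrable the value is irrelevant: for f in L^2(mu) and
   P mu-invariant this only happens on a mu-negligible set. *)
Definition markov_op f : T -> R := fun x => \int[P x]_y f y.

Definition right_gap : \bar R :=
  ereal_inf [set (l2dot (f \- markov_op f) f / l2norm f ^+ 2)%:E |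
    f in [set f | L20 f /\ ~ (f = cst 0 %[ae mu])]].

Definition shifted_op lambda f : T -> R := fun x => lambda * f x - markov_op f x.

(* lambda Id - P is a bijection of L^2_0(mu) with bounded inverse. As L^2_0(mu)
   is a real Hilbert space, lambda ranges over the scalar field R. *)
Definition in_resolvent lambda : Prop :=
  [/\ forall f, L20 f -> shifted_op lambda f = cst 0 %[ae mu] ->
        f = cst 0 %[ae mu],
      forall h, L20 h -> exists2 f, L20 f & shifted_op lambda f = h %[ae mu]
    & exists C : R, forall f, L20 f ->
        l2norm f <= C * l2norm (shifted_op lambda f)].

Definition spectrum0 : set R := [set lambda | ~ in_resolvent lambda].

Definition spectral_gap : \bar R :=
  (1 - ereal_sup [set `|lambda|%:E | lambda in spectrum0])%E.

End gaps.

(* Main.v *)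
From HB Require Import structures.
Require Import Defs.
From mathcomp Require Import all_boot all_order all_algebra.
From mathcomp Require Import all_classical all_reals all_analysis.
From mathcomp Require Import measurable_realfun ring lra.

(* Conductance.  The acceptance rate is at least exp(-vs^2/2)/2, and proposals
   from nearby points overlap in total variation, so P(x, ~A) + P(y, A) is
   bounded below for x in A and y outside A that are closer than a constant
   times sigma/sqrt d.  Hence the points of A and those of ~A with a small escape
   probability are far apart, and the Gaussian isoperimetric inequality for three
   sets bounds from below the measure of the points that escape easily.  The
   latter inequality is obtained by moving x to an independent copy z along
   x cos t + z sin t in n equal steps: each step preserves the Gaussian measure,
   and the squared distance to the first set, capped at delta^2, is semiconcave
   and has a first-order increase only from the third set; then n tends to
   infinity.

   Right spectral gap.  Cheeger's inequality: the coarea formula applied to the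
   squares of the positive and negative parts of f - m, for a median m of f, gives
   a right gap of at least kappa^2 / 8.

   Absolute gap.  P is a positive operator: the Gaussian proposal is a convolution
   square, and min(p(x), p(y)) is the integral over t of 1(t < p(x)) 1(t < p(y)).
   Therefore |P f| <= beta |f| with beta = sup <P f, f> / |f|^2, a Neumann series
   inverts lambda - P for |lambda| > beta, and beta is in the spectrum because
   |(beta - P) f|^2 <= beta <(beta - P) f, f>. *)

Set Implicit Arguments.
Unset Strict Implicit.
Unset Printing Implicit Defensive.

Import Order.TTheory GRing.Theory Num.Theory.
Import numFieldNormedType.Exports.

Local Open Scope classical_set_scope.
Local Open Scope ring_scope.

(** * Lebesgue measure on tuples *)

(** Apart from the factor d^(-1/2) of the step size, every bound is dimension free. In the three-set
    inequality the slope of the squared distance enters only through the one-dimensional Gaussian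
    [dotp p z]; what sees the dimension, the second moment, is of second order in the step and
    disappears in the limit. The acceptance bound a0 = exp(-vs^2/2)/2 enters twice, in the escape
    threshold a0/4 and in the separation (a0/2) * sigma * d^(-1/2). The resulting factor exp(-vs^2)
    is at least the one claimed. The constant is (1/2) * (a0/4) * (a0/8) * (9/16) = (9/4096) *
    exp(-vs^2), with 9/4096 > 0.00216; then 0.00216^2 / 8 = 5.832 * 10^-7. A recurring obstacle is
    that P f has a junk value where f is not integrable. Reversibility and positivity are therefore
    first proved for functions with values in [0, +oo], in forms without subtraction, and carried to
    L^2 through positive and negative parts. *)

Section ge0_integral_unique.
Local Open Scope ereal_scope.
Context d (T : measurableType d) (R : realType).
Variables (m : {measure set T -> \bar R}) (L : (T -> \bar R) -> \bar R).
Hypothesis L_indic : forall A, measurable A -> L (fun x => (\1_A x)%:E) = m A.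
Hypothesis L_add : forall f g, measurable_fun setT f -> measurable_fun setT g ->
  (forall x, 0 <= f x) -> (forall x, 0 <= g x) -> L (f \+ g) = L f + L g.
Hypothesis L_scale : forall (r : R) f, measurable_fun setT f ->
  (forall x, 0 <= f x) -> (0 <= r)%R -> L (fun x => r%:E * f x) = r%:E * L f.
Hypothesis L_lim : forall g : (T -> \bar R)^nat,
  (forall n, measurable_fun setT (g n)) -> (forall n x, 0 <= g n x) ->
  (forall x, nondecreasing_seq (g ^~ x)) ->
  L (fun x => limn (g ^~ x)) = limn (fun n => L (g n)).

Import HBNNSimple.

Let L0 : L (cst 0) = 0.
Proof.
have h : L (fun x => (\1_(@set0 T) x)%:E) = 0 by rewrite L_indic ?measure0.
by rewrite -[RHS]h; congr L; apply/funext => x; rewrite indic0.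
Qed.

Let L_sum (I : Type) (s : seq I) (F : I -> T -> \bar R) :
  (forall i, measurable_fun setT (F i)) -> (forall i x, 0 <= F i x) ->
  L (fun x => \sum_(i <- s) F i x) = \sum_(i <- s) L (F i).
Proof.
move=> mF F0; elim: s => [|i s ih].
  by rewrite big_nil -[RHS]L0; congr L; apply/funext => x; rewrite big_nil.
rewrite big_cons -ih -L_add//.
- by congr L; apply/funext => x /=; rewrite big_cons.
- exact: emeasurable_sum.
- by move=> x; exact: sume_ge0.
Qed.

(** The four hypotheses settle indicators, then nonnegative simple functions, then monotone limits.
    Both [gauss s] and the Metropolis kernel are given only as set functions; this lemma yields
    their integration formulas. *)
Lemma ge0_integral_unique f : measurable_fun setT f -> (forall x, 0 <= f x) ->
  L f = \int[m]_x f x.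
Proof.
move=> mf f0; pose f_ := nnsfun_approx measurableT mf.
have nd_f_ x : nondecreasing_seq (fun n => (f_ n x)%:E).
  by move=> a b ab; rewrite lee_fin; exact/lefP/nd_nnsfun_approx.
have limf : f = fun x => limn (fun n => (f_ n x)%:E).
  by apply/funext => x; apply/esym/cvg_lim => //; exact: cvg_nnsfun_approx.
rewrite limf L_lim//; last 2 first.
- by move=> n; exact/measurable_EFinP.
- by move=> n x; rewrite lee_fin.
rewrite monotone_convergence//; last 2 first.
- by move=> n; exact/measurable_EFinP.
- by move=> n x _; rewrite lee_fin.
congr (limn _); apply/funext => n.
pose s := f_ n.
have sE x : (s x)%:E = \sum_(r <- finmap.enum_fset (fset_set (range s))) (r * \1_(s @^-1` [set r]) x)%:E.
  by rewrite sumEFin fimfunE fsbig_finite.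
have ms r : measurable (s @^-1` [set r]) by exact: measurable_sfunP.
have ge0 r x : 0 <= (r * \1_(s @^-1` [set r]) x)%:E.
  by rewrite EFinM nnfun_muleindic_ge0.
have mM r : measurable_fun setT (fun x => (r * \1_(s @^-1` [set r]) x)%:E).
  by apply/measurable_EFinP; apply: measurable_funM => //; exact: measurable_indic.
transitivity (\sum_(r <- finmap.enum_fset (fset_set (range s))) L (fun x => (r * \1_(s @^-1` [set r]) x)%:E)).
  by rewrite -L_sum//; congr L; apply/funext => x; exact: sE.
under [in RHS]eq_integral do rewrite sE.
rewrite ge0_integral_sum//; apply: eq_bigr => r _.
have [r0|r0] := leP 0%R r.
  under eq_integral do rewrite EFinM.
  rewrite (_ : (fun x => _) = fun x => r%:E * (\1_(s @^-1` [set r]) x)%:E); last first.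
    by apply/funext => x; rewrite EFinM.
  rewrite L_scale//; last by apply/measurable_EFinP; exact: measurable_indic.
  rewrite ge0_integralZl//; last by apply/measurable_EFinP; exact: measurable_indic.
  by rewrite L_indic// integral_indic// setIT.
(* A negative r is out of reach of [L_scale], but it is not a value of the nonnegative function [s],
   so its preimage is empty. *)
have z x : (r * \1_(s @^-1` [set r]) x)%:E = 0.
  by rewrite preimage_nnfun0// indic0 mulr0.
rewrite (_ : (fun x => _) = cst 0); last by apply/funext.
by rewrite L0 integral0_eq.
Qed.

End ge0_integral_unique.

Section lebesgue_tuple_invariance.
Context {R : realType}.
Local Open Scope ereal_scope.

Definition lebesgue_preserving (phi : R -> R) :=
  forall g : R -> \bar R, measurable_fun setT g -> (forall x, 0 <= g x) ->
  \int[lebesgue_measure]_x g (phi x) = \int[lebesgue_measure]_x g x.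

(** The family [phi] is indexed by natural numbers, so that in an induction on d the tail of a tuple
    is handled by the shifted family, with no cast between ordinals. *)
Definition coord_map d (phi : nat -> R -> R) (x : d.-tuple R) : d.-tuple R :=
  [tuple phi i (tnth x i) | i < d].

Lemma measurable_coord_map d (phi : nat -> R -> R) :
  (forall i, measurable_fun setT (phi i)) ->
  measurable_fun setT (@coord_map d phi).
Proof.
move=> mphi; apply/measurable_fun_tnthP => i.
rewrite (_ : _ \o _ = fun z => phi i (tnth z i)); last first.
  by apply/funext => z /=; rewrite tnth_mktuple.
by apply: measurableT_comp => //; exact: measurable_tnth.
Qed.

Lemma ge0_integral_lebesgue_tupleS d (f : d.+1.-tuple R -> \bar R) :
  measurable_fun setT f -> (forall x, 0 <= f x) ->
  \int[lebesgue_tuple R d.+1]_t f t =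
  \int[lebesgue_measure]_x \int[lebesgue_tuple R d]_t f (tcons (x, t)).
Proof.
move=> mf f0.
transitivity (\int[@lebesgue_measure R \x lebesgue_tuple R d]_xt f (tcons xt)).
  exact: (ge0_integral_pushforward measurable_tcons).
rewrite fubini_tonelli1//.
exact: (measurableT_comp mf measurable_tcons).
Qed.

Lemma coord_map_tcons d (phi : nat -> R -> R) (x : R) (t : d.-tuple R) :
  coord_map phi (tcons (x, t)) = tcons (phi 0%N x, coord_map (fun i => phi i.+1) t).
Proof.
apply: eq_from_tnth => i; rewrite tnth_mktuple.
case: (unliftP ord0 i) => [j|] -> /=.
  by rewrite !tnthS tnth_mktuple.
by rewrite !tnth0.
Qed.

Lemma lebesgue_tuple_coord_map d (phi : nat -> R -> R) (f : d.-tuple R -> \bar R) :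
  (forall i, measurable_fun setT (phi i)) -> (forall i, lebesgue_preserving (phi i)) ->
  measurable_fun setT f -> (forall x, 0 <= f x) ->
  \int[lebesgue_tuple R d]_x f (coord_map phi x) = \int[lebesgue_tuple R d]_x f x.
Proof.
elim: d phi f => [|d ih] phi f mphi Lphi mf f0.
  by apply: eq_integral => x _; congr f; rewrite !tuple0; apply/esym/tuple0.
have mfphi : measurable_fun setT (fun x => f (coord_map phi x)).
  by apply: (measurableT_comp mf); exact: measurable_coord_map.
rewrite (ge0_integral_lebesgue_tupleS mfphi) ?(ge0_integral_lebesgue_tupleS mf); last 2 first.
- exact: f0.
- by move=> x; exact: f0.
pose g x := \int[lebesgue_tuple R d]_t f (tcons (x, t)).
have mft x : measurable_fun setT (fun t => f (tcons (x, t))).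
  by apply: (measurableT_comp mf); apply: (measurableT_comp measurable_tcons).
transitivity (\int[lebesgue_measure]_x g (phi 0%N x)).
  apply: eq_integral => x _; under eq_integral do rewrite coord_map_tcons.
  exact: (ih _ (fun t => f (tcons (phi 0%N x, t)))).
apply: Lphi => [|x]; last exact: integral_ge0.
have := @measurable_fun_fubini_tonelli_F _ _ _ _ _ (lebesgue_tuple R d)
  (fun xt : measurableTypeR R * d.-tuple R => f (tcons xt)).
apply; last by [].
exact: (measurableT_comp mf measurable_tcons).
Qed.

(** The image measure gives each half-open interval its length, which characterizes Lebesgue
    measure. *)
Lemma lebesgue_preserving_shift (a : R) : lebesgue_preserving (+%R a).
Proof.
move=> g mg g0.
have ma : measurable_fun setT (+%R a : measurableTypeR R -> measurableTypeR R).
  exact: measurable_funD.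
have /= := @ge0_integral_pushforward _ _ _ _ _ _ ma lebesgue_measure setT g measurableT mg.
rewrite preimage_setT => <-; last by [].
apply: eq_measure_integral => //= A mA _; apply/esym.
apply: (@lebesgue_measure_unique _
  (measure_function_pushforward__canonical__measure_function_Measure lebesgue_measure ma)) => //.
move=> _ [[u v]] _ <- /=.
rewrite /pushforward (_ : _ @^-1` _ = `](u - a)%R, (v - a)%R]%classic); last first.
  by apply/seteqP; split => x /=; rewrite !in_itv/= ltrBlDl lerBrDl.
have e : (v - a - (u - a) = v - u)%R by ring.
by rewrite !lebesgue_measure_itv/= !lte_fin ltrD2r -!EFinD e.
Qed.

Lemma lebesgue_preserving_opp : lebesgue_preserving -%R.
Proof.
move=> g mg g0.
have ma : measurable_fun setT (-%R : measurableTypeR R -> measurableTypeR R).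
  exact: measurable_funN.
have /= := @ge0_integral_pushforward _ _ _ _ _ _ ma lebesgue_measure setT g measurableT mg.
rewrite preimage_setT => <-; last by [].
by apply: eq_measure_integral => //= A mA _; exact: lebesgue_measureN.
Qed.

Lemma lebesgue_tuple_translation d (a : d.-tuple R) (f : d.-tuple R -> \bar R) :
  measurable_fun setT f -> (forall x, 0 <= f x) ->
  \int[lebesgue_tuple R d]_x f (tadd a x) = \int[lebesgue_tuple R d]_x f x.
Proof.
move=> mf f0.
rewrite -[RHS](@lebesgue_tuple_coord_map d (fun i => +%R (nth 0%R a i)))//.
- apply: eq_integral => x _; congr f; apply: eq_from_tnth => i.
  by rewrite !tnth_mktuple (tnth_nth 0%R a).
- by move=> i; exact: measurable_funD.
- by move=> i; exact: lebesgue_preserving_shift.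
Qed.

Lemma lebesgue_tuple_reflection d (f : d.-tuple R -> \bar R) :
  measurable_fun setT f -> (forall x, 0 <= f x) ->
  \int[lebesgue_tuple R d]_x f (tscale (-1) x) = \int[lebesgue_tuple R d]_x f x.
Proof.
move=> mf f0.
rewrite -[RHS](@lebesgue_tuple_coord_map d (fun=> -%R))//.
- by apply: eq_integral => x _; congr f; apply: eq_from_tnth => i;
    rewrite !tnth_mktuple mulN1r.
- by move=> i; exact: lebesgue_preserving_opp.
Qed.

End lebesgue_tuple_invariance.

(** * Gaussian measures *)

Section vector_algebra.
Context {R : realType} {d : nat}.
Implicit Types (x y z : d.-tuple R) (a b c s t : R).

(** The square of [enorm]: without the root, identities between norms are polynomial. *)
Definition sqn x : R := \sum_(i < d) tnth x i ^+ 2.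
Definition dotp x y : R := \sum_(i < d) tnth x i * tnth y i.

Lemma sqn_ge0 x : 0 <= sqn x.
Proof. by apply: sumr_ge0 => i _; exact: sqr_ge0. Qed.

Lemma enorm_sqr x : enorm x ^+ 2 = sqn x.
Proof. by rewrite sqr_sqrtr// sqn_ge0. Qed.

Lemma sqn_tadd x y : sqn (tadd x y) = sqn x + 2 * dotp x y + sqn y.
Proof.
rewrite /sqn /dotp mulr_sumr -!big_split/=; apply: eq_bigr => i _.
by rewrite tnth_mktuple; ring.
Qed.

Lemma sqn_tscale c x : sqn (tscale c x) = c ^+ 2 * sqn x.
Proof.
by rewrite /sqn mulr_sumr; apply: eq_bigr => i _; rewrite tnth_mktuple exprMn.
Qed.

Lemma dotpC x y : dotp x y = dotp y x.
Proof. by apply: eq_bigr => i _; rewrite mulrC. Qed.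

Lemma dotp_taddr x y z : dotp x (tadd y z) = dotp x y + dotp x z.
Proof.
rewrite /dotp -big_split/=; apply: eq_bigr => i _.
by rewrite tnth_mktuple mulrDr.
Qed.

Lemma dotp_tscaler c x y : dotp x (tscale c y) = c * dotp x y.
Proof.
by rewrite /dotp mulr_sumr; apply: eq_bigr => i _; rewrite tnth_mktuple mulrCA.
Qed.

Lemma dotp_taddl x y z : dotp (tadd y z) x = dotp y x + dotp z x.
Proof. by rewrite dotpC dotp_taddr !(dotpC x). Qed.

Lemma dotp_tscalel c x y : dotp (tscale c x) y = c * dotp x y.
Proof. by rewrite dotpC dotp_tscaler dotpC. Qed.

Lemma dotpxx x : dotp x x = sqn x.
Proof. by apply: eq_bigr => i _; rewrite expr2. Qed.

Definition vectE := (sqn_tadd, sqn_tscale, dotp_taddr, dotp_taddl, dotp_tscaler,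
  dotp_tscalel, dotpxx).

Lemma taddC x y : tadd x y = tadd y x.
Proof. by apply: eq_from_tnth => i; rewrite !tnth_mktuple addrC. Qed.

Lemma taddA x y z : tadd x (tadd y z) = tadd (tadd x y) z.
Proof. by apply: eq_from_tnth => i; rewrite !tnth_mktuple addrA. Qed.

Lemma tscaleD a b x : tadd (tscale a x) (tscale b x) = tscale (a + b) x.
Proof. by apply: eq_from_tnth => i; rewrite !tnth_mktuple mulrDl. Qed.

Lemma tscale1 x : tscale 1 x = x.
Proof. by apply: eq_from_tnth => i; rewrite tnth_mktuple mul1r. Qed.

Lemma tadd_tscale0 x y : tadd x (tscale 0 y) = x.
Proof. by apply: eq_from_tnth => i; rewrite !tnth_mktuple mul0r addr0. Qed.

End vector_algebra.

Section vector_measurability.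
Context {R : realType} {d : nat} d' (X : measurableType d').
Implicit Types (f g : X -> d.-tuple R).

Lemma measurable_fun_tadd f g : measurable_fun setT f -> measurable_fun setT g ->
  measurable_fun setT (fun x => tadd (f x) (g x)).
Proof.
move=> mf mg; apply/measurable_fun_tnthP => i.
rewrite (_ : _ \o _ = fun x => tnth (f x) i + tnth (g x) i); last first.
  by apply/funext => z /=; rewrite tnth_mktuple.
by apply: measurable_funD; apply: (measurableT_comp (measurable_tnth _)).
Qed.

Lemma measurable_fun_tscale c f : measurable_fun setT f ->
  measurable_fun setT (fun x => tscale c (f x)).
Proof. by move=> mf; exact: (measurableT_comp (measurable_tscale c)). Qed.

Lemma measurable_fun_dotp f g : measurable_fun setT f -> measurable_fun setT g ->
  measurable_fun setT (fun x => dotp (f x) (g x)).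
Proof.
move=> mf mg; apply: measurable_sum => i.
by apply: measurable_funM; apply: (measurableT_comp (measurable_tnth _)).
Qed.

Lemma measurable_fun_sqn f : measurable_fun setT f ->
  measurable_fun setT (fun x => sqn (f x)).
Proof.
move=> mf; rewrite (_ : (fun _ => _) = fun x => dotp (f x) (f x)).
  exact: measurable_fun_dotp.
by apply/funext => x; rewrite dotpxx.
Qed.

Lemma measurable_fun_gauss_pdf s f : measurable_fun setT f ->
  measurable_fun setT (fun x => gauss_pdf s (f x)).
Proof. by move=> mf; exact: (measurableT_comp (measurable_gauss_pdf s)). Qed.

End vector_measurability.

(** Stated for every s, including 0, so that finiteness and Tonelli's theorem are available for
    [gauss s] unconditionally. *)
HB.instance Definition _ (R : realType) (d : nat) (s : R) :=
  Measure_isSubProbability.Build _ _ _ (@gauss R d s) (gauss_setT_le1 s).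

Section gauss_integral.
Context {R : realType} {d : nat}.
Local Notation T := (d.-tuple R).
Local Notation L := (lebesgue_tuple R d).
Implicit Types (x y z a : T) (s : R).

Lemma ge0_integral_gauss s (f : T -> \bar R) : measurable_fun setT f ->
  (forall x, 0 <= f x)%E ->
  (\int[gauss s]_x f x = \int[L]_x (f x * (gauss_pdf s x)%:E))%E.
Proof.
move=> mf f0; apply/esym.
have mp : measurable_fun setT (fun x : T => (gauss_pdf s x)%:E).
  by apply/measurable_EFinP; exact: measurable_gauss_pdf.
have p0 x : (0 <= (gauss_pdf s x)%:E)%E by rewrite lee_fin gauss_pdf_ge0.
apply: (@ge0_integral_unique _ _ _ (gauss s)
  (fun f => \int[L]_x (f x * (gauss_pdf s x)%:E))%E) => //.
- move=> A mA; rewrite /gauss [RHS]integral_mkcond; apply: eq_integral => x _.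
  by rewrite epatch_indic muleC.
- move=> g h mg mh g0 h0; rewrite -ge0_integralD//.
  + by apply: eq_integral => x _; rewrite ge0_muleDl.
  + by move=> x _; exact: mule_ge0.
  + exact: emeasurable_funM.
  + by move=> x _; exact: mule_ge0.
  + exact: emeasurable_funM.
- move=> r g mg g0 r0; rewrite -ge0_integralZl//.
  + by apply: eq_integral => x _; rewrite muleA.
  + exact: emeasurable_funM.
  + by move=> x _; exact: mule_ge0.
- move=> g mg g0 nd; rewrite -monotone_convergence//.
  + apply: eq_integral => x _; rewrite limeMr//.
    by apply: ereal_nondecreasing_is_cvgn; exact: nd.
  + by move=> n; exact: emeasurable_funM.
  + by move=> n x _; exact: mule_ge0.
  + by move=> x _ n m nm; apply: lee_wpmul2r => //; exact: nd.
Qed.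

Lemma gauss_pdfE s x :
  gauss_pdf s x = expR (- (sqn x / (2 * s ^+ 2))) / Num.sqrt (2 * pi * s ^+ 2) ^+ d.
Proof. by rewrite /gauss_pdf /gauss_potential enorm_sqr. Qed.

Lemma gauss_pdf_gt0 s x : s != 0 -> 0 < gauss_pdf s x.
Proof.
move=> s0; rewrite divr_gt0 ?expR_gt0// exprn_gt0// sqrtr_gt0.
by apply: mulr_gt0; rewrite ?exprn_even_gt0// mulr_gt0// pi_gt0.
Qed.

Lemma integral_gauss_pdf s : s != 0 -> (\int[L]_x (gauss_pdf s x)%:E = 1)%E.
Proof. exact: gauss_setT. Qed.

(** Completing the square: an exponential tilt of a centered Gaussian is a translate of it, up to a
    constant factor. *)
Lemma expR_dotp_gauss_pdf s a x : s != 0 ->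
  expR (dotp a x) * gauss_pdf s x =
  expR (s ^+ 2 * sqn a / 2) * gauss_pdf s (tadd (tscale (- s ^+ 2) a) x).
Proof.
move=> s0; rewrite !gauss_pdfE !mulrA -!expRD; congr (expR _ / _).
by rewrite !vectE; field.
Qed.

Lemma integral_gauss_pdf_tadd s a : s != 0 ->
  (\int[L]_x (gauss_pdf s (tadd a x))%:E = 1)%E.
Proof.
move=> s0; rewrite (lebesgue_tuple_translation a (f := fun x => (gauss_pdf s x)%:E)).
- exact: integral_gauss_pdf.
- by apply/measurable_EFinP; exact: measurable_gauss_pdf.
- by move=> x; rewrite lee_fin gauss_pdf_ge0.
Qed.

Lemma gauss_mgf s a : s != 0 ->
  (\int[gauss s]_x (expR (dotp a x))%:E = (expR (s ^+ 2 * sqn a / 2))%:E)%E.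
Proof.
move=> s0.
have me : measurable_fun setT (fun x : T => (expR (dotp a x))%:E).
  apply/measurable_EFinP; apply: measurableT_comp => //.
  exact: measurable_fun_dotp.
rewrite ge0_integral_gauss//.
under eq_integral do rewrite -EFinM expR_dotp_gauss_pdf// EFinM.
rewrite ge0_integralZl//.
- by rewrite integral_gauss_pdf_tadd// mule1.
- by apply/measurable_EFinP; apply: measurable_fun_gauss_pdf; exact: measurable_tadd.
- by move=> x _; rewrite lee_fin gauss_pdf_ge0.
Qed.

Lemma gauss_pdf_reflection s x : gauss_pdf s (tscale (-1) x) = gauss_pdf s x.
Proof. by rewrite !gauss_pdfE !vectE sqrrN expr1n mul1r. Qed.

Lemma gauss_reflection s (f : T -> \bar R) : measurable_fun setT f ->
  (forall x, 0 <= f x)%E ->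
  (\int[gauss s]_x f (tscale (-1) x) = \int[gauss s]_x f x)%E.
Proof.
move=> mf f0; rewrite !ge0_integral_gauss//; last first.
  by apply: (measurableT_comp mf); exact: measurable_tscale.
under eq_integral do rewrite -(gauss_pdf_reflection s).
rewrite (lebesgue_tuple_reflection (f := fun x => f x * (gauss_pdf s x)%:E)%E)//.
- by apply: emeasurable_funM => //; apply/measurable_EFinP; exact: measurable_gauss_pdf.
- by move=> x; rewrite mule_ge0// lee_fin gauss_pdf_ge0.
Qed.

End gauss_integral.

(** * Rotation invariance of a pair of independent Gaussian vectors *)

Section rotation.
Context {R : realType} {d : nat}.
Local Notation T := (d.-tuple R).
Local Notation L := (lebesgue_tuple R d).
Local Open Scope ereal_scope.

Definition rotation (c s : R) (xz : T * T) : T * T :=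
  (tadd (tscale c xz.1) (tscale s xz.2), tadd (tscale (- s) xz.1) (tscale c xz.2)).

Lemma measurable_rotation c s : measurable_fun setT (rotation c s).
Proof.
by apply: measurable_fun_pair; apply: measurable_fun_tadd;
  apply: measurable_fun_tscale.
Qed.

Lemma lebesgue_shear1 t (H : T * T -> \bar R) : measurable_fun setT H ->
  (forall u, 0 <= H u) ->
  \int[L]_x \int[L]_z H (tadd x (tscale t z), z) = \int[L]_x \int[L]_z H (x, z).
Proof.
move=> mH H0.
have mS : measurable_fun setT (fun xz : T * T => H (tadd xz.1 (tscale t xz.2), xz.2)).
  apply: (measurableT_comp mH); apply: measurable_fun_pair => //.
  by apply: measurable_fun_tadd => //; exact: measurable_fun_tscale.
rewrite (fubini_tonelli (fun xz : T * T => H (tadd xz.1 (tscale t xz.2), xz.2)))//.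
rewrite (fubini_tonelli H)//; apply: eq_integral => z _ /=.
under eq_integral do rewrite taddC.
rewrite (lebesgue_tuple_translation _ (f := fun x => H (x, z)))//.
exact: measurableT_comp.
Qed.

Lemma lebesgue_shear2 t (H : T * T -> \bar R) : measurable_fun setT H ->
  (forall u, 0 <= H u) ->
  \int[L]_x \int[L]_z H (x, tadd z (tscale t x)) = \int[L]_x \int[L]_z H (x, z).
Proof.
move=> mH H0; apply: eq_integral => x _ /=.
under eq_integral do rewrite taddC.
rewrite (lebesgue_tuple_translation _ (f := fun z => H (x, z)))//.
exact: measurableT_comp.
Qed.

(** A rotation by an angle t is a product of three shears with coefficients tan(t/2), - sin t and
    tan(t/2), where tan(t/2) = s / (1 + c). A shear is a translation of one variable while the other
    is fixed, so translation invariance of Lebesgue measure and Tonelli's theorem give rotation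
    invariance. *)
Lemma rotation_shears (c s : R) (t := (s / (1 + c))%R) (x z : T) :
  (c ^+ 2 + s ^+ 2 = 1)%R -> (1 + c != 0)%R ->
  let x1 := tadd x (tscale t z) in let z1 := tadd z (tscale (- s) x1) in
  rotation c s (x, z) = (tadd x1 (tscale t z1), z1).
Proof.
move=> cs c1 x1 z1.
have hs : (s ^+ 2 = (1 - c) * (1 + c))%R by rewrite -subr_sqr expr1n -cs; ring.
have ts : (s * t = 1 - c)%R by rewrite /t mulrA -expr2 hs mulfK.
have tc : (t * (1 + c) = s)%R by rewrite /t mulfVK.
rewrite /rotation /z1 /x1/=; congr pair; apply: eq_from_tnth => i;
  rewrite !tnth_mktuple.
- move: (tnth x i) (tnth z i) => u v.
  rewrite [RHS](_ : _ = (1 - s * t) * u + t * (2 - s * t) * v)%R; last by ring.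
  by have sv : (s * v = t * (1 + c) * v)%R; rewrite ?tc// ts sv; ring.
- move: (tnth x i) (tnth z i) => u v.
  rewrite [RHS](_ : _ = - s * u + (1 - s * t) * v)%R; last by ring.
  by rewrite ts; ring.
Qed.

Lemma lebesgue_rotation (c s : R) (H : T * T -> \bar R) :
  (c ^+ 2 + s ^+ 2 = 1)%R -> (1 + c != 0)%R -> measurable_fun setT H ->
  (forall u, 0 <= H u) ->
  \int[L]_x \int[L]_z H (rotation c s (x, z)) = \int[L]_x \int[L]_z H (x, z).
Proof.
move=> cs c1 mH H0.
under eq_integral do under eq_integral do rewrite rotation_shears//.
set t := (s / (1 + c))%R.
have m1 : measurable_fun setT (fun xz : T * T => (tadd xz.1 (tscale t xz.2), xz.2)).
  apply: measurable_fun_pair => //.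
  by apply: measurable_fun_tadd => //; exact: measurable_fun_tscale.
have m2 : measurable_fun setT (fun xz : T * T => (xz.1, tadd xz.2 (tscale (- s) xz.1))).
  apply: measurable_fun_pair => //.
  by apply: measurable_fun_tadd => //; exact: measurable_fun_tscale.
pose H1 xz := H (tadd xz.1 (tscale t xz.2), xz.2).
have mH1 : measurable_fun setT H1 by exact: (measurableT_comp mH).
pose H2 xz := H1 (xz.1, tadd xz.2 (tscale (- s) xz.1)).
have mH2 : measurable_fun setT H2 by exact: (measurableT_comp mH1).
transitivity (\int[L]_x \int[L]_z H2 (tadd x (tscale t z), z)); first by [].
rewrite lebesgue_shear1//; last by move=> u; exact: H0.
rewrite (lebesgue_shear2 _ (H := H1))//; last by move=> u; exact: H0.
by rewrite (lebesgue_shear1 _ (H := H)).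
Qed.

Lemma sqn_rotation (c s : R) (x z : T) : (c ^+ 2 + s ^+ 2 = 1)%R ->
  (sqn (rotation c s (x, z)).1 + sqn (rotation c s (x, z)).2 = sqn x + sqn z)%R.
Proof.
move=> cs; rewrite /rotation/= !vectE.
rewrite [LHS](_ : _ = (c ^+ 2 + s ^+ 2) * (sqn x + sqn z))%R; last by ring.
by rewrite cs mul1r.
Qed.

Lemma ge0_integral_gauss2 (s0 : R) (G : T * T -> \bar R) :
  measurable_fun setT G -> (forall u, 0 <= G u) ->
  \int[gauss s0]_x \int[gauss s0]_z G (x, z) =
  \int[L]_x \int[L]_z (G (x, z) * (gauss_pdf s0 x * gauss_pdf s0 z)%:E).
Proof.
move=> mG G0.
rewrite ge0_integral_gauss; last 2 first.
- exact: (measurable_fun_fubini_tonelli_F G).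
- by move=> x; exact: integral_ge0.
apply: eq_integral => x _.
rewrite ge0_integral_gauss//; last exact: measurableT_comp.
rewrite -ge0_integralZr//.
- by apply: eq_integral => z _; rewrite -muleA -EFinM [X in (_ * X%:E)](mulrC).
- apply: emeasurable_funM; first exact: measurableT_comp.
  by apply/measurable_EFinP; exact: measurable_gauss_pdf.
- by move=> z _; rewrite mule_ge0// lee_fin gauss_pdf_ge0.
- by rewrite lee_fin gauss_pdf_ge0.
Qed.

(** The product density depends only on [sqn x + sqn z], which a rotation preserves. *)
Lemma gauss_rotation (s0 c s : R) (G : T * T -> \bar R) :
  (c ^+ 2 + s ^+ 2 = 1)%R -> (1 + c != 0)%R -> measurable_fun setT G ->
  (forall u, 0 <= G u) ->
  \int[gauss s0]_x \int[gauss s0]_z G (rotation c s (x, z)) =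
  \int[gauss s0]_x \int[gauss s0]_z G (x, z).
Proof.
move=> cs c1 mG G0.
rewrite (ge0_integral_gauss2 _ (G := G))//.
have mGr : measurable_fun setT (G \o rotation c s).
  exact: (measurableT_comp mG (measurable_rotation c s)).
rewrite (ge0_integral_gauss2 _ mGr); last by move=> u; exact: G0.
pose H u := G u * (gauss_pdf s0 u.1 * gauss_pdf s0 u.2)%:E.
have mH : measurable_fun setT H.
  apply: emeasurable_funM => //; apply/measurable_EFinP.
  by apply: measurable_funM; exact: measurable_fun_gauss_pdf.
have H0 u : 0 <= H u by rewrite mule_ge0// lee_fin mulr_ge0// gauss_pdf_ge0.
transitivity (\int[L]_x \int[L]_z H (rotation c s (x, z))).
  apply: eq_integral => x _; apply: eq_integral => z _; rewrite /H.
  congr (_ * _%:E); rewrite !gauss_pdfE mulrACA [RHS]mulrACA -!expRD.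
  by rewrite -!opprD -!mulrDl sqn_rotation.
exact: lebesgue_rotation.
Qed.

End rotation.

(** * Isoperimetry for three sets *)

Section open_measurable.
Context {R : realType} {d : nat}.
Local Notation T := (d.-tuple R).

Definition cube (x : T) (e : R) : set T :=
  [set y | forall i, `|tnth y i - tnth x i| < e].

Lemma measurable_cube x e : measurable (cube x e).
Proof.
rewrite (_ : cube x e = \bigcap_(i in [set: 'I_d])
    (fun y : T => tnth y i) @^-1` `]tnth x i - e, tnth x i + e[%classic); last first.
  apply/seteqP; split => [y xy i _ /=|y xy i].
    by rewrite in_itv/= -ltr_distlC distrC; exact: xy.
  by have := xy i Logic.I; rewrite /= in_itv/= -ltr_distlC distrC.
apply: fin_bigcap_measurable => // i _.
rewrite -[X in measurable X]setTI; apply: (@measurable_tnth _ _ d i) => //.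
Qed.

(** A set that is open for the sup norm is the union of the rational cubes it contains, and these
    are countably many. *)
Lemma cube_open_measurable (U : set T) :
  (forall x, U x -> exists2 e, 0 < e & cube x e `<=` U) -> measurable U.
Proof.
move=> oU.
pose qc (q : d.-tuple rat) : T := [tuple ratr (tnth q i) | i < d].
pose V (qr : d.-tuple rat * rat) :=
  if `[< cube (qc qr.1) (ratr qr.2) `<=` U >] then cube (qc qr.1) (ratr qr.2) else set0.
rewrite (_ : U = \bigcup_qr V qr).
  apply: countable_bigcupT_measurable => [|qr].
    exact: countableP.
  by rewrite /V; case: ifP => _; [exact: measurable_cube|exact: measurable0].
apply/seteqP; split=> [x Ux|x [qr _]]; last first.
  by rewrite /V; case: ifPn => // /asboolP; apply.
have [e e0 xeU] := oU x Ux.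
have e20 : 0 < e / 2 by rewrite divr_gt0.
have [r] := rat_in_itvoo e20; rewrite in_itv/= => /andP[r0 re].
have hq (i : 'I_d) : exists q, `|tnth x i - ratr q| < ratr r.
  have : tnth x i - ratr r < tnth x i + ratr r by rewrite ltrD2l gtrN.
  move=> /rat_in_itvoo[q]; rewrite in_itv/= -ltr_distlC => h.
  by exists q.
pose q := [tuple xchoose (hq i) | i < d].
have xq : cube (qc q) (ratr r) x.
  by move=> i; rewrite !tnth_mktuple; exact: (xchooseP (hq i)).
(* The point x lies in the rational cube of radius r < e / 2 around q, so every point of that cube
   is within e of x in each coordinate. *)
exists (q, r) => //; rewrite /V ifT//; apply/asboolP => y yq; apply: xeU => i.
rewrite (le_lt_trans (ler_distD (tnth (qc q) i) _ _))//.
rewrite (splitr e); apply: ltrD; apply: (lt_trans _ re); first exact: (yq i).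
by rewrite distrC; exact: (xq i).
Qed.

End open_measurable.

Section capped_distance.
Context {R : realType} {d : nat}.
Local Notation T := (d.-tuple R).
Implicit Types (x y v p : T) (A : set T) (m : R).

Definition tsub x y : T := tadd x (tscale (-1) y).

(** The infimum of this set is the minimum of m and the squared distance to A. Having m among the
    values both caps the distance and keeps the set nonempty when A is empty. *)
Let values A m x : set R := [set r | r = m \/ exists2 a, A a & r = sqn (tsub x a)].

Definition capdist A m x : R := inf (values A m x).

Let values_m A m x : values A m x m. Proof. by left. Qed.

Let has_lb A m x : 0 <= m -> lbound (values A m x) 0.
Proof. by move=> m0 r [->//|[a _ ->]]; exact: sqn_ge0. Qed.

Lemma capdist_ge0 A m x : 0 <= m -> 0 <= capdist A m x.
Proof. by move=> m0; apply: lb_le_inf; [exists m|exact: has_lb]. Qed.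

Lemma capdist_le A m x : 0 <= m -> capdist A m x <= m.
Proof. by move=> m0; apply: ge_inf => //; exists 0; exact: has_lb. Qed.

Lemma capdist_le_sqn A m x a : 0 <= m -> A a -> capdist A m x <= sqn (tsub x a).
Proof.
by move=> m0 Aa; apply: ge_inf; [exists 0; exact: has_lb|right; exists a].
Qed.

Lemma capdist_eq A m x : 0 <= m -> (forall a, A a -> m <= sqn (tsub x a)) ->
  capdist A m x = m.
Proof.
move=> m0 h; apply/eqP; rewrite eq_le capdist_le//=.
by apply: lb_le_inf => [|r [->//|[a Aa ->]]]; [exists m|exact: h].
Qed.

Lemma sqn_tsubxx x : sqn (tsub x x) = 0.
Proof. by rewrite /tsub -{1}(tscale1 x) tscaleD !vectE subrr expr0n mul0r. Qed.

Lemma capdist_eq0 A m x : 0 <= m -> A x -> capdist A m x = 0.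
Proof.
move=> m0 Ax; apply/eqP; rewrite eq_le capdist_ge0// andbT.
by rewrite (le_trans (capdist_le_sqn _ m0 Ax))// sqn_tsubxx.
Qed.

Lemma tsub_tadd x v a : tsub (tadd x v) a = tadd (tsub x a) v.
Proof. by rewrite /tsub -!taddA (taddC v). Qed.

Lemma tadd_tsubxx x v : tadd (tsub x x) v = v.
Proof.
by apply: eq_from_tnth => i; rewrite !tnth_mktuple mulN1r subrr add0r.
Qed.

(* The squared distance is semiconcave, being an infimum of functions with
   constant Hessian. *)
Lemma capdist_semiconcave A m x e : 0 <= m -> 0 < e -> exists2 p, sqn p <= m &
  forall v, capdist A m (tadd x v) <= capdist A m x + 2 * dotp p v + sqn v + e.
Proof.
move=> m0 e0.
have [|r vr rlt] := @inf_adherent _ (values A m x) e e0.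
  by split; [exists m|exists 0; exact: has_lb].
(* If the near-minimal value r is not below the cap, the zero slope [tscale 0 x] works. Otherwise r
   comes from a point a of A and the slope is x - a. The slack e is there because the infimum need
   not be attained. *)
have h0 : m <= r -> exists2 p, sqn p <= m &
  forall v, capdist A m (tadd x v) <= capdist A m x + 2 * dotp p v + sqn v + e.
  move=> mr; exists (tscale 0 x); first by rewrite vectE expr0n mul0r.
  move=> v; rewrite vectE mul0r mulr0 addr0 (le_trans (capdist_le _ _ _))//.
  by rewrite -addrA addrCA ler_wpDl ?sqn_ge0// (le_trans mr)// ltW.
case: vr => [rm|[a Aa ra]]; first by apply: h0; rewrite rm.
have [/h0//|rm] := leP m r.
exists (tsub x a); first by rewrite -ra ltW.
move=> v; rewrite (le_trans (capdist_le_sqn _ m0 Aa))//.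
rewrite tsub_tadd sqn_tadd -ra; have : r <= capdist A m x + e by exact: ltW.
lra.
Qed.

Lemma cube_sqn x e : 0 < e -> exists2 r, 0 < r &
  forall y, cube x r y -> sqn y < sqn x + e.
Proof.
(* For r <= 1, moving a coordinate u by at most r increases its square by at most r * (2 |u| + 1).
   The extra 1 makes K positive when d = 0 and the final inequality strict. *)
move=> e0; pose K := \sum_(i < d) (2 * `|tnth x i| + 1) + 1.
have K0 : 0 < K.
  by rewrite ltr_wpDl// sumr_ge0// => i _; rewrite addr_ge0// mulr_ge0.
exists (Num.min 1 (e / K)); first by rewrite lt_min ltr01 divr_gt0.
move=> y xy; set r := Num.min 1 (e / K) in xy.
have r0 : 0 < r by rewrite lt_min ltr01 divr_gt0.
have r1 : r <= 1 by rewrite ge_min lexx.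
have rK : r * K <= e by rewrite -ler_pdivlMr// ge_min lexx orbT.
apply: (@lt_le_trans _ _ (sqn x + r * K)); last by rewrite lerD2l.
rewrite /K mulrDr mulr1 addrA ltr_pwDr//.
  rewrite mulr_sumr /sqn -big_split/=; apply: ler_sum => i _.
  have /ltW := xy i; move: (tnth x i) (tnth y i) => u w uw.
  rewrite (_ : w = u + (w - u)); last by ring.
  move: (w - u) uw => t tr.
  rewrite sqrrD -addrA lerD2l.
  have : u * t <= `|u| * r.
    by rewrite (le_trans (ler_norm _))// normrM ler_wpM2l.
  have : t ^+ 2 <= r.
    rewrite -(real_normK (num_real t)) (le_trans (_ : _ <= r ^+ 2))//.
      by rewrite ler_sqr ?nnegrE// ltW.
    by rewrite expr2 ger_pMr.
  lra.
Qed.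

(** An infimum of continuous functions is upper semicontinuous: its strict sublevel sets are
    open. *)
Lemma measurable_capdist A m : 0 <= m -> measurable_fun setT (capdist A m).
Proof.
move=> m0; apply: (measurability _ (RGenInftyO.measurableE R)) => _ [_ [b ->] <-].
rewrite setTI; apply: cube_open_measurable => x /=.
rewrite in_itv/= => xb; have xb0 : 0 < b - capdist A m x by rewrite subr_gt0.
have [|r [rm|[a Aa ra]] rb] := @inf_adherent _ (values A m x) _ xb0.
- by split; [exists m|exists 0; exact: has_lb].
- exists 1 => // y _ /=; rewrite in_itv/= (le_lt_trans (capdist_le _ _ _))//.
  by move: rb; rewrite rm addrC subrK.
have e0 : 0 < b - sqn (tsub x a).
  by rewrite subr_gt0 -ra; move: rb; rewrite addrC subrK.
have [e e_gt0 xe] := cube_sqn (tsub x a) e0.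
exists e => // y xy /=; rewrite in_itv/= (le_lt_trans (capdist_le_sqn _ m0 Aa))//.
rewrite -[ltRHS](subrK (sqn (tsub x a))) addrC xe// => i.
by rewrite !tnth_mktuple opprD addrACA subrr addr0; exact: xy.
Qed.

End capped_distance.

Section trigo.
Context {R : realType}.

Lemma sin_le_id (x : R) : 0 <= x -> sin x <= x.
Proof.
move=> x0.
have [y _] := @MVT_segment R sin cos 0 x x0 (fun y _ => is_derive_sin y)
  (continuous_subspaceT (@continuous_sin R)).
by rewrite sin0 !subr0 => ->; rewrite -[leRHS]mul1r ler_wpM2r// cos_le1.
Qed.

End trigo.

Section gauss_moments.
Context {R : realType} {d : nat}.
Local Notation T := (d.-tuple R).
Local Open Scope ereal_scope.

(** From u <= 4 s^2 exp(u / (4 s^2)) with u = |x|^2, the integrand is at most C times the density of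
    N(0, 2 s^2 I); C contains the ratio of the two normalizations. Finiteness is enough, as this
    moment only multiplies a term that tends to 0. *)
Lemma gauss_sqn_lty (s : R) : (0 < s)%R -> \int[gauss s]_(x in [set: T]) (sqn x)%:E < +oo.
Proof.
move=> s0; have sn0 : s != 0%R by rewrite gt_eqF.
pose s2 := (Num.sqrt 2 * s)%R.
have s20 : (0 < s2)%R by rewrite mulr_gt0// sqrtr_gt0.
have s2n0 : s2 != 0%R by rewrite gt_eqF.
have s22 : (s2 ^+ 2 = 2 * s ^+ 2)%R by rewrite exprMn sqr_sqrtr.
pose C := (4 * s ^+ 2 * (Num.sqrt (2 * pi * s2 ^+ 2) ^+ d / Num.sqrt (2 * pi * s ^+ 2) ^+ d))%R.
have C0 : (0 <= C)%R by rewrite mulr_ge0 ?divr_ge0 ?exprn_ge0 ?sqrtr_ge0// mulr_ge0// sqr_ge0.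
have msq : measurable_fun setT (fun x : T => (sqn x)%:E).
  by apply/measurable_EFinP; exact: measurable_fun_sqn.
rewrite ge0_integral_gauss//; last by move=> x; rewrite lee_fin sqn_ge0.
apply: (@le_lt_trans _ _ (\int[lebesgue_tuple R d]_x (C%:E * (gauss_pdf s2 x)%:E))).
  apply: ge0_le_integral => //.
  - by move=> x _; rewrite mule_ge0// lee_fin ?sqn_ge0// gauss_pdf_ge0.
  - by apply: emeasurable_funM => //; apply/measurable_EFinP; exact: measurable_gauss_pdf.
  - by apply: measurable_funeM; apply/measurable_EFinP; exact: measurable_gauss_pdf.
  move=> x _; rewrite -!EFinM lee_fin !gauss_pdfE s22.
  set N := (Num.sqrt (2 * pi * s ^+ 2) ^+ d)%R; set u := sqn x.
  have N2 : (Num.sqrt (2 * pi * s2 ^+ 2) ^+ d != 0)%R.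
    rewrite expf_neq0// gt_eqF// sqrtr_gt0 mulr_gt0 ?mulr_gt0 ?pi_gt0//.
  rewrite /C s22 -/N.
  move: N2; rewrite s22; set M := (Num.sqrt _ ^+ d)%R => M0.
  rewrite [leRHS](_ : _ = 4 * s ^+ 2 * expR (- (u / (2 * (2 * s ^+ 2)))) / N)%R; last first.
    by move: (expR _) (N^-1)%R => e n; field.
  rewrite [leLHS]mulrA ler_wpM2r ?invr_ge0 ?exprn_ge0 ?sqrtr_ge0//.
  rewrite (_ : - (u / (2 * s ^+ 2)) =
    - (u / (2 * (2 * s ^+ 2))) - u / (4 * s ^+ 2))%R; last by field.
  rewrite expRD mulrCA [leRHS]mulrC ler_wpM2l ?expR_ge0//.
  rewrite expRN ler_pdivrMr ?expR_gt0// -ler_pdivrMl ?mulr_gt0 ?exprn_gt0//.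
  by rewrite mulrC (le_trans _ (expR_ge1Dx _))// lerDr.
rewrite ge0_integralZl//; last 2 first.
- by apply/measurable_EFinP; exact: measurable_gauss_pdf.
- by move=> x _; rewrite lee_fin gauss_pdf_ge0.
by rewrite integral_gauss_pdf// mule1 ltry.
Qed.

(* From u <= exp (u - 1) and the moment generating function. *)
Lemma gauss_dotp_pos_le (s k : R) (p : T) : (0 < s)%R -> (0 < k)%R ->
  (sqn p <= k ^+ 2)%R ->
  \int[gauss s]_z (Num.max 0 (dotp p z))%:E <= (s * k * expR (- 2^-1))%:E.
Proof.
move=> s0 k0 pk; have sn0 : s != 0%R by rewrite gt_eqF.
have sk0 : (0 < s * k)%R by rewrite mulr_gt0.
pose q := tscale (s * k)^-1 p.
have mq : measurable_fun setT (fun z : T => (expR (dotp q z))%:E).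
  by apply/measurable_EFinP; apply: measurableT_comp => //; exact: measurable_fun_dotp.
apply: (@le_trans _ _ (\int[gauss s]_z ((s * k * expR (-1))%:E * (expR (dotp q z))%:E))).
  apply: ge0_le_integral => //.
  - by move=> z _; rewrite lee_fin le_max lexx.
  - apply/measurable_EFinP; apply: measurable_maxr => //.
    exact: measurable_fun_dotp.
  - exact: measurable_funeM.
  move=> z _; rewrite -EFinM lee_fin.
  rewrite -[leRHS]mulrA.
  rewrite -expRD /q dotp_tscalel.
  rewrite ge_max; apply/andP; split; first by rewrite mulr_ge0 ?expR_ge0// ltW.
  set u := dotp p z.
  rewrite -[leLHS](mulVKf (lt0r_neq0 sk0)); apply: ler_wpM2l; first exact: ltW.
  by apply: le_trans (expR_ge1Dx _); rewrite addrA subrr add0r.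
rewrite ge0_integralZl//; last by rewrite lee_fin mulr_ge0 ?expR_ge0// ltW.
rewrite gauss_mgf// -EFinM lee_fin -[leLHS]mulrA -expRD ler_wpM2l ?(ltW sk0)// ler_expR.
rewrite /q sqn_tscale.
have : (s ^+ 2 * ((s * k)^-1 ^+ 2 * sqn p) <= 1)%R.
  rewrite [leLHS](_ : _ = sqn p / k ^+ 2)%R; last by field; rewrite sn0 gt_eqF.
  by rewrite ler_pdivrMr ?exprn_gt0// mul1r.
lra.
Qed.

End gauss_moments.

Section gauss_three_set.
Context {R : realType} {d : nat}.
Local Notation T := (d.-tuple R).
Variables (s0 delta : R) (A1 A2 : set T).
Hypotheses (s0_gt0 : 0 < s0) (delta_gt0 : 0 < delta).
Hypotheses (mA1 : measurable A1) (mA2 : measurable A2).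
Hypothesis sep : forall x y, A1 x -> A2 y -> delta ^+ 2 <= sqn (tsub y x).

Let A3 := ~` (A1 `|` A2).
Let m := delta ^+ 2.
Let F := capdist A1 m.
Let m0 : 0 <= m. Proof. exact: sqr_ge0. Qed.
Let mF : measurable_fun setT F. Proof. exact: measurable_capdist. Qed.
Let mA3 : measurable A3. Proof. by apply: measurableC; exact: measurableU. Qed.
Let s0n0 : s0 != 0. Proof. by rewrite gt_eqF. Qed.

(** Taking the positive part keeps all integrands nonnegative; increases along a path then add up to
    an inequality rather than an equality. *)
Let rise (c s : R) (u : T * T) : R :=
  Num.max 0 (F (tadd (tscale c u.1) (tscale s u.2)) - F u.1).

Let measurable_rise c s : measurable_fun setT (rise c s).
Proof.
apply: measurable_maxr => //; apply: measurable_funB.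
  apply: (measurableT_comp mF); apply: measurable_fun_tadd;
  exact: measurable_fun_tscale.
exact: (measurableT_comp mF).
Qed.

Let rise_ge0 c s u : 0 <= rise c s u. Proof. by rewrite le_max lexx. Qed.

Let dotp_lb (p x : T) : - (sqn p + sqn x) <= 2 * dotp p x.
Proof. by have := sqn_ge0 (tadd p x); rewrite sqn_tadd; lra. Qed.

Let sqn_tadd_le (p x : T) : sqn (tadd p x) <= 2 * sqn p + 2 * sqn x.
Proof.
have := sqn_ge0 (tsub p x); rewrite sqn_tadd /tsub !vectE => h.
have -> : sqn x = (-1) ^+ 2 * sqn x by rewrite sqrrN expr1n mul1r.
lra.
Qed.

(** The bound [m * \1_A3 x] forces the slope p to vanish outside A3. Indeed F is 0 on A1 and grows
    from there at most like the squared displacement, while on A2 it equals its cap and cannot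
    increase. On A3 the slope is that of semiconcavity. *)
Let rise_le c s x : 0 <= c -> 0 < s -> c ^+ 2 + s ^+ 2 = 1 ->
  exists2 p, sqn p <= m * \1_A3 x & forall z,
  rise c s (x, z) <= 2 * s * Num.max 0 (dotp p z) +
    s ^+ 2 * (m + 1 + 3 * sqn x + 2 * sqn z).
Proof.
move=> c0 s_gt0 cs.
have s2_gt0 : 0 < s ^+ 2 by rewrite exprn_gt0.
have c1 : c <= 1.
  by rewrite -(@ler_sqr _ c 1) ?nnegrE// expr1n -cs lerDl ltW.
(* The displacement is (c - 1) x + s z; its part along x is of second order in s. *)
have c1s : 1 - c <= s ^+ 2.
  by rewrite (_ : s ^+ 2 = (1 - c) * (1 + c)); nra.
pose v z := tadd (tscale (c - 1) x) (tscale s z).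
have vE z : tadd (tscale c x) (tscale s z) = tadd x (v z).
  by rewrite /v taddA -{2}(tscale1 x) tscaleD addrC subrK.
have sqn_v z : sqn (v z) <= s ^+ 2 * (2 * sqn x + 2 * sqn z).
  rewrite (le_trans (sqn_tadd_le _ _))// !sqn_tscale.
  by have := sqn_ge0 x; have := sqn_ge0 z; nra.
pose K (z : T) := s ^+ 2 * (m + 1 + 3 * sqn x + 2 * sqn z).
have K0 z : 0 <= K z.
  apply: mulr_ge0; first exact: ltW.
  by have := sqn_ge0 x; have := sqn_ge0 z; move: m0; lra.
have noslope : (forall z, F (tadd x (v z)) - F x <= sqn (v z)) ->
  exists2 p, sqn p <= m * \1_A3 x & forall z,
  rise c s (x, z) <= 2 * s * Num.max 0 (dotp p z) + K z.
  move=> h; exists (tscale 0 x).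
    by rewrite sqn_tscale expr0n mul0r mulr_ge0.
  move=> z; rewrite dotp_tscalel mul0r maxxx mulr0 add0r ge_max K0/= vE.
  rewrite (le_trans (h z))// (le_trans (sqn_v z))// ler_wpM2l ?(ltW s2_gt0)//.
  by have := sqn_ge0 x; move: m0; lra.
have [A1x|A1x] := pselect (A1 x).
  apply: noslope => z; rewrite /F (capdist_eq0 m0 A1x) subr0.
  by rewrite (le_trans (capdist_le_sqn _ m0 A1x))// tsub_tadd tadd_tsubxx.
have [A2x|A2x] := pselect (A2 x).
  apply: noslope => z; rewrite (le_trans _ (sqn_ge0 _))// subr_le0.
  rewrite /F [leRHS](capdist_eq m0) ?capdist_le// => a A1a; exact: sep.
(* The slack of the infimum is chosen as [s ^+ 2], the order of the error term. *)
have [p pm h] := capdist_semiconcave A1 x m0 s2_gt0.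
have -> : \1_A3 x = 1 :> R by rewrite indicE mem_set// => -[].
rewrite mulr1; exists p => // z; rewrite ge_max; apply/andP; split.
  apply: addr_ge0; last exact: K0.
  by rewrite mulr_ge0 ?le_max ?lexx// mulr_ge0// ltW.
rewrite vE /=; have := h (v z); have := sqn_v z; have := dotp_lb p x.
rewrite dotp_taddr !dotp_tscaler /=.
set M := Num.max 0 (dotp p z).
have : dotp p z <= M by rewrite le_max lexx orbT.
have := sqn_ge0 x; have := sqn_ge0 p; rewrite -/F.
move: M (dotp p z) (dotp p x) (sqn (v z)) pm => {}M a b w.
move: (F _) (F _) (sqn p) (sqn x) (sqn z) => f2 f1 p2 x2 z2 pm p20 x20 *.
(* The inner product of p and x can have either sign, but its coefficient is of order s^2 and 2
   |p.x| <= |p|^2 + |x|^2, so it belongs to the error term. *)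
suff : 2 * (c - 1) * b <= s ^+ 2 * (m + x2) by nra.
have : 2 * (c - 1) * b <= (1 - c) * (p2 + x2) by nra.
have : (1 - c) * (p2 + x2) <= s ^+ 2 * (p2 + x2) by rewrite ler_wpM2r// addr_ge0.
have : s ^+ 2 * (p2 + x2) <= s ^+ 2 * (m + x2) by rewrite ler_wpM2l ?(ltW s2_gt0)// lerD2r.
lra.
Qed.

Local Notation g := (@gauss R d s0).
Let e2 := expR (- 2^-1) : R.

Local Open Scope ereal_scope.

Let M2 : R := fine (\int[g]_x (sqn x)%:E).

Let M2E : \int[g]_x (sqn x)%:E = M2%:E.
Proof.
rewrite fineK// ge0_fin_numE; first exact: gauss_sqn_lty.
by apply: integral_ge0 => x _; rewrite lee_fin sqn_ge0.
Qed.

Let g1 : g setT = 1. Proof. exact: gauss_setT. Qed.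

Let gcst (a : R) : \int[g]_(x in [set: T]) a%:E = a%:E.
Proof. by rewrite integral_cst// [X in _ * X]g1 mule1. Qed.

Let msqn : measurable_fun setT (fun x : T => (sqn x)%:E).
Proof. by apply/measurable_EFinP; exact: measurable_fun_sqn. Qed.

Let mrise c s : measurable_fun setT (fun u => (rise c s u)%:E).
Proof. by apply/measurable_EFinP; exact: measurable_rise. Qed.

Let rise_inner c s x : (0 <= c)%R -> (0 < s)%R -> (c ^+ 2 + s ^+ 2 = 1)%R ->
  \int[g]_z (rise c s (x, z))%:E <=
  (2 * s * (s0 * delta * e2))%:E * (\1_A3 x)%:E +
  (s ^+ 2)%:E * ((m + 1 + 2 * M2)%:E + 3%:E * (sqn x)%:E).
Proof.
move=> c0 s_gt0 cs.
have s2_ge0 : (0 <= s ^+ 2)%R by exact: sqr_ge0.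
have [p pA h] := rise_le x c0 s_gt0 cs.
have mp : measurable_fun setT (fun z : T => (Num.max 0 (dotp p z))%:E).
  by apply/measurable_EFinP; apply: measurable_maxr => //; exact: measurable_fun_dotp.
have p0 (z : T) : 0 <= (Num.max 0 (dotp p z))%:E by rewrite lee_fin le_max lexx.
have ip : \int[g]_z (Num.max 0 (dotp p z))%:E <= (s0 * delta * e2)%:E * (\1_A3 x)%:E.
  have [A3x|A3x] := pselect (A3 x).
    rewrite indicE mem_set// mule1; apply: gauss_dotp_pos_le => //.
    by rewrite (le_trans pA)// indicE mem_set// mulr1.
  have : (sqn p <= 0)%R by rewrite (le_trans pA)// indicE memNset// mulr0.
  move=> p00; rewrite indicE memNset// mule0.
  suff: forall z, dotp p z = 0%R.
    by move=> dz; rewrite integral0_eq// => z _; rewrite dz maxxx.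
  move=> z; apply: big1 => i _.
  suff -> : tnth p i = 0%R by rewrite mul0r.
  apply/eqP; rewrite -sqrf_eq0 eq_le sqr_ge0 andbT (le_trans _ p00)//.
  by rewrite /sqn (bigD1 i)//= lerDl sumr_ge0// => j _; exact: sqr_ge0.
pose a := (s ^+ 2 * (m + 1 + 3 * sqn x))%R.
have a0 : (0 <= a)%R.
  by apply: mulr_ge0 => //; have := sqn_ge0 x; move: m0; lra.
apply: (@le_trans _ _ (\int[g]_z ((2 * s)%:E * (Num.max 0 (dotp p z))%:E +
   (a%:E + (2 * s ^+ 2)%:E * (sqn z)%:E)))).
  apply: ge0_le_integral => //.
  - by move=> z _; rewrite lee_fin.
  - exact: (measurableT_comp (mrise c s)).
  - apply: emeasurable_funD; first exact: measurable_funeM.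
    by apply: emeasurable_funD => //; exact: measurable_funeM.
  - move=> z _; rewrite -!EFinM -!EFinD lee_fin (le_trans (h z))// lerD2l /a.
    by rewrite le_eqVlt; apply/orP; left; apply/eqP; ring.
rewrite ge0_integralD//; last 4 first.
- by move=> z _; rewrite mule_ge0// lee_fin mulr_ge0// ltW.
- exact: measurable_funeM.
- by move=> z _; rewrite adde_ge0// mule_ge0// lee_fin ?sqn_ge0// mulr_ge0.
- by apply: emeasurable_funD => //; exact: measurable_funeM.
rewrite ge0_integralD//; last 2 first.
- by move=> z _; rewrite mule_ge0// lee_fin ?sqn_ge0// mulr_ge0.
- exact: measurable_funeM.
rewrite ge0_integralZl//; last by rewrite lee_fin mulr_ge0// ltW.
rewrite ge0_integralZl//; last 2 first.
- by move=> z _; rewrite lee_fin sqn_ge0.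
- by rewrite lee_fin mulr_ge0.
rewrite gcst M2E; apply: leeD.
  rewrite [leRHS](_ : _ = (2 * s)%:E * ((s0 * delta * e2)%:E * (\1_A3 x)%:E)); last first.
    by rewrite EFinM -muleA.
  apply: lee_wpmul2l => //.
  by rewrite lee_fin mulr_ge0// ltW.
rewrite -!EFinM -!EFinD -?EFinM lee_fin /a.
by rewrite le_eqVlt; apply/orP; left; apply/eqP; ring.
Qed.

Let K : R := (m + 1 + 5 * M2)%R.

Let rise_outer c s : (0 <= c)%R -> (0 < s)%R -> (c ^+ 2 + s ^+ 2 = 1)%R ->
  \int[g]_x \int[g]_z (rise c s (x, z))%:E <=
  (2 * s * (s0 * delta * e2))%:E * g A3 + (s ^+ 2 * K)%:E.
Proof.
move=> c0 s_gt0 cs.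
have M20 : (0 <= M2)%R.
  by rewrite -lee_fin -M2E; apply: integral_ge0 => x _; rewrite lee_fin sqn_ge0.
have C0 : 0 <= (2 * s * (s0 * delta * e2))%:E.
  by rewrite lee_fin !mulr_ge0 ?expR_ge0// ltW.
have b0 : (0 <= m + 1 + 2 * M2)%R by move: m0 M20; lra.
have m1 : measurable_fun setT (fun x : T => (\1_A3 x : R)%:E).
  by apply/measurable_EFinP; exact: measurable_indic.
have m2 : measurable_fun setT (fun x : T => 3%:E * (sqn x)%:E).
  exact: measurable_funeM.
have s3 (x : T) : 0 <= 3%:E * (sqn x)%:E by rewrite mule_ge0// lee_fin sqn_ge0.
apply: (@le_trans _ _ (\int[g]_x ((2 * s * (s0 * delta * e2))%:E * (\1_A3 x)%:E +
  (s ^+ 2)%:E * ((m + 1 + 2 * M2)%:E + 3%:E * (sqn x)%:E)))).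
  apply: ge0_le_integral => //.
  - by move=> x _; apply: integral_ge0 => z _; rewrite lee_fin.
  - apply: (measurable_fun_fubini_tonelli_F (fun u => (rise c s u)%:E)) => //.
    by move=> u; rewrite lee_fin.
  - apply: emeasurable_funD; first exact: measurable_funeM.
    by apply: measurable_funeM; exact: emeasurable_funD.
  - by move=> x _; exact: rise_inner.
rewrite ge0_integralD//; last 4 first.
- by move=> x _; rewrite mule_ge0// lee_fin.
- exact: measurable_funeM.
- move=> x _; apply: mule_ge0; first by rewrite lee_fin sqr_ge0.
  exact: adde_ge0.
- by apply: measurable_funeM; exact: emeasurable_funD.
rewrite ge0_integralZl//.
rewrite integral_indic// setIT; apply: leeD => //.
rewrite ge0_integralZl//; last 3 first.
- exact: emeasurable_funD.
- by move=> x _; rewrite adde_ge0.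
- by rewrite lee_fin sqr_ge0.
rewrite ge0_integralD// ge0_integralZl//; last by move=> x _; rewrite lee_fin sqn_ge0.
rewrite gcst M2E !(=^~ EFinM, =^~ EFinD) lee_fin /K.
by rewrite le_eqVlt; apply/orP; left; apply/eqP; ring.
Qed.

(** Along the path cos(k t) x + sin(k t) z, each step is [rise (cos t) (sin t)] evaluated at the
    rotated pair [X k]. By rotation invariance all n steps have the same mean, that of the first
    one. *)
Let telescope n t : (0 < n)%N -> (n%:R * t = pi / 2)%R ->
  \int[g]_x \int[g]_z (rise (cos (pi / 2)) (sin (pi / 2)) (x, z))%:E <=
  n%:R%:E * \int[g]_x \int[g]_z (rise (cos t) (sin t) (x, z))%:E.
Proof.
move=> n0 nt.
have nR0 : (0 < n%:R :> R)%R by rewrite ltr0n.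
have t0 : (0 < t)%R by rewrite -(pmulr_rgt0 _ nR0) nt divr_gt0// pi_gt0.
pose X k (u : T * T) := rotation (cos (k%:R * t)) (sin (k%:R * t)) u.
have X0 u : (X 0%N u).1 = u.1.
  by rewrite /X mul0r cos0 sin0 /rotation/= tscale1 tadd_tscale0.
have XS k u : rise (cos t) (sin t) (X k u) =
    Num.max 0%R (F (X k.+1 u).1 - F (X k u).1)%R.
  rewrite /rise; congr (Num.max _ (F _ - _))%R.
  rewrite /X -natr1 mulrDl mul1r cosD sinD /rotation/=.
  by apply: eq_from_tnth => i; rewrite !tnth_mktuple; ring.
have mX k : measurable_fun setT (X k) by exact: measurable_rotation.
have tele k u : (Num.max 0 (F (X k u).1 - F u.1) <=
    \sum_(i < k) rise (cos t) (sin t) (X i u))%R.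
  elim: k => [|k ih]; first by rewrite big_ord0 X0 subrr maxxx.
  rewrite big_ord_recr/= XS ge_max; apply/andP; split.
    by rewrite addr_ge0 ?le_max ?lexx// sumr_ge0.
  rewrite (_ : F (X k.+1 u).1 - F u.1 =
    (F (X k u).1 - F u.1) + (F (X k.+1 u).1 - F (X k u).1))%R; last by ring.
  rewrite lerD// ?le_max ?lexx ?orbT// (le_trans _ ih)// le_max lexx orbT//.
have mr k : measurable_fun setT (fun u => (rise (cos t) (sin t) (X k u))%:E).
  exact: (measurableT_comp (mrise (cos t) (sin t)) (mX k)).
have inv k : (k < n)%N -> \int[g]_x \int[g]_z (rise (cos t) (sin t) (X k (x, z)))%:E =
    \int[g]_x \int[g]_z (rise (cos t) (sin t) (x, z))%:E.
  move=> kn; apply: (@gauss_rotation _ _ s0 _ _ (fun u => (rise (cos t) (sin t) u)%:E)) => //.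
  - exact: cos2Dsin2.
  - rewrite gt_eqF// ltr_wpDr//; apply: cos_ge0_pihalf; apply/andP; split.
      apply: (@le_trans _ _ 0%R); first by rewrite oppr_le0 divr_ge0// pi_ge0.
      by rewrite mulr_ge0// ltW.
    by rewrite -nt ler_wpM2r ?(ltW t0)// ler_nat ltnW.
  - by move=> u; rewrite lee_fin.
apply: (@le_trans _ _ (\int[g]_x \int[g]_z
    \sum_(i < n) (rise (cos t) (sin t) (X i (x, z)))%:E)).
  have mS : measurable_fun setT (fun u =>
      \sum_(i < n) (rise (cos t) (sin t) (X i u))%:E).
    exact: emeasurable_sum.
  have mR := mrise (cos (pi / 2)) (sin (pi / 2)).
  have S0 u : 0 <= \sum_(i < n) (rise (cos t) (sin t) (X i u))%:E.
    by apply: sume_ge0 => i _; rewrite lee_fin.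
  apply: ge0_le_integral => //.
  - by move=> x _; apply: integral_ge0 => z _; rewrite lee_fin.
  - apply: (measurable_fun_fubini_tonelli_F (fun u => (rise (cos (pi / 2)) (sin (pi / 2)) u)%:E)) => //.
    by move=> u; rewrite lee_fin.
  - exact: (measurable_fun_fubini_tonelli_F (fun u =>
      \sum_(i < n) (rise (cos t) (sin t) (X i u))%:E)).
  move=> x _; apply: ge0_le_integral => //.
  - by move=> z _; rewrite lee_fin.
  - exact: (measurableT_comp mR).
  - exact: (measurableT_comp mS).
  move=> z _; rewrite sumEFin lee_fin (le_trans _ (tele n (x, z)))//.
  by rewrite /X nt.
under eq_integral => x _.
  rewrite ge0_integral_sum//; last 2 first.
  - by move=> i; exact: (measurableT_comp (mr i)).
  - by move=> i z _; rewrite lee_fin.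
  over.
rewrite ge0_integral_sum//; last 2 first.
- move=> i; apply: (measurable_fun_fubini_tonelli_F (fun u =>
    (rise (cos t) (sin t) (X i u))%:E)) => //.
  by move=> u; rewrite lee_fin.
- by move=> i x _; apply: integral_ge0 => z _; rewrite lee_fin.
under eq_bigr do rewrite inv//.
by rewrite sumr_const card_ord mule_natl.
Qed.

(** The quarter turn replaces x by the independent copy z. If x is in A1 and z in A2, then F goes
    from 0 to delta^2. *)
Let rise_pihalf : (delta ^+ 2)%:E * (g A1 * g A2) <=
  \int[g]_x \int[g]_z (rise (cos (pi / 2)) (sin (pi / 2)) (x, z))%:E.
Proof.
have mi1 : measurable_fun setT (fun x : T => (\1_A1 x : R)%:E).
  by apply/measurable_EFinP; exact: measurable_indic.
have mi2 : measurable_fun setT (fun x : T => (\1_A2 x : R)%:E).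
  by apply/measurable_EFinP; exact: measurable_indic.
have d0 : 0 <= (delta ^+ 2)%:E by rewrite lee_fin sqr_ge0.
have inner x : \int[g]_z ((delta ^+ 2)%:E * (\1_A1 x)%:E * (\1_A2 z)%:E) =
    (delta ^+ 2)%:E * g A2 * (\1_A1 x)%:E.
  rewrite ge0_integralZl//; last by rewrite mule_ge0// lee_fin.
  by rewrite integral_indic// setIT muleAC.
apply: (@le_trans _ _ (\int[g]_x \int[g]_z
    ((delta ^+ 2)%:E * (\1_A1 x)%:E * (\1_A2 z)%:E))).
  under eq_integral do rewrite inner.
  rewrite ge0_integralZl//; last by rewrite mule_ge0.
  by rewrite integral_indic// setIT -muleA [X in _ <= _ * X]muleC.
apply: ge0_le_integral => //.
- by move=> x _; rewrite inner !mule_ge0// lee_fin.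
- under eq_fun do rewrite inner.
  exact: measurable_funeM.
- apply: (measurable_fun_fubini_tonelli_F (fun u =>
    (rise (cos (pi / 2)) (sin (pi / 2)) u)%:E)) => //.
  by move=> u; rewrite lee_fin.
move=> x _; apply: ge0_le_integral => //.
- by move=> z _; rewrite !mule_ge0// lee_fin.
- exact: measurable_funeM.
- exact: (measurableT_comp (mrise _ _)).
move=> z _; rewrite -!EFinM lee_fin /rise/= cos_pihalf sin_pihalf tscale1.
rewrite taddC tadd_tscale0 !indicE.
have [A1x|A1x] := pselect (A1 x); last first.
  by rewrite (memNset A1x) mulr0 mul0r le_max lexx.
have [A2z|A2z] := pselect (A2 z); last first.
  by rewrite (memNset A2z) mulr0 le_max lexx.
rewrite !mem_set// !mulr1 le_max /F (capdist_eq0 m0 A1x) (capdist_eq m0).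
  by rewrite subr0 lexx orbT.
by move=> a A1a; exact: sep.
Qed.

(** With N = n + 1 steps of angle t = pi / (2 N), the first-order terms add up to 2 N sin(t) s0
    delta exp(-1/2) times the mass of A3. Since N sin(t) <= pi / 2 <= 2, this is where the 4 comes
    from. The errors add up to N sin(t)^2 K <= 4 K / N. One factor delta cancels. *)
Lemma gauss_three_set : delta%:E * (g A1 * g A2) <= (4 * s0 * expR (- 2^-1))%:E * g A3.
Proof.
have gfin A : measurable A -> g A \is a fin_num.
  move=> mA; exact: fin_num_measure.
rewrite -(fineK (gfin _ mA1)) -(fineK (gfin _ mA2)) -(fineK (gfin _ mA3)).
set a1 := fine (g A1); set a2 := fine (g A2); set a3 := fine (g A3).
have a30 : (0 <= a3)%R by exact: fine_ge0.
rewrite -!EFinM lee_fin -(ler_pM2l delta_gt0).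
have M20 : (0 <= M2)%R.
  by rewrite -lee_fin -M2E; apply: integral_ge0 => x _; rewrite lee_fin sqn_ge0.
have K0 : (0 <= K)%R by rewrite /K; move: m0 M20; lra.
have bnd n : (delta ^+ 2 * (a1 * a2) <= 4 * s0 * e2 * delta * a3 + 4 * K / n.+1%:R)%R.
  pose t := (pi / 2 / n.+1%:R : R)%R.
  have n0 : (0 < n.+1%:R :> R)%R by rewrite ltr0n.
  have t0 : (0 < t)%R by rewrite divr_gt0// divr_gt0// pi_gt0.
  have n1 : (1 <= n.+1%:R :> R)%R by rewrite ler1n.
  have tpi : (t <= pi / 2)%R by rewrite ler_pdivrMr// ler_peMr// divr_ge0// pi_ge0.
  have nt : (n.+1%:R * t = pi / 2)%R by rewrite mulrC divfK ?gt_eqF.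
  have nt2 : (n.+1%:R * t <= 2)%R by rewrite nt ltW// pihalf_lt2.
  have c0 : (0 <= cos t)%R.
    apply: cos_ge0_pihalf; rewrite tpi andbT (le_trans _ (ltW t0))// oppr_le0.
    by rewrite divr_ge0// pi_ge0.
  have st : (0 < sin t)%R.
    have [->|tn] := eqVneq t (pi / 2)%R; first by rewrite sin_pihalf.
    by apply: sin_gt0_pihalf; rewrite t0 lt_neqAle tn.
  have sle : (sin t <= t)%R by rewrite sin_le_id// ltW.
  have := le_trans rise_pihalf (telescope (ltn0Sn n) nt).
  move=> /le_trans/(_ (lee_wpmul2l _ (rise_outer c0 st (cos2Dsin2 t)))).
  rewrite lee_fin => /(_ (ler0n _ _)).
  rewrite -(fineK (gfin _ mA1)) -(fineK (gfin _ mA2)) -(fineK (gfin _ mA3)).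
  rewrite -/a1 -/a2 -/a3 !(=^~ EFinM, =^~ EFinD) lee_fin => /le_trans; apply.
  set N := n.+1%:R in n0 n1 nt2 *; set S := sin t in st sle *.
  have NS : (N * S <= 2)%R by rewrite (le_trans _ nt2)// ler_wpM2l// ltW.
  have NS2 : (N * S ^+ 2 <= 4 / N)%R.
    rewrite ler_pdivlMr// (_ : N * S ^+ 2 * N = (N * S) ^+ 2)%R; last by ring.
    rewrite (_ : 4 = 2 ^+ 2)%R; last by ring.
    by rewrite ler_sqr ?nnegrE ?mulr_ge0// ltW.
  rewrite mulrDr; apply: lerD.
    rewrite (_ : N * (2 * S * (s0 * delta * e2) * a3) =
      (N * S) * (2 * s0 * delta * e2 * a3))%R; last by ring.
    rewrite [leRHS](_ : _ = 2 * (2 * s0 * delta * e2 * a3))%R; last by ring.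
    by rewrite ler_wpM2r// !mulr_ge0// ?expR_ge0// ltW.
  rewrite mulrA [leRHS](_ : _ = 4 / N * K)%R; last by ring.
  by rewrite ler_wpM2r.
rewrite [leRHS](_ : _ = 4 * s0 * e2 * delta * a3)%R; last by rewrite /e2; ring.
rewrite [leLHS](_ : _ = delta ^+ 2 * (a1 * a2))%R; last by ring.
apply/ler_addgt0Pr => e e0.
have K1 : (0 <= 4 * K / e)%R by rewrite divr_ge0// ?mulr_ge0// ltW.
rewrite (le_trans (bnd (Num.truncn (4 * K / e))))// lerD2l ler_pdivrMr ?ltr0n//.
by rewrite -ler_pdivrMl// mulrC ltW// Num.Theory.truncnS_gt.
Qed.

End gauss_three_set.

(** * The Random Walk Metropolis kernel *)

Section rwm_kernel.
Context {R : realType} {d : nat}.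
Local Notation T := (d.-tuple R).
Local Notation L := (lebesgue_tuple R d).
Variables (s0 s : R).
Hypotheses (s0_gt0 : 0 < s0) (s_gt0 : 0 < s).
Local Notation p := (@gauss_pdf R d s0).
Local Notation q := (@gauss_pdf R d s).
Local Notation tau := ((Num.sqrt d%:R)^-1 : R).
Local Notation pi := (@gauss R d s0).
Local Notation gam := (@gauss R d s).
Local Notation P := (@rwm_gauss R d s0 s).
Implicit Types (x y z : T).

Definition rwm_acc x z : R := rwm_accept p x (rwm_step z).
Local Notation acc := rwm_acc.
Local Notation rate := (rwm_accept_rate p s).
Definition rwm_prop (x z : T) : T := tadd x (rwm_step z).
Local Notation prop := rwm_prop.

Let s0n0 : s0 != 0. Proof. by rewrite gt_eqF. Qed.
Let sn0 : s != 0. Proof. by rewrite gt_eqF. Qed.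
Let p_gt0 x : 0 < p x. Proof. exact: gauss_pdf_gt0. Qed.
Let q_ge0 x : 0 <= q x. Proof. exact: gauss_pdf_ge0. Qed.

Lemma rwm_acc_ge0 x z : 0 <= acc x z.
Proof. by rewrite le_min ler01 divr_ge0 ?gauss_pdf_ge0. Qed.

Lemma rwm_acc_le1 x z : acc x z <= 1.
Proof. by rewrite ge_min lexx. Qed.

Lemma measurable_rwm_prop : measurable_fun setT (fun u : T * T => prop u.1 u.2).
Proof. by apply: measurable_fun_tadd => //; exact: measurable_fun_tscale. Qed.

Lemma rwm_accM x z : p x * acc x z = Num.min (p x) (p (prop x z)).
Proof.
by rewrite /rwm_acc /rwm_accept minr_pMr ?ltW// mulr1 mulrCA divff ?mulr1// gt_eqF.
Qed.

Lemma measurable_rwm_acc : measurable_fun setT (fun u : T * T => acc u.1 u.2).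
Proof.
apply: measurable_minr => //; apply: measurable_funM.
  by apply: measurable_fun_gauss_pdf; exact: measurable_rwm_prop.
have -> : (fun u : T * T => (p u.1)^-1) =
    fun u => expR (gauss_potential s0 u.1) * Num.sqrt (2 * trigo.pi * s0 ^+ 2) ^+ d.
  by apply/funext => u; rewrite /gauss_pdf invfM expRN !invrK.
apply: measurable_funM => //; apply: measurableT_comp => //.
apply: measurable_funM => //.
rewrite (_ : (fun _ => _) = fun u : T * T => sqn u.1).
  exact: measurable_fun_sqn.
by apply/funext => u; rewrite enorm_sqr.
Qed.

Let mpropx x : measurable_fun setT (prop x).
Proof. exact: (measurableT_comp measurable_rwm_prop (measurable_pair1 x)). Qed.

Let maccx x : measurable_fun setT (fun z => (acc x z)%:E).
Proof.
apply/measurable_EFinP.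
exact: (measurableT_comp measurable_rwm_acc (measurable_pair1 x)).
Qed.

Local Open Scope ereal_scope.

Let acc0 x z : 0 <= (acc x z)%:E. Proof. by rewrite lee_fin rwm_acc_ge0. Qed.

Lemma rwm_rateE x : (rate x)%:E = \int[gam]_z (acc x z)%:E.
Proof.
rewrite /rwm_accept_rate /Rintegral fineK// ge0_fin_numE; last by apply: integral_ge0 => z _; exact: acc0.
apply: (@le_lt_trans _ _ (\int[gam]_(z in [set: T]) 1)).
  apply: ge0_le_integral => //.
  - by move=> z _; exact: acc0.
  - exact: maccx.
  - by move=> z _; rewrite lee_fin; exact: rwm_acc_le1.
by rewrite integral_cst// mul1e (le_lt_trans (gauss_setT_le1 s))// ltry.
Qed.

Lemma rwm_rate_le1 x : (rate x <= 1)%R.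
Proof.
rewrite -lee_fin rwm_rateE.
apply: (@le_trans _ _ (\int[gam]_(z in [set: T]) 1)).
  by apply: ge0_le_integral => // z _; rewrite lee_fin; exact: rwm_acc_le1.
by rewrite integral_cst// mul1e gauss_setT_le1.
Qed.

Lemma measurable_rwm_rate : measurable_fun setT (rate : T -> R).
Proof.
apply/measurable_EFinP.
rewrite (_ : EFin \o _ = fun x => \int[gam]_z (acc x z)%:E); last first.
  by apply/funext => x /=; exact: rwm_rateE.
apply: (measurable_fun_fubini_tonelli_F (fun u => (acc u.1 u.2)%:E)) => //.
by apply/measurable_EFinP; exact: measurable_rwm_acc.
Qed.

Lemma ge0_integral_rwm x (f : T -> \bar R) : measurable_fun setT f ->
  (forall y, 0 <= f y) ->
  \int[P x]_y f y =
  \int[gam]_z (f (prop x z) * (acc x z)%:E) + f x * (1 - rate x)%:E.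
Proof.
move=> mf f0; apply/esym.
have stay0 : 0 <= (1 - rate x)%:E by rewrite lee_fin subr_ge0 rwm_rate_le1.
have mM (g : T -> \bar R) : measurable_fun setT g ->
    measurable_fun setT (fun z => g (prop x z) * (acc x z)%:E).
  by move=> mg; apply: emeasurable_funM => //; exact: (measurableT_comp mg).
apply: (@ge0_integral_unique _ _ _ (P x) (fun f =>
  \int[gam]_z (f (prop x z) * (acc x z)%:E) + f x * (1 - rate x)%:E)) => //.
- move=> g h mg mh g0 h0 /=.
  under eq_integral do rewrite ge0_muleDl//.
  rewrite ge0_integralD//; last 4 first.
  + by move=> z _; exact: mule_ge0.
  + exact: mM.
  + by move=> z _; exact: mule_ge0.
  + exact: mM.
  by rewrite ge0_muleDl// addeACA.
- move=> r g mg g0 r0; rewrite ge0_muleDr//; last 2 first.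
  + by apply: integral_ge0 => z _; exact: mule_ge0.
  + exact: mule_ge0.
  rewrite -muleA; congr (_ + _); rewrite -ge0_integralZl//.
  + by apply: eq_integral => z _; rewrite muleA.
  + exact: mM.
  + by move=> z _; exact: mule_ge0.
- move=> g mg g0 nd.
  have nd' : nondecreasing_seq (fun n => \int[gam]_z (g n (prop x z) * (acc x z)%:E)).
    move=> n n' nn'; apply: ge0_le_integral => //.
    + by move=> z _; exact: mule_ge0.
    + exact: mM.
    + exact: mM.
    + by move=> z _; apply: lee_wpmul2r => //; exact: nd.
  rewrite limeD; last 3 first.
  + exact: ereal_nondecreasing_is_cvgn.
  + apply: ereal_nondecreasing_is_cvgn => n n' nn'.
    by apply: lee_wpmul2r => //; exact: nd.
  + rewrite ge0_adde_def// inE.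
      apply: lime_ge; first exact: ereal_nondecreasing_is_cvgn.
      by apply: nearW => n; apply: integral_ge0 => z _; exact: mule_ge0.
    apply: lime_ge.
      apply: ereal_nondecreasing_is_cvgn => n n' nn'.
      by apply: lee_wpmul2r => //; exact: nd.
    by apply: nearW => n; exact: mule_ge0.
  congr (_ + _).
    rewrite -monotone_convergence//.
    + apply: eq_integral => z _; rewrite limeMr//.
      by apply: ereal_nondecreasing_is_cvgn; exact: nd.
    + by move=> n; exact: mM.
    + by move=> n z _; exact: mule_ge0.
    + by move=> z _ n n' nn'; apply: lee_wpmul2r => //; exact: nd.
  by rewrite limeMr//; apply: ereal_nondecreasing_is_cvgn; exact: nd.
Qed.

Lemma measurable_integral_rwm (f : T -> \bar R) : measurable_fun setT f ->
  (forall y, 0 <= f y) -> measurable_fun setT (fun x => \int[P x]_y f y).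
Proof.
move=> mf f0; under eq_fun do rewrite ge0_integral_rwm//.
apply: emeasurable_funD.
  apply: (measurable_fun_fubini_tonelli_F (fun u => f (prop u.1 u.2) * (acc u.1 u.2)%:E)).
    apply: emeasurable_funM; first exact: (measurableT_comp mf measurable_rwm_prop).
    by apply/measurable_EFinP; exact: measurable_rwm_acc.
  by move=> u; exact: mule_ge0.
apply: emeasurable_funM => //; apply/measurable_EFinP.
by apply: measurable_funB => //; exact: measurable_rwm_rate.
Qed.

(** The part of <g, P f> due to accepted moves, written with Lebesgue densities: p(x) times the
    acceptance probability is the minimum of p at the two endpoints. *)
Definition rwm_flow (g f : T -> \bar R) : \bar R :=
  \int[L]_x \int[L]_z (g x * f (prop x z) *
    (Num.min (p x) (p (prop x z)) * q z)%:E).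

Let mmin : measurable_fun setT
  (fun u : T * T => (Num.min (p u.1) (p (prop u.1 u.2)) * q u.2)%:E).
Proof.
apply/measurable_EFinP; apply: measurable_funM.
  apply: measurable_minr; apply: measurable_fun_gauss_pdf => //.
  exact: measurable_rwm_prop.
exact: measurable_fun_gauss_pdf.
Qed.

Let min0 x y z : 0 <= (Num.min (p x) (p y) * q z)%:E.
Proof. by rewrite lee_fin mulr_ge0// le_min !gauss_pdf_ge0. Qed.

Let mflow (g f : T -> \bar R) : measurable_fun setT g -> measurable_fun setT f ->
  measurable_fun setT (fun u : T * T => g u.1 * f (prop u.1 u.2) *
    (Num.min (p u.1) (p (prop u.1 u.2)) * q u.2)%:E).
Proof.
move=> mg mf; apply: emeasurable_funM => //; apply: emeasurable_funM.
  exact: (measurableT_comp mg).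
exact: (measurableT_comp mf measurable_rwm_prop).
Qed.

(** The substitution that sends (x, z) to (x + d^(-1/2) z, - z) exchanges the endpoints of the move
    and preserves both the minimum and q. It is carried out as a translation of x for fixed z, then
    a reflection of z. *)
Lemma rwm_flow_sym (g f : T -> \bar R) : measurable_fun setT g -> measurable_fun setT f ->
  (forall x, 0 <= g x) -> (forall x, 0 <= f x) -> rwm_flow g f = rwm_flow f g.
Proof.
move=> mg mf g0 f0; rewrite /rwm_flow.
pose G (g f : T -> \bar R) (u : T * T) := g u.1 * f (prop u.1 u.2) *
    (Num.min (p u.1) (p (prop u.1 u.2)) * q u.2)%:E.
have mG1 : measurable_fun setT (G g f) by exact: mflow.
have mG2 : measurable_fun setT (G f g) by exact: mflow.
have G0 a b u : (forall x, 0 <= a x) -> (forall x, 0 <= b x) -> 0 <= G a b u.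
  by move=> a0 b0; rewrite mule_ge0// mule_ge0.
transitivity (\int[L]_z \int[L]_x G g f (x, z)).
  exact: (fubini_tonelli (G g f) mG1 (fun u => G0 _ _ u g0 f0)).
transitivity (\int[L]_z \int[L]_x G f g (x, z)); last first.
  exact/esym/(fubini_tonelli (G f g) mG2 (fun u => G0 _ _ u f0 g0)).
transitivity (\int[L]_z \int[L]_x G f g (x, tscale (-1) z)).
  apply: eq_integral => z _.
  rewrite -(lebesgue_tuple_translation (rwm_step (tscale (-1) z)) (f := fun x => G g f (x, z))).
  - apply: eq_integral => x _; rewrite /G/= taddC -/(prop x (tscale (-1) z)).
    have -> : prop (prop x (tscale (-1) z)) z = x.
      by apply: eq_from_tnth => i; rewrite !tnth_mktuple; ring.
    by rewrite [in RHS]minC gauss_pdf_reflection [X in X * _]muleC.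
  - exact: measurableT_comp.
  - by move=> x; exact: G0.
pose K z := \int[L]_x G f g (x, z).
have mK : measurable_fun setT K.
  exact: (measurable_fun_fubini_tonelli_G (G f g) mG2 (fun u => G0 _ _ u f0 g0)).
have K0 z : 0 <= K z by apply: integral_ge0 => x _; exact: G0.
exact: (lebesgue_tuple_reflection mK K0).
Qed.

(** Reversibility and positivity are both read off this splitting, in which the rejection part is
    multiplication by a nonnegative function. *)
Lemma rwm_bilinearE (g f : T -> \bar R) : measurable_fun setT g -> measurable_fun setT f ->
  (forall x, 0 <= g x) -> (forall x, 0 <= f x) ->
  \int[pi]_x (g x * \int[P x]_y f y) =
  rwm_flow g f + \int[pi]_x (g x * f x * (1 - rate x)%:E).
Proof.
move=> mg mf g0 f0.
have stay0 x : 0 <= (1 - rate x)%:E by rewrite lee_fin subr_ge0 rwm_rate_le1.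
have mstay : measurable_fun setT (fun x : T => (1 - rate x)%:E).
  apply/measurable_EFinP.
  by apply: measurable_funB => //; exact: measurable_rwm_rate.
pose H u := f (prop u.1 u.2) * (acc u.1 u.2)%:E.
have mH : measurable_fun setT H.
  apply: emeasurable_funM; first exact: (measurableT_comp mf measurable_rwm_prop).
  by apply/measurable_EFinP; exact: measurable_rwm_acc.
have H0 u : 0 <= H u by exact: mule_ge0.
have mI : measurable_fun setT (fun x => \int[gam]_z H (x, z)).
  exact: (measurable_fun_fubini_tonelli_F H).
have I0 x : 0 <= \int[gam]_z H (x, z) by exact: integral_ge0.
have E x : g x * \int[P x]_y f y =
    g x * \int[gam]_z H (x, z) + g x * f x * (1 - rate x)%:E.
  by rewrite ge0_integral_rwm// ge0_muleDr ?muleA ?I0// mule_ge0.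
under eq_integral do rewrite E.
rewrite ge0_integralD//; last 4 first.
- by move=> x _; exact: mule_ge0.
- exact: emeasurable_funM.
- by move=> x _; rewrite mule_ge0// mule_ge0.
- by apply: emeasurable_funM => //; exact: emeasurable_funM.
congr (_ + _); rewrite ge0_integral_gauss//; last 2 first.
- exact: emeasurable_funM.
- by move=> x; exact: mule_ge0.
apply: eq_integral => x _; rewrite ge0_integral_gauss//; last 1 first.
  exact: (measurableT_comp mH).
rewrite -muleA -ge0_integralZr//; last 3 first.
- apply: emeasurable_funM; first exact: (measurableT_comp mH).
  by apply/measurable_EFinP; exact: measurable_gauss_pdf.
- by move=> z _; rewrite mule_ge0// lee_fin.
- by rewrite lee_fin ltW.
rewrite -ge0_integralZl//; last 2 first.
- apply: emeasurable_funM => //; apply: emeasurable_funM.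
    exact: (measurableT_comp mH).
  by apply/measurable_EFinP; exact: measurable_gauss_pdf.
- by move=> z _; rewrite mule_ge0 ?lee_fin ?(ltW (p_gt0 _))// mule_ge0// lee_fin.
apply: eq_integral => z _; rewrite /H/= -!muleA; congr (_ * (_ * _)).
by rewrite -!EFinM -rwm_accM; congr EFin; ring.
Qed.

Lemma rwm_reversible (g f : T -> \bar R) : measurable_fun setT g -> measurable_fun setT f ->
  (forall x, 0 <= g x) -> (forall x, 0 <= f x) ->
  \int[pi]_x (g x * \int[P x]_y f y) = \int[pi]_x (f x * \int[P x]_y g y).
Proof.
move=> mg mf g0 f0; rewrite !rwm_bilinearE// rwm_flow_sym//; congr (_ + _).
by apply: eq_integral => x _; rewrite [g x * _]muleC.
Qed.

End rwm_kernel.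

(** * Conductance *)

Section rwm_acceptance.
Context {R : realType} {d : nat}.
Local Notation T := (d.-tuple R).
Local Notation L := (lebesgue_tuple R d).
Variables (s0 s : R).
Hypotheses (d_gt0 : (0 < d)%N) (s0_gt0 : 0 < s0) (s_gt0 : 0 < s).
Local Notation p := (@gauss_pdf R d s0).
Local Notation q := (@gauss_pdf R d s).
Local Notation tau := ((Num.sqrt d%:R)^-1 : R).
Local Notation gam := (@gauss R d s).
Local Notation acc := (rwm_acc s0).
Local Notation rate := (rwm_accept_rate p s).
Local Notation prop := rwm_prop.
Implicit Types (x y z : T).

Let vs := s / s0.

(** The factor 1/2 comes from restricting to increments in a half-space, the exponential from the
    mean of the weight [w] below. *)
Definition accept_lb : R := expR (- (vs ^+ 2 / 2)) / 2.

Let s0n0 : s0 != 0. Proof. by rewrite gt_eqF. Qed.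
Let sn0 : s != 0. Proof. by rewrite gt_eqF. Qed.
Let p_gt0 x : 0 < p x. Proof. exact: gauss_pdf_gt0. Qed.
Let q_gt0 x : 0 < q x. Proof. exact: gauss_pdf_gt0. Qed.
Let dR_gt0 : 0 < d%:R :> R. Proof. by rewrite ltr0n. Qed.
Let tau_gt0 : 0 < tau. Proof. by rewrite invr_gt0 sqrtr_gt0. Qed.
Let tau2 : tau ^+ 2 = d%:R^-1. Proof. by rewrite exprVn sqr_sqrtr. Qed.

Lemma accept_lb_gt0 : 0 < accept_lb. Proof. by rewrite divr_gt0// expR_gt0. Qed.

Let w z : R := expR (- (tau ^+ 2 * sqn z / (2 * s0 ^+ 2))).

(** The ratio p(x + tau z) / p(x) is [w z] times exp(- tau x.z / s0^2), and the last factor is at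
    least 1 on this half-space. *)
Let acc_ge x z : dotp x z <= 0 -> w z <= acc x z.
Proof.
move=> xz; rewrite /acc /rwm_accept le_min; apply/andP; split.
  rewrite -[leRHS]expR0 ler_expR oppr_le0.
  by apply: divr_ge0; apply: mulr_ge0; rewrite ?sqn_ge0 ?sqr_ge0.
rewrite ler_pdivlMr// !gauss_pdfE mulrA ler_wpM2r ?invr_ge0 ?exprn_ge0 ?sqrtr_ge0//.
rewrite -expRD ler_expR -opprD lerN2 -mulrDl ler_wpM2r ?invr_ge0 ?mulr_ge0 ?sqr_ge0 ?(ltW s0_gt0)//.
rewrite /rwm_step !vectE (addrC (_ * sqn z)) lerD2r gerDl.
by rewrite mulr_ge0_le0// mulr_ge0_le0// ltW.
Qed.

(** Multiplying q by [w] adds precisions: s1^-2 = s^-2 + tau^2 s0^-2. *)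
Let s1 := s / Num.sqrt (1 + vs ^+ 2 / d%:R).
Let D_gt0 : 0 < 1 + vs ^+ 2 / d%:R.
Proof. by rewrite ltr_wpDr// divr_ge0// sqr_ge0. Qed.
Let s1_gt0 : 0 < s1. Proof. by rewrite divr_gt0// sqrtr_gt0. Qed.

Let w_q z : w z * q z = (s1 / s) ^+ d * gauss_pdf s1 z.
Proof.
have sD : Num.sqrt (1 + vs ^+ 2 / d%:R) != 0 by rewrite gt_eqF// sqrtr_gt0.
have h2 : 0 < 2 * pi :> R by rewrite mulr_gt0// pi_gt0.
have hs : 0 <= 2 * pi * s ^+ 2 by rewrite mulr_ge0 ?sqr_ge0// ltW.
have hc (t : R) : 0 < t -> Num.sqrt (2 * pi * t ^+ 2) = Num.sqrt (2 * pi) * t.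
  by move=> t0; rewrite sqrtrM ?(ltW h2)// sqrtr_sqr gtr0_norm.
rewrite !gauss_pdfE !hc// mulrA -expRD [RHS]mulrCA mulrC [in RHS]mulrC.
have N0 : Num.sqrt (2 * pi) != 0 :> R by rewrite gt_eqF// sqrtr_gt0.
rewrite -!exprVn -exprMn; congr (_ * expR _).
  congr (_ ^+ d); rewrite /s1; field.
  by rewrite N0 sn0 sD.
rewrite /s1 expr_div_n sqr_sqrtr ?ltW// tau2 /vs; field.
have h : s0 ^+ 2 * d%:R + s ^+ 2 != 0.
  by rewrite gt_eqF// ltr_wpDr ?sqr_ge0// mulr_gt0 ?exprn_gt0.
by rewrite sn0 s0n0 h gt_eqF.
Qed.

(** Here (s1 / s)^d = (1 + vs^2 / d)^(-d/2), and 1 + u <= exp u with u = vs^2 / d removes the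
    dimension. *)
Let ratio_ge : expR (- (vs ^+ 2 / 2)) <= (s1 / s) ^+ d.
Proof.
have -> : s1 / s = (Num.sqrt (1 + vs ^+ 2 / d%:R))^-1.
  by rewrite /s1 mulrAC divff// mul1r.
rewrite exprVn expRN lef_pV2 ?posrE ?expR_gt0 ?exprn_gt0 ?sqrtr_gt0//.
have -> : vs ^+ 2 / 2 = (vs ^+ 2 / d%:R / 2) * d%:R.
  by field; rewrite gt_eqF.
rewrite expRM_natr; apply: lerXn2r; rewrite ?nnegrE ?sqrtr_ge0 ?expR_ge0//.
rewrite -(@ler_sqr _ (Num.sqrt _)) ?nnegrE ?sqrtr_ge0 ?expR_ge0//.
rewrite sqr_sqrtr ?(ltW D_gt0)// -expRM_natr divfK//.
exact: expR_ge1Dx.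
Qed.

Local Open Scope ereal_scope.

Lemma rwm_rate_ge x : (accept_lb <= rate x)%R.
Proof.
have mw : measurable_fun setT w.
  apply: measurableT_comp => //; apply: measurableT_comp => //.
  by apply: measurable_funM => //; apply: measurable_funM => //; exact: measurable_fun_sqn.
have w0 z : (0 <= w z)%R by exact: expR_ge0.
pose ind z : R := (dotp x z <= 0)%R%:R.
have mind : measurable_fun setT ind.
  apply: (measurableT_comp (f := fun b : bool => b%:R : R)) => //.
  by apply: measurable_fun_ler => //; exact: measurable_fun_dotp.
have mwi : measurable_fun setT (fun z => (w z * ind z)%:E).
  by apply/measurable_EFinP; exact: measurable_funM.
have wi0 z : 0 <= (w z * ind z)%:E by rewrite lee_fin mulr_ge0// ler0n.
have low : \int[gam]_z (w z * ind z)%:E <= (rate x)%:E.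
  rewrite rwm_rateE//; apply: ge0_le_integral => //.
  - apply/measurable_EFinP.
    exact: (measurableT_comp (@measurable_rwm_acc R d s0) (measurable_pair1 x)).
  - move=> z _; rewrite lee_fin /ind; case: (leP (dotp x z) 0%R) => [xz|_]; rewrite ?mulr1 ?mulr0 ?rwm_acc_ge0//.
    exact: acc_ge.
have tot : \int[gam]_z (w z)%:E = ((s1 / s) ^+ d)%:E.
  rewrite ge0_integral_gauss//; last exact/measurable_EFinP.
  under eq_integral do rewrite -EFinM w_q EFinM.
  rewrite ge0_integralZl//.
  - by rewrite integral_gauss_pdf ?mule1// gt_eqF.
  - by apply/measurable_EFinP; exact: measurable_gauss_pdf.
  - by move=> z _; rewrite lee_fin gauss_pdf_ge0.
  - by rewrite lee_fin exprn_ge0// divr_ge0// ltW.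
(* The weight [w] is even and one of z, - z lies in the half-space, so the half-space carries at
   least half of the integral of [w]. *)
have : ((s1 / s) ^+ d)%:E <= 2%:E * (rate x)%:E.
  rewrite -tot; apply: (@le_trans _ _ (\int[gam]_z ((w z * ind z)%:E +
      (w (tscale (-1) z) * ind (tscale (-1) z))%:E))).
    apply: ge0_le_integral => //.
    - by move=> z _; rewrite lee_fin.
    - exact/measurable_EFinP.
    - apply: emeasurable_funD => //.
      exact: (measurableT_comp mwi (measurable_tscale _)).
    - move=> z _; rewrite -EFinD lee_fin /w vectE sqrrN expr1n mul1r -mulrDr.
      rewrite ler_peMr ?expR_ge0// /ind dotp_tscaler mulN1r oppr_le0 -natrD ler1n.
      by case: (leP (dotp x z)) => //= /ltW ->.
  rewrite ge0_integralD//; last first.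
    exact: (measurableT_comp mwi (measurable_tscale _)).
  rewrite (gauss_reflection _ (f := fun z => (w z * ind z)%:E))//.
  by rewrite -mule2n -mule_natl lee_wpmul2l// lee_fin.
rewrite -EFinM lee_fin => h.
by rewrite /accept_lb ler_pdivrMr// (le_trans ratio_ge)// [leRHS]mulrC.
Qed.

End rwm_acceptance.

(** * Total variation between a Gaussian and its translates *)

Section gauss_overlap.
Context {R : realType} {d : nat}.
Local Notation T := (d.-tuple R).
Local Notation L := (lebesgue_tuple R d).
Variables (s : R).
Hypothesis s_gt0 : 0 < s.
Local Notation q := (@gauss_pdf R d s).
Implicit Types (x y z b : T).

Let sn0 : s != 0. Proof. by rewrite gt_eqF. Qed.
Let q_gt0 x : 0 < q x. Proof. exact: gauss_pdf_gt0. Qed.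

(** In other words q(b + z)^2 / q(z) is exp(|b|^2 / s^2) times a translated density, so its
    integral, which is 1 plus the chi-square divergence, is exp(|b|^2 / s^2). *)
Lemma gauss_pdf_sqr b z : q (tadd b z) ^+ 2 =
  q z * (expR (sqn b / s ^+ 2) * q (tadd (tscale 2 b) z)).
Proof.
rewrite !gauss_pdfE exprMn -expRM_natr; set n := (Num.sqrt _ ^+ d)^-1.
rewrite (_ : expR _ = expR (- (sqn z / (2 * s ^+ 2))) * (expR (sqn b / s ^+ 2) *
  expR (- (sqn (tadd (tscale 2 b) z) / (2 * s ^+ 2))))); first by ring.
by rewrite -!expRD; congr expR; rewrite !vectE; field.
Qed.

(* AM-GM, after completing the square in the chi-square divergence. *)
Lemma gauss_shift_pointwise (k : R) b z :
  4 * k * Num.max 0 (q z - q (tadd b z)) + (2 * k + 2) * q (tadd b z) <=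
  (k + 1) ^+ 2 * q z + expR (sqn b / s ^+ 2) * q (tadd (tscale 2 b) z).
Proof.
have := gauss_pdf_sqr b z; set Q := expR _ * _; move: (q_gt0 z).
move: (q z) (q (tadd b z)) Q => u v Q u0 h.
have -> : Q = v ^+ 2 / u by rewrite h mulrC mulKf// gt_eqF.
rewrite -subr_ge0.
have e r : 0 <= (u * r - v) ^+ 2 / u by rewrite divr_ge0 ?sqr_ge0// ltW.
rewrite maxEle; case: ifPn => _.
  rewrite [X in 0 <= X](_ : _ = (u * (1 - k) - v) ^+ 2 / u) ?e//.
  by field; rewrite gt_eqF.
rewrite [X in 0 <= X](_ : _ = (u * (1 + k) - v) ^+ 2 / u) ?e//.
by field; rewrite gt_eqF.
Qed.

Local Open Scope ereal_scope.

(** The total variation distance between [gauss s] and its translate by - b, as the mass of the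
    positive part of the difference of densities. *)
Definition gauss_tv b : \bar R :=
  \int[L]_z (Num.max 0 (q z - q (tadd b z)))%:E.

(** Integrating the pointwise inequality gives 4 k t <= k^2 - 1 + exp u for t = [gauss_tv b] and u =
    |b|^2 / s^2 <= k^2. With exp u <= 1 + 2 u the right-hand side is at most 3 k^2. *)
Lemma gauss_tv_le (k : R) b : (0 < k)%R -> (k <= 4^-1)%R ->
  (sqn b <= (k * s) ^+ 2)%R -> gauss_tv b <= k%:E.
Proof.
move=> k0 k4 bk.
have mq : measurable_fun setT (fun z => (q z)%:E).
  by apply/measurable_EFinP; exact: measurable_gauss_pdf.
have mqt a : measurable_fun setT (fun z => (q (tadd a z))%:E).
  by apply/measurable_EFinP; apply: measurable_fun_gauss_pdf; exact: measurable_tadd.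
have mm : measurable_fun setT (fun z => (Num.max 0 (q z - q (tadd b z)))%:E).
  apply/measurable_EFinP; apply: measurable_maxr => //; apply: measurable_funB.
    exact: measurable_gauss_pdf.
  by apply: measurable_fun_gauss_pdf; exact: measurable_tadd.
have m0 z : 0 <= (Num.max 0 (q z - q (tadd b z)))%:E by rewrite lee_fin le_max lexx.
have q0 z : 0 <= (q z)%:E by rewrite lee_fin ltW.
have tv_fin : gauss_tv b \is a fin_num.
  rewrite ge0_fin_numE; last exact: integral_ge0.
  rewrite (@le_lt_trans _ _ (\int[L]_z (q z)%:E))//.
    apply: ge0_le_integral => // z _; rewrite lee_fin ge_max ltW//=.
    by rewrite gerBl ltW.
  by rewrite integral_gauss_pdf// ltry.
have : \int[L]_z ((4 * k)%:E * (Num.max 0 (q z - q (tadd b z)))%:E +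
      (2 * k + 2)%:E * (q (tadd b z))%:E) <=
    \int[L]_z (((k + 1) ^+ 2)%:E * (q z)%:E +
      (expR (sqn b / s ^+ 2))%:E * (q (tadd (tscale 2 b) z))%:E).
  apply: ge0_le_integral => //.
  - by move=> z _; rewrite adde_ge0// mule_ge0// lee_fin ?addr_ge0 ?mulr_ge0// ltW.
  - by apply: emeasurable_funD; exact: measurable_funeM.
  - by apply: emeasurable_funD; exact: measurable_funeM.
  - by move=> z _; rewrite -!EFinM -!EFinD lee_fin gauss_shift_pointwise.
have k40 : 0 <= (4 * k)%:E by rewrite lee_fin mulr_ge0// ltW.
have k20 : 0 <= (2 * k + 2)%:E by rewrite lee_fin addr_ge0// mulr_ge0// ltW.
have k10 : 0 <= ((k + 1) ^+ 2)%:E by rewrite lee_fin sqr_ge0.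
have e0 : 0 <= (expR (sqn b / s ^+ 2))%:E by rewrite lee_fin expR_ge0.
rewrite !ge0_integralD//; try (by move=> z _; rewrite mule_ge0);
  try exact: measurable_funeM.
have I a : \int[L]_z (q (tadd a z))%:E = 1 by exact: integral_gauss_pdf_tadd.
rewrite (ge0_integralZl _ _ mm)// (ge0_integralZl _ _ (mqt b))//.
rewrite (ge0_integralZl _ _ mq)// (ge0_integralZl _ _ (mqt (tscale 2 b)))//.
have E : \int[L]_z (Num.max 0 (q z - q (tadd b z)))%:E = (fine (gauss_tv b))%:E.
  by rewrite fineK.
rewrite (I b) (I (tscale 2 b)) (integral_gauss_pdf sn0) E !mule1 -!EFinM -!EFinD lee_fin.
rewrite -(fineK tv_fin) lee_fin; set t := fine _; set u := (sqn b / s ^+ 2)%R => h.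
have uk : (u <= k ^+ 2)%R by rewrite /u ler_pdivrMr ?exprn_gt0// -exprMn.
have u0 : (0 <= u)%R by rewrite divr_ge0 ?sqn_ge0 ?sqr_ge0.
have k2 : (k ^+ 2 <= 4^-1)%R.
  rewrite expr2 (le_trans (_ : _ <= k * 1)%R) ?mulr1//.
  by nra.
(* From exp(- u) >= 1 - u and (1 + 2 u) (1 - u) >= 1, which holds for 0 <= u <= 1/2. *)
have eu : (expR u <= 1 + 2 * u)%R.
  have e1 := expR_ge1Dx (- u); have e2 := expR_gt0 u.
  have e3 : (expR u * expR (- u) = 1)%R by rewrite -expRD subrr expR0.
  have e4 : (expR u * (1 - u) <= 1)%R by rewrite -[leRHS]e3; apply: ler_wpM2l => //; exact: ltW.
  have e5 : (1 <= (1 + 2 * u) * (1 - u))%R by nra.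
  have e6 : (0 < 1 - u)%R by lra.
  by rewrite -(ler_pM2r e6) (le_trans e4).
have : (4 * k * t <= 4 * k * k)%R by nra.
by rewrite ler_pM2l// mulr_gt0.
Qed.

End gauss_overlap.

(** * Flow out of a set *)

Section rwm_conductance.
Context {R : realType} {d : nat}.
Local Notation T := (d.-tuple R).
Local Notation L := (lebesgue_tuple R d).
Variables (s0 s : R).
Hypotheses (d_gt0 : (0 < d)%N) (s0_gt0 : 0 < s0) (s_gt0 : 0 < s).
Local Notation p := (@gauss_pdf R d s0).
Local Notation q := (@gauss_pdf R d s).
Local Notation tau := ((Num.sqrt d%:R)^-1 : R).
Local Notation pi := (@gauss R d s0).
Local Notation gam := (@gauss R d s).
Local Notation P := (@rwm_gauss R d s0 s).
Local Notation acc := (rwm_acc s0).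
Local Notation rate := (rwm_accept_rate p s).
Local Notation prop := rwm_prop.
Implicit Types (x y z : T) (A : set T).

Let s0n0 : s0 != 0. Proof. by rewrite gt_eqF. Qed.
Let sn0 : s != 0. Proof. by rewrite gt_eqF. Qed.
Let p_gt0 x : 0 < p x. Proof. exact: gauss_pdf_gt0. Qed.
Let q_gt0 x : 0 < q x. Proof. exact: gauss_pdf_gt0. Qed.
Let tau_gt0 : 0 < tau. Proof. by rewrite invr_gt0 sqrtr_gt0 ltr0n. Qed.

Let a0 := accept_lb s0 s.
Let a0_gt0 : 0 < a0. Proof. exact: accept_lb_gt0. Qed.
Let a0_le : a0 <= 2^-1.
Proof.
rewrite /a0 /accept_lb ler_pdivrMr// mulVf// -expR0 ler_expR oppr_le0.
by rewrite divr_ge0// sqr_ge0.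
Qed.

Local Open Scope ereal_scope.

(** The accepted part of [P x A]. Leaving out the atom at x makes it a Lebesgue integral over
    increments, which can be translated. *)
Let move x A : \bar R := \int[L]_z (\1_A (prop x z) * acc x z * q z)%:E.

Let mmove x A : measurable A ->
  measurable_fun setT (fun z => (\1_A (prop x z) * acc x z * q z)%:E).
Proof.
move=> mA; apply/measurable_EFinP; apply: measurable_funM.
  apply: measurable_funM.
    apply: (measurableT_comp _ (measurableT_comp measurable_rwm_prop (measurable_pair1 x))).
    exact: measurable_indic.
  exact: (measurableT_comp (@measurable_rwm_acc R d s0) (measurable_pair1 x)).
exact: measurable_gauss_pdf.
Qed.

Let move_ge0 x A z : 0 <= (\1_A (prop x z) * acc x z * q z)%:E.
Proof. by rewrite lee_fin mulr_ge0 ?(ltW (q_gt0 _))// mulr_ge0// rwm_acc_ge0. Qed.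

Let move_le x A : measurable A -> move x A <= P x A.
Proof.
move=> mA; rewrite /rwm_gauss/= /rwm.
apply: (@le_trans _ _ (\int[gam]_z (\1_A (prop x z) * acc x z)%:E)).
  rewrite ge0_integral_gauss//.
  - apply/measurable_EFinP; apply: measurable_funM.
      apply: (measurableT_comp _ (measurableT_comp measurable_rwm_prop (measurable_pair1 x))).
      exact: measurable_indic.
    exact: (measurableT_comp (@measurable_rwm_acc R d s0) (measurable_pair1 x)).
  - by move=> z; rewrite lee_fin mulr_ge0// rwm_acc_ge0.
rewrite leeDl// lee_fin mulr_ge0// subr_ge0.
exact: rwm_rate_le1.
Qed.

(** The shift of increments for which the proposal from x lands where the proposal from y does. *)
Let b_of x y := tscale tau^-1 (tsub y x).

Let prop_b x y z : prop x (tadd (b_of x y) z) = prop y z.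
Proof.
apply: eq_from_tnth => i; rewrite !tnth_mktuple mulrDr mulrA mulfV; last first.
  by rewrite gt_eqF.
by rewrite mul1r addrA mulN1r addrCA addrN addr0.
Qed.

(** As p(x) <= p(y), a move to a common target is accepted at least as often from x as from y. The
    accepted moves from y into the complement of A are thus matched by moves from x with shifted
    increments, up to the total variation distance between the two increment laws. *)
Let overlap x y A : measurable A -> (sqn y <= sqn x)%R ->
  (rate y)%:E <= P x (~` A) + P y A + gauss_tv s (b_of x y).
Proof.
move=> mA xy.
have mC := measurableC mA.
have pxy : (p x <= p y)%R.
  rewrite !gauss_pdfE ler_wpM2r ?invr_ge0 ?exprn_ge0 ?sqrtr_ge0//.
  by rewrite ler_expR lerN2 ler_wpM2r// invr_ge0 mulr_ge0 ?sqr_ge0.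
apply: (@le_trans _ _ (move x (~` A) + move y A + gauss_tv s (b_of x y))); last first.
  by rewrite leeD// leeD// move_le.
set b := b_of x y.
rewrite /move -(lebesgue_tuple_translation b
    (f := fun z => (\1_(~` A) (prop x z) * acc x z * q z)%:E))//; last exact: mmove.
have m1 : measurable_fun setT (fun z =>
    (\1_(~` A) (prop x (tadd b z)) * acc x (tadd b z) * q (tadd b z))%:E).
  exact: (measurableT_comp (mmove x mC) (measurable_tadd b)).
have m2 := mmove y mA.
have m3 : measurable_fun setT (fun z => (Num.max 0 (q z - q (tadd b z)))%:E).
  apply/measurable_EFinP; apply: measurable_maxr => //; apply: measurable_funB.
    exact: measurable_gauss_pdf.
  by apply: measurable_fun_gauss_pdf; exact: measurable_tadd.
have p3 z : 0 <= (Num.max 0 (q z - q (tadd b z)))%:E by rewrite lee_fin le_max lexx.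
rewrite -ge0_integralD// -ge0_integralD//; last 2 first.
- by move=> z _; rewrite adde_ge0.
- exact: emeasurable_funD.
have macc : measurable_fun setT (fun z => (acc y z)%:E).
  apply/measurable_EFinP.
  exact: (measurableT_comp (@measurable_rwm_acc R d s0) (measurable_pair1 y)).
rewrite rwm_rateE// ge0_integral_gauss//; last by move=> z; rewrite lee_fin rwm_acc_ge0.
apply: ge0_le_integral => //.
- by move=> z _; rewrite mule_ge0// lee_fin ?rwm_acc_ge0// ltW.
- by apply: emeasurable_funM => //; apply/measurable_EFinP; exact: measurable_gauss_pdf.
- by apply: emeasurable_funD => //; exact: emeasurable_funD.
move=> z _; rewrite -EFinM -!EFinD lee_fin.
have ac : (acc y z <= acc x (tadd b z))%R.
  rewrite /rwm_acc /rwm_accept -!/(prop _ _) prop_b le_min ge_min lexx/= ge_min.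
  by apply/orP; right; rewrite ler_wpM2l ?(ltW (p_gt0 _))// lef_pV2 ?posrE.
rewrite prop_b; have := rwm_acc_ge0 s0 y z; have := rwm_acc_le1 s0 y z.
have := q_gt0 z; have := q_gt0 (tadd b z); move: ac.
have : (q z - q (tadd b z) <= Num.max 0 (q z - q (tadd b z)))%R.
  by rewrite le_max lexx orbT.
have : (0 <= Num.max 0 (q z - q (tadd b z)))%R by rewrite le_max lexx.
move: (Num.max 0 (q z - q (tadd b z)))%R (acc _ _) (acc _ _) (q _) (q _) => M u v w t.
have [Aw|Aw] := pselect (A (prop y z)).
  rewrite !indicE (mem_set Aw) memNset; last by move/(_ Aw).
  by rewrite /=; nra.
rewrite !indicE (memNset Aw) mem_set//=.
nra.
Qed.

(** For points this close, |b| <= (a0 / 2) * s, so the total variation term is at most a0 / 2, half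
    of the acceptance rate a0 that is available. *)
Let close_overlap x y A : measurable A ->
  (sqn (tsub y x) <= (a0 / 2 * s * tau) ^+ 2)%R ->
  (a0 / 2)%:E <= P x (~` A) + P y A.
Proof.
have sqnC u v : sqn (tsub u v) = sqn (tsub v u).
  by apply: eq_bigr => i _; rewrite !tnth_mktuple -sqrrN; congr (_ ^+ 2)%R; ring.
(* The claim is invariant under exchanging x with y and A with its complement, so x may be taken as
   the point farther from the origin. *)
wlog xy : x y A / (sqn y <= sqn x)%R.
  move=> h mA yx; have [xy|/ltW xy] := leP (sqn y) (sqn x); first exact: h.
  rewrite sqnC in yx; have := h y x (~` A) xy (measurableC mA) yx.
  have gen (u v c : \bar R) : c <= u + v -> c <= v + u by rewrite addeC.
  rewrite setCK.
  exact: gen.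
move=> mA yx.
have tv : gauss_tv s (b_of x y) <= (a0 / 2)%:E.
  apply: gauss_tv_le => //.
  - by rewrite divr_gt0.
  - by move: a0_le; lra.
  - rewrite /b_of sqn_tscale exprVn mulrC ler_pdivrMr ?exprn_gt0//.
    by rewrite -exprMn.
have := overlap mA xy.
move=> /le_trans/(_ (leeD2l _ tv)).
have : a0%:E <= (rate y)%:E by rewrite lee_fin; exact: rwm_rate_ge.
move=> /le_trans h /h {h}.
have -> : a0%:E = (a0 / 2)%:E + (a0 / 2)%:E by rewrite -EFinD -splitr.
by rewrite leeD2rE.
Qed.

Let PE x A : measurable A -> \int[P x]_y (\1_A y : R)%:E = P x A.
Proof. by move=> mA; rewrite integral_indic// setIT. Qed.

Lemma measurable_rwm A : measurable A -> measurable_fun setT (fun x => P x A).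
Proof.
move=> mA; under eq_fun do rewrite -PE//.
apply: measurable_integral_rwm => //.
by apply/measurable_EFinP; exact: measurable_indic.
Qed.

Let flow A : \bar R := \int[pi]_(x in A) P x (~` A).

(** Reversibility for the indicators of A and of its complement. *)
Let flowC A : measurable A -> flow (~` A) = flow A.
Proof.
move=> mA; have mC := measurableC mA.
have E B : measurable B ->
    flow B = \int[pi]_x ((\1_B x : R)%:E * \int[P x]_y (\1_(~` B) y : R)%:E).
  move=> mB; rewrite /flow integral_mkcond; apply: eq_integral => x _.
  rewrite epatch_indic (PE _ (measurableC mB)); exact: muleC.
have mi B : measurable B -> measurable_fun setT (fun x : T => (\1_B x : R)%:E).
  by move=> mB; apply/measurable_EFinP; exact: measurable_indic.
have i0 B (x : T) : 0 <= (\1_B x : R)%:E by rewrite lee_fin.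
rewrite (E _ mA) (E _ mC) setCK.
exact: (rwm_reversible s s0_gt0 (mi _ mC) (mi _ mA) (i0 _) (i0 _)).
Qed.

(** The threshold is half of the bound in [close_overlap], so a point in the core of A and one in
    the core of its complement cannot be close. *)
Let core A := A `&` [set x | P x (~` A) < (a0 / 4)%:E].

Let mcore A : measurable A -> measurable (core A).
Proof.
move=> mA; apply: measurableI => //.
rewrite (_ : [set _ | _] = setT `&` (fun x => P x (~` A)) @^-1` `]-oo, (a0 / 4)%:E[%classic).
  by apply: (measurable_rwm (measurableC mA)) => //; exact: emeasurable_itv.
by rewrite setTI; apply/seteqP; split => x /=; rewrite in_itv.
Qed.

Let flow_ge A : measurable A -> (a0 / 4)%:E * pi (A `\` core A) <= flow A.
Proof.
move=> mA; have mD : measurable (A `\` core A) by apply: measurableD => //; exact: mcore.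
have mP := measurable_rwm (measurableC mA).
apply: (@le_trans _ _ (\int[pi]_(x in A `\` core A) P x (~` A))); last first.
  by apply: ge0_subset_integral => //; exact: measurable_funTS.
rewrite -integral_cst//; apply: ge0_le_integral => //.
- by move=> x _; rewrite lee_fin divr_ge0// ltW.
- exact: measurable_funTS.
- by move=> x [Ax nc]; rewrite leNgt; apply/negP => h; exact: nc.
Qed.

(** Either the core misses at least a quarter of A or of its complement, and those points already
    escape with probability a0 / 4; or both cores are large, and the three-set inequality makes the
    remaining points numerous. *)
Lemma rwm_flow_ge A : measurable A ->
  (216 / 10 ^+ 5 * expR (- (s / s0) ^+ 2) * (s / s0 * tau))%:E * (pi A * pi (~` A))
  <= \int[pi]_(x in A) P x (~` A).
Proof.
move=> mA; have mC := measurableC mA.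
have m1 := mcore mA; have m2 := mcore mC.
set A1 := core A in m1; set A2 := core (~` A) in m2.
have dpos : (0 < a0 / 2 * s * tau)%R by rewrite mulr_gt0// mulr_gt0// divr_gt0.
have sep x y : A1 x -> A2 y -> ((a0 / 2 * s * tau) ^+ 2 <= sqn (tsub y x))%R.
  move=> [Ax Px] [Ay Py]; rewrite leNgt; apply/negP => /ltW yx.
  have Px' : P x (~` A) < (a0 / 4)%:E := Px.
  have Py' : P y (~` ~` A) < (a0 / 4)%:E := Py.
  rewrite setCK in Py'.
  have := close_overlap mA yx; apply/negP; rewrite -ltNge.
  have -> : (a0 / 2)%:E = (a0 / 4)%:E + (a0 / 4)%:E.
    by rewrite -EFinD; congr EFin; field.
  exact: (lteD Px' Py').
have iso := gauss_three_set s0_gt0 dpos m1 m2 sep.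
have gfin B : measurable B -> pi B \is a fin_num by move=> mB; exact: fin_num_measure.
pose mu B := fine (pi B).
have muE B : measurable B -> pi B = (mu B)%:E by move=> mB; rewrite fineK// gfin.
have mu0 B : (0 <= mu B)%R by exact: fine_ge0.
have muD B C : measurable B -> measurable C -> C `<=` B -> mu (B `\` C) = (mu B - mu C)%R.
  move=> mB mC' CB; rewrite /mu measureD//; last by rewrite -ge0_fin_numE// gfin.
  by rewrite setIidr// fineB// gfin.
have mAC : (mu A + mu (~` A) = 1)%R.
  apply: EFin_inj; rewrite EFinD -!muE// -measureU//; last by rewrite setICr.
  by rewrite setUCr; exact: gauss_setT.
have m3 : measurable (~` (A1 `|` A2)) by apply: measurableC; exact: measurableU.
have mu3 : mu (~` (A1 `|` A2)) = ((mu A - mu A1) + (mu (~` A) - mu A2))%R.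
  have -> : ~` (A1 `|` A2) = (A `\` A1) `|` (~` A `\` A2).
    rewrite setCU; apply/seteqP; split => [x [n1 n2]|x [[Ax n1]|[Ax n2]]].
    - by have [Ax|Ax] := pselect (A x); [left|right].
    - by split => // -[].
    - by split => // -[].
  have mD1 := measurableD mA m1; have mD2 := measurableD mC m2.
  rewrite -muD//; last by move=> x [].
  rewrite -muD//; last by move=> x [].
  apply: EFin_inj; rewrite EFinD -!muE//; last exact: measurableU.
  rewrite measureU//; apply/seteqP; split => // x [[Ax _] [nAx _]].
  exact: nAx.
have f1 := flow_ge mA; have f2 := flow_ge mC; rewrite flowC// in f2.
have fE B : measurable B -> measurable (core B) ->
    (a0 / 4)%:E * pi (B `\` core B) = (a0 / 4 * (mu B - mu (core B)))%:E.
  move=> mB mcB; rewrite muE; last exact: measurableD.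
  by rewrite muD// => x [].
rewrite (fE _ mA m1) in f1; rewrite (fE _ mC m2) in f2.
rewrite !muE// -!EFinM lee_fin mu3 in iso.
rewrite !muE// -!EFinM -/(flow A).
move: f1 f2 iso mAC (mu0 A) (mu0 (~` A)) (mu0 A1) (mu0 A2); rewrite -/A1 -/A2.
move: (flow A) (mu A) (mu (~` A)) (mu A1) (mu A2) => phi a b a1 a2.
move=> f1 f2 iso ab a_ge0 b_ge0 a1_ge0 a2_ge0.
clear - d_gt0 s0_gt0 s_gt0 a0_gt0 s0n0 tau_gt0 dpos f1 f2 iso ab a_ge0 b_ge0 a1_ge0 a2_ge0.
set h := (s / s0 * tau)%R.
have h0 : (0 < h)%R by rewrite /h mulr_gt0// divr_gt0.
pose E0 := expR (- ((s / s0) ^+ 2 / 2)) : R.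
have E0_gt0 : (0 < E0)%R by exact: expR_gt0.
have EE : expR (- (s / s0) ^+ 2) = (E0 ^+ 2)%R.
  by rewrite /E0 -expRM_natr; congr expR; field.
have a0E : a0 = (E0 / 2)%R by [].
(* Since h <= vs and vs * exp(- vs^2 / 2) <= 1. This lets the target bound, quadratic in E0, be
   dominated by a0 / 16, linear in E0, when a core is small. *)
have hE0 : (h * E0 <= 1)%R.
  have tau1 : (tau <= 1)%R by rewrite invf_le1 ?sqrtr_gt0 ?ltr0n// -[leLHS]sqrtr1 ler_wsqrtr// ler1n.
  have v0 : (0 < s / s0)%R by rewrite divr_gt0.
  have hv : (h <= s / s0)%R by rewrite /h ler_piMr// ltW.
  have : (s / s0 * E0 <= 1)%R.
    rewrite /E0 expRN ler_pdivrMr ?expR_gt0// mul1r.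
    rewrite (le_trans _ (expR_ge1Dx _))//; nra.
  nra.
have a1b : (a <= 1)%R by lra.
have b1b : (b <= 1)%R by lra.
rewrite EE; set c := (216 / 10 ^+ 5)%R.
have c0 : (0 < c)%R by rewrite /c; lra.
have small : (c * E0 ^+ 2 * h <= a0 / 16)%R.
  rewrite a0E; have : (c <= 32^-1)%R by rewrite /c; lra.
  have : (E0 ^+ 2 * h <= E0)%R by nra.
  nra.
have ab0 : (0 <= a * b)%R by exact: mulr_ge0.
have abE : (a * b <= a)%R by rewrite ler_piMr.
have baE : (a * b <= b)%R by rewrite ler_piMl.
have a0p := a0_gt0.
have cEh : (0 <= c * E0 ^+ 2 * h)%R.
  apply: mulr_ge0; last exact: ltW.
  by apply: mulr_ge0; [exact: ltW|exact: sqr_ge0].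
have [a1s|a1l] := leP a1 (3 / 4 * a)%R.
  apply: le_trans f1; rewrite lee_fin.
  apply: (@le_trans _ _ (a0 / 16 * a)%R); first exact: ler_pM.
  by nra.
have [a2s|a2l] := leP a2 (3 / 4 * b)%R.
  apply: le_trans f2; rewrite lee_fin.
  apply: (@le_trans _ _ (a0 / 16 * b)%R); first exact: ler_pM.
  by nra.
set a3 := (a - a1 + (b - a2))%R in iso.
have hiso : (a0 / 8 * h * (a1 * a2) <= a3)%R.
  have a30 : (0 <= a3)%R.
    have e20 : (0 < 4 * s0 * expR (- 2^-1))%R by rewrite mulr_gt0 ?expR_gt0// mulr_gt0.
    rewrite -(pmulr_rge0 _ e20) (le_trans _ iso)// mulr_ge0 ?(ltW dpos)// mulr_ge0//.
  have e21 : (expR (- 2^-1) <= 1 :> R)%R by rewrite expR_le1 oppr_le0.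
  have : (4 * s0 * expR (- 2^-1) * a3 <= 4 * s0 * a3)%R.
    by apply: ler_wpM2r => //; apply: ler_piMr => //; rewrite mulr_ge0// ltW.
  move=> /(le_trans iso); rewrite (mulrC (4 * s0)%R) -ler_pdivrMr ?mulr_gt0//.
  congr (_ <= _)%R; rewrite /h; field.
  by rewrite s0n0 gt_eqF// sqrtr_gt0 ltr0n.
have a12 : (9 / 16 * (a * b) <= a1 * a2)%R by nra.
(* By reversibility [f1] and [f2] bound the same flow. Adding them counts it twice, which is why 2 *
   c is compared with 9 / 2048 in the end. *)
rewrite leNgt; apply/negP => phi_lt.
have /lteD/(_ phi_lt) := phi_lt; apply/negP; rewrite -leNgt -EFinD.
apply: le_trans (leeD f1 f2); rewrite -EFinD lee_fin -[leRHS]mulrDr -/a3.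
apply: (@le_trans _ _ (a0 / 4 * (a0 / 8 * h * (9 / 16 * (a * b))))%R); last first.
  rewrite ler_wpM2l ?divr_ge0 ?(ltW a0p)//; apply: le_trans hiso.
  by rewrite ler_wpM2l// mulr_ge0 ?divr_ge0// ltW.
rewrite a0E; have : (c <= 9 / 4096)%R by rewrite /c; lra.
have : (0 <= E0 ^+ 2 * h * (a * b))%R.
  apply: mulr_ge0; last exact: mulr_ge0.
  by apply: mulr_ge0; [exact: sqr_ge0|exact: ltW].
set X := (E0 ^+ 2 * h * (a * b))%R => X0 c9.
rewrite [leLHS](_ : _ = 2 * c * X)%R; last by rewrite /X; ring.
rewrite [leRHS](_ : _ = 9 / 2048 * X)%R; last by rewrite /X; field.
nra.
Qed.

End rwm_conductance.

(** * Positivity *)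

Lemma ge0_le_integral_double (R : realType) (dX : measure_display) (X : measurableType dX)
    (m : {measure set X -> \bar R}) (u v w : X -> \bar R) :
  measurable_fun setT u -> measurable_fun setT v -> measurable_fun setT w ->
  (forall x, 0 <= u x)%E -> (forall x, 0 <= v x)%E -> (forall x, 0 <= w x)%E ->
  (forall x, u x + u x <= v x + w x)%E ->
  (\int[m]_x u x + \int[m]_x u x <= \int[m]_x v x + \int[m]_x w x)%E.
Proof.
move=> mu mv mw u0 v0 w0 uvw; rewrite -!ge0_integralD//.
apply: ge0_le_integral => //.
- by move=> x _; rewrite adde_ge0.
- exact: emeasurable_funD.
- exact: emeasurable_funD.
Qed.

Section rwm_positivity.
Context {R : realType} {d : nat}.
Local Notation T := (d.-tuple R).
Local Notation L := (lebesgue_tuple R d).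
Variables (s0 s : R).
Hypotheses (s0_gt0 : 0 < s0) (s_gt0 : 0 < s).
Local Notation p := (@gauss_pdf R d s0).
Local Notation q := (@gauss_pdf R d s).
Local Notation pi := (@gauss R d s0).
Local Notation P := (@rwm_gauss R d s0 s).
Local Notation rate := (rwm_accept_rate p s).
Local Notation prop := rwm_prop.
Implicit Types (x y z u v w : T).

(** N(0, s^2 I) is the convolution square of N(0, s2^2 I). For fixed z, the product of psi at u and
    at u + z is, as a function of u, Gaussian around - z / 2 with standard deviation [s4]. *)
Let s2 : R := s / Num.sqrt 2.
Let s4 : R := s / 2.
Local Notation psi := (@gauss_pdf R d s2).
Let s20 : s2 != 0. Proof. by rewrite gt_eqF// divr_gt0// sqrtr_gt0. Qed.
Let s40 : s4 != 0. Proof. by rewrite gt_eqF// divr_gt0. Qed.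
Let sn0 : s != 0. Proof. by rewrite gt_eqF. Qed.

Let N (t : R) : R := Num.sqrt (2 * trigo.pi * t ^+ 2) ^+ d.

Let N_gt0 t : t != 0 -> 0 < N t.
Proof.
move=> t0; rewrite exprn_gt0// sqrtr_gt0.
by apply: mulr_gt0; rewrite ?exprn_even_gt0// mulr_gt0// pi_gt0.
Qed.

Let C0 : R := N s * N s4 / N s2 ^+ 2.

Let C0_gt0 : 0 < C0.
Proof. by apply: divr_gt0; [apply: mulr_gt0|apply: exprn_gt0]; exact: N_gt0. Qed.

Let psi_psi u z : psi u * psi (tadd u z) =
  C0 * q z * gauss_pdf s4 (tadd (tscale 2^-1 z) u).
Proof.
have n20 := N_gt0 s20; have n0 := N_gt0 sn0; have n40 := N_gt0 s40.
rewrite /C0 !gauss_pdfE -!/(N _).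
set e1 := expR _; set e2 := expR _; set e3 := expR _; set e4 := expR _.
suff e : e1 * e2 = e3 * e4.
  rewrite mulrACA e; field; by rewrite !gt_eqF.
rewrite /e1 /e2 /e3 /e4 -!expRD; congr expR.
rewrite /s2 /s4 !vectE !expr_div_n sqr_sqrtr// (dotpC z u).
by field.
Qed.

Local Open Scope ereal_scope.

Let conv_psi z : \int[L]_u (psi u * psi (tadd u z))%:E = (C0 * q z)%:E.
Proof.
under eq_integral do rewrite psi_psi EFinM.
rewrite ge0_integralZl//; last 3 first.
- by apply/measurable_EFinP; apply: measurable_fun_gauss_pdf; exact: measurable_tadd.
- by move=> u _; rewrite lee_fin gauss_pdf_ge0.
- by rewrite lee_fin mulr_ge0 ?gauss_pdf_ge0// (ltW C0_gt0).
by rewrite (integral_gauss_pdf_tadd _ s40) mule1.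
Qed.

(** The form <a, Q b> in L^2 of Lebesgue measure, where Q is the random walk that accepts every
    proposal. *)
Definition gauss_corr (a b : T -> \bar R) : \bar R :=
  \int[L]_x \int[L]_z (a x * b (prop x z) * (q z)%:E).

Let S (a : T -> \bar R) w : \bar R := \int[L]_u (a (prop w u) * (psi u)%:E).

Let mpsi : measurable_fun setT (fun u => (psi u)%:E).
Proof. by apply/measurable_EFinP; exact: measurable_gauss_pdf. Qed.

Let psi0 u : 0 <= (psi u)%:E. Proof. by rewrite lee_fin gauss_pdf_ge0. Qed.

Let mSin (a : T -> \bar R) : measurable_fun setT a ->
  measurable_fun setT (fun wu : T * T => a (prop wu.1 wu.2) * (psi wu.2)%:E).
Proof.
move=> ma; apply: emeasurable_funM; first exact: (measurableT_comp ma measurable_rwm_prop).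
exact: (measurableT_comp mpsi).
Qed.

Let mS (a : T -> \bar R) : measurable_fun setT a -> (forall x, 0 <= a x) ->
  measurable_fun setT (S a).
Proof.
move=> ma a0.
apply: (measurable_fun_fubini_tonelli_F (fun wu => a (prop wu.1 wu.2) * (psi wu.2)%:E)).
  exact: mSin.
by move=> wu; exact: mule_ge0.
Qed.

Let S0 (a : T -> \bar R) w : (forall x, 0 <= a x) -> 0 <= S a w.
Proof. by move=> a0; apply: integral_ge0 => u _; exact: mule_ge0. Qed.

Let back x u : T := tadd (tscale (- (Num.sqrt d%:R)^-1) u) x.

Let prop_back x u : prop (back x u) u = x.
Proof. by apply: eq_from_tnth => i; rewrite !tnth_mktuple; ring. Qed.

Let prop_back_tadd x u z : prop (back x u) (tadd u z) = prop x z.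
Proof. by apply: eq_from_tnth => i; rewrite !tnth_mktuple; ring. Qed.

(** Q is, up to the positive constant [C0], the square of the symmetric smoothing operator [S].
    Expanding S a and S b, the substitution x = w + d^(-1/2) u leaves the convolution of psi with
    itself at the difference z of the two increments. *)
Let gauss_corrE (a b : T -> \bar R) : measurable_fun setT a -> measurable_fun setT b ->
  (forall x, 0 <= a x) -> (forall x, 0 <= b x) ->
  C0%:E * gauss_corr a b = \int[L]_w (S a w * S b w).
Proof.
move=> ma mb a0 b0.
have mSb := mS mb b0; have S0b w := S0 w b0.
pose H1 (wu : T * T) := a (prop wu.1 wu.2) * (psi wu.2)%:E * S b wu.1.
have mH1 : measurable_fun setT H1.
  by apply: emeasurable_funM; [exact: mSin|exact: (measurableT_comp mSb)].
have H10 wu : 0 <= H1 wu by rewrite mule_ge0// mule_ge0.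
have mback : measurable_fun setT (fun xu : T * T => back xu.1 xu.2).
  by apply: measurable_fun_tadd => //; exact: measurable_fun_tscale.
pose H2 (xu : T * T) := a xu.1 * (psi xu.2)%:E * S b (back xu.1 xu.2).
have mH2 : measurable_fun setT H2.
  apply: emeasurable_funM; last exact: (measurableT_comp mSb).
  by apply: emeasurable_funM; [exact: (measurableT_comp ma)|exact: (measurableT_comp mpsi)].
have H20 xu : 0 <= H2 xu by rewrite mule_ge0// mule_ge0.
pose H3 x (uz : T * T) := b (prop x uz.2) * (psi uz.1 * psi (tadd uz.1 uz.2))%:E.
have mpz : measurable_fun setT (fun uz : T * T => (psi uz.1 * psi (tadd uz.1 uz.2))%:E).
  apply/measurable_EFinP; apply: measurable_funM; apply: measurable_fun_gauss_pdf => //.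
  exact: measurable_fun_tadd.
have mpx x : measurable_fun setT (prop x).
  exact: (measurableT_comp measurable_rwm_prop (measurable_pair1 x)).
have mH3 x : measurable_fun setT (H3 x).
  apply: emeasurable_funM => //; apply: (measurableT_comp mb).
  exact: (measurableT_comp (mpx x)).
have H30 x uz : 0 <= H3 x uz by rewrite mule_ge0// lee_fin mulr_ge0 ?gauss_pdf_ge0.
apply/esym; transitivity (\int[L]_w \int[L]_u H1 (w, u)).
  apply: eq_integral => w _; rewrite -ge0_integralZr//.
  - exact: (measurableT_comp (mSin ma) (measurable_pair1 w)).
  - by move=> u _; exact: mule_ge0.
transitivity (\int[L]_u \int[L]_w H1 (w, u)); first exact: (fubini_tonelli H1 mH1 H10).
transitivity (\int[L]_u \int[L]_x H2 (x, u)).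
  apply: eq_integral => u _.
  rewrite -(lebesgue_tuple_translation (tscale (- (Num.sqrt d%:R)^-1) u)
    (f := fun w => H1 (w, u))); last 2 first.
  - exact: (measurableT_comp mH1).
  - by move=> w; exact: H10.
  by apply: eq_integral => x _; rewrite /H1/= -/(back x u) prop_back.
transitivity (\int[L]_x \int[L]_u H2 (x, u)).
  exact/esym/(fubini_tonelli H2 mH2 H20).
have C00 : 0 <= C0%:E by rewrite lee_fin (ltW C0_gt0).
have mG : measurable_fun setT (fun xz : T * T => a xz.1 * b (prop xz.1 xz.2) * (q xz.2)%:E).
  apply: emeasurable_funM.
    apply: emeasurable_funM; first exact: (measurableT_comp ma).
    exact: (measurableT_comp mb measurable_rwm_prop).
  by apply/measurable_EFinP; exact: measurable_fun_gauss_pdf.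
have G0 xz : 0 <= a xz.1 * b (prop xz.1 xz.2) * (q xz.2)%:E.
  by rewrite mule_ge0 ?lee_fin ?gauss_pdf_ge0// mule_ge0.
rewrite /gauss_corr -ge0_integralZl//; last 2 first.
- exact: (measurable_fun_fubini_tonelli_F _ mG G0).
- by move=> x _; apply: integral_ge0 => z _; exact: (G0 (x, z)).
apply: eq_integral => x _.
rewrite -ge0_integralZl//; last 2 first.
- exact: (measurableT_comp mG (measurable_pair1 x)).
- by move=> z _; exact: (G0 (x, z)).
transitivity (a x * \int[L]_u \int[L]_z H3 x (u, z)).
  have mI : measurable_fun setT (fun u => \int[L]_z H3 x (u, z)).
    exact: (measurable_fun_fubini_tonelli_F (H3 x) (mH3 x) (H30 x)).
  have I0 u : 0 <= \int[L]_z H3 x (u, z).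
    by apply: integral_ge0 => z _; exact: H30.
  rewrite -(ge0_integralZl L measurableT mI (fun u _ => I0 u) (a0 x)).
  apply: eq_integral => u _; rewrite /H2 /H3 /= -muleA; congr (_ * _).
  rewrite /S -(lebesgue_tuple_translation u
    (f := fun v => b (prop (back x u) v) * (psi v)%:E)); last 2 first.
  - exact: (measurableT_comp (mSin mb) (measurable_pair1 (back x u))).
  - by move=> v; exact: mule_ge0.
  rewrite -ge0_integralZl//; last 2 first.
  - exact: (measurableT_comp (measurableT_comp (mSin mb) (measurable_pair1 (back x u)))
      (measurable_tadd u)).
  - by move=> z _; exact: mule_ge0.
  apply: eq_integral => z _; by rewrite prop_back_tadd (EFinM (psi u)) [RHS]muleCA.
transitivity (a x * \int[L]_z \int[L]_u H3 x (u, z)).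
  have E : \int[L]_u \int[L]_z H3 x (u, z) = \int[L]_z \int[L]_u H3 x (u, z) :=
    fubini_tonelli (H3 x) (mH3 x) (H30 x).
  exact (congr1 (fun r => a x * r) E).
have mI : measurable_fun setT (fun z => \int[L]_u H3 x (u, z)).
  exact: (measurable_fun_fubini_tonelli_G (H3 x) (mH3 x) (H30 x)).
have I0 z : 0 <= \int[L]_u H3 x (u, z).
  by apply: integral_ge0 => u _; exact: H30.
rewrite -(ge0_integralZl L measurableT mI (fun z _ => I0 z) (a0 x)).
apply: eq_integral => z _; rewrite /H3/= ge0_integralZl//; last 2 first.
- exact: (measurableT_comp mpz (measurable_pair2 z)).
- by move=> u _; rewrite lee_fin mulr_ge0 ?gauss_pdf_ge0.
by rewrite conv_psi EFinM -(muleA (a x)) [b _ * (C0%:E * _)]muleCA [LHS]muleCA.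
Qed.

Lemma amgm_ereal (x y : \bar R) : 0 <= x -> 0 <= y -> x * y + x * y <= x * x + y * y.
Proof.
move: x y => [x| |] [y| |]// x0 y0; rewrite ?mulyy ?addye ?addey ?leey//.
by rewrite -!EFinM -!EFinD lee_fin -subr_ge0; have := sqr_ge0 (x - y); rewrite expr2; lra.
Qed.

Let gauss_corr_amgm (a b : T -> \bar R) :
  measurable_fun setT a -> measurable_fun setT b ->
  (forall x, 0 <= a x) -> (forall x, 0 <= b x) ->
  gauss_corr a b + gauss_corr a b <= gauss_corr a a + gauss_corr b b.
Proof.
move=> ma mb a0 b0.
have J0 (f g : T -> \bar R) : (forall x, 0 <= f x) -> (forall x, 0 <= g x) ->
    0 <= gauss_corr f g.
  move=> f0 g0; apply: integral_ge0 => x _; apply: integral_ge0 => z _.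
  by rewrite mule_ge0 ?lee_fin ?gauss_pdf_ge0// mule_ge0.
have gen (c u v w X Y Z : \bar R) : 0 < c -> c \is a fin_num ->
    0 <= u -> 0 <= v -> 0 <= w ->
    c * u = X -> c * v = Y -> c * w = Z -> X + X <= Y + Z -> u + u <= v + w.
  move=> c0 cfin u0 v0 w0 <- <- <-.
  by rewrite -ge0_muleDr// -ge0_muleDr// lee_pmul2l.
have mSa := mS ma a0; have mSb := mS mb b0.
have Sa0 w := S0 w a0; have Sb0 w := S0 w b0.
have mM f g : measurable_fun setT (S f) -> measurable_fun setT (S g) ->
  measurable_fun setT (fun w => S f w * S g w) by exact: emeasurable_funM.
have M0 f g : (forall w, 0 <= S f w) -> (forall w, 0 <= S g w) ->
  forall w, setT w -> 0 <= S f w * S g w by move=> f0 g0 w _; exact: mule_ge0.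
have C0p : 0 < C0%:E by rewrite lte_fin.
have C0f : C0%:E \is a fin_num by [].
refine (gen C0%:E _ _ _ _ _ _ C0p C0f (J0 _ _ a0 b0) (J0 _ _ a0 a0) (J0 _ _ b0 b0)
  (gauss_corrE ma mb a0 b0) (gauss_corrE ma ma a0 a0) (gauss_corrE mb mb b0 b0) _).
have le : \int[L]_w (S a w * S b w + S a w * S b w) <=
    \int[L]_w (S a w * S a w + S b w * S b w).
  apply: ge0_le_integral => //.
  - by move=> w _; rewrite adde_ge0// mule_ge0.
  - by apply: emeasurable_funD; exact: mM.
  - by apply: emeasurable_funD; exact: mM.
  - by move=> w _; exact: amgm_ereal.
have D1 := ge0_integralD L measurableT (M0 a b Sa0 Sb0) (mM a b mSa mSb)
  (M0 a b Sa0 Sb0) (mM a b mSa mSb).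
have D2 := ge0_integralD L measurableT (M0 a a Sa0 Sa0) (mM a a mSa mSa)
  (M0 b b Sb0 Sb0) (mM b b mSb mSb).
by move: le; rewrite D1 D2.
Qed.

(** The condition 0 <= t allows the levels to range over all of R with Lebesgue measure. *)
Let ind (t : R) x : R := ((0 <= t) && (t < p x))%R%:R.

Let cut (a : T -> \bar R) t x : \bar R := a x * (ind t x)%:E.

Let mind : measurable_fun setT (fun tx : measurableTypeR R * T => ind tx.1 tx.2).
Proof.
apply: (measurableT_comp (f := fun b : bool => b%:R : R)) => //.
apply: measurable_and; first exact: measurable_fun_ler.
apply: measurable_fun_ltr => //.
exact: measurable_fun_gauss_pdf.
Qed.

Lemma measurable_ind_comp (d' : measure_display) (X : measurableType d')
    (t : X -> measurableTypeR R) (h : X -> T) :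
  measurable_fun setT t -> measurable_fun setT h ->
  measurable_fun setT (fun u : X => ind (t u) (h u)).
Proof. by move=> mt mh; exact: (measurableT_comp mind (measurable_fun_pair mt mh)). Qed.

Let p_gt0 x : (0 < p x)%R. Proof. by apply: gauss_pdf_gt0; rewrite gt_eqF. Qed.

Let layer_cake x y :
  \int[@lebesgue_measure R]_t (ind t x * ind t y)%:E = (Num.min (p x) (p y))%:E.
Proof.
pose I := `[0%R, Num.min (p x) (p y)[%classic : set R.
transitivity (\int[@lebesgue_measure R]_t (\1_I t)%:E).
  apply: eq_integral => t _; congr EFin.
  rewrite /ind indicE -natrM mulnb /I mem_setE in_itv/= lt_min.
  by case: (0 <= t)%R.
transitivity (@lebesgue_measure R (I `&` setT)).
  by apply: integral_indic => //; exact: measurable_itv.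
rewrite setIT /I lebesgue_measure_itv/= lte_fin lt_min !p_gt0/=.
by rewrite oppr0 adde0.
Qed.

(* Layer-cake decomposition of [min (p x) (p y)]. *)
Let flow_layers (a b : T -> \bar R) :
  measurable_fun setT a -> measurable_fun setT b ->
  (forall x, 0 <= a x) -> (forall x, 0 <= b x) ->
  rwm_flow s0 s a b = \int[@lebesgue_measure R]_t gauss_corr (cut a t) (cut b t).
Proof.
move=> ma mb a0 b0.
have ind0 t x : (0 <= ind t x)%R by exact: ler0n.
pose G (u : T * T) := a u.1 * b (prop u.1 u.2) * (q u.2)%:E.
have mG : measurable_fun setT G.
  apply: emeasurable_funM.
    apply: emeasurable_funM; first exact: (measurableT_comp ma).
    exact: (measurableT_comp mb measurable_rwm_prop).
  by apply/measurable_EFinP; exact: measurable_fun_gauss_pdf.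
have G0 (u : T * T) : 0 <= G u by rewrite mule_ge0 ?lee_fin ?gauss_pdf_ge0// mule_ge0.
pose I (ut : (T * T) * measurableTypeR R) := (ind ut.2 ut.1.1 * ind ut.2 (prop ut.1.1 ut.1.2))%:E.
have mI : measurable_fun setT I.
  apply/measurable_EFinP; apply: measurable_funM.
    apply: measurable_ind_comp => //.
    exact: (measurableT_comp measurable_fst measurable_fst).
  apply: measurable_ind_comp => //.
  exact: (measurableT_comp measurable_rwm_prop measurable_fst).
have I0 ut : 0 <= I ut by rewrite lee_fin mulr_ge0.
pose K ut := G ut.1 * I ut.
have mK : measurable_fun setT K.
  by apply: emeasurable_funM => //; exact: (measurableT_comp mG).
have K0 ut : 0 <= K ut by exact: mule_ge0.
have swap d1 (X : measurableType d1) (h1 : X -> T) (h2 : X -> T) (h3 : X -> measurableTypeR R) :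
    measurable_fun setT h1 -> measurable_fun setT h2 -> measurable_fun setT h3 ->
    measurable_fun setT (fun w : X => K (h1 w, h2 w, h3 w)).
  move=> m1 m2 m3; apply: (measurableT_comp mK).
  by apply: measurable_fun_pair => //; exact: measurable_fun_pair.
transitivity (\int[L]_x \int[L]_z \int[@lebesgue_measure R]_t K ((x, z), t)).
  apply: eq_integral => x _; apply: eq_integral => z _.
  have Z := ge0_integralZl (@lebesgue_measure R) measurableT
    (measurableT_comp mI (measurable_pair1 (x, z))) (fun t _ => I0 ((x, z), t)) (G0 (x, z)).
  apply: (eq_trans _ (esym Z)).
  rewrite /G/= (_ : \int[_]_t I _ = (Num.min (p x) (p (prop x z)))%:E); last first.
    by rewrite -layer_cake; apply: eq_integral => t _.
  by rewrite -!muleA; do 2 congr (_ * _); rewrite -EFinM mulrC.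
transitivity (\int[L]_x \int[@lebesgue_measure R]_t \int[L]_z K ((x, z), t)).
  apply: eq_integral => x _.
  pose Kx (zt : T * measurableTypeR R) := K ((x, zt.1), zt.2).
  have mKx : measurable_fun setT Kx by exact: swap.
  exact: (@fubini_tonelli _ _ _ _ R L (@lebesgue_measure R) Kx mKx (fun _ => K0 _)).
pose F (xt : T * measurableTypeR R) := \int[L]_z K ((xt.1, z), xt.2).
have mF : measurable_fun setT F.
  pose K' (w : (T * measurableTypeR R) * T) := K ((w.1.1, w.2), w.1.2).
  have mK' : measurable_fun setT K'.
    apply: swap => //; exact: (measurableT_comp _ measurable_fst).
  exact: (@measurable_fun_fubini_tonelli_F _ _ _ _ R L K' mK' (fun _ => K0 _)).
have F0 xt : 0 <= F xt by apply: integral_ge0 => z _; exact: K0.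
transitivity (\int[@lebesgue_measure R]_t \int[L]_x F (x, t)).
  exact: (@fubini_tonelli _ _ _ _ R L (@lebesgue_measure R) F mF F0).
apply: eq_integral => t _.
apply: eq_integral => x _; apply: eq_integral => z _.
by rewrite /K /G /I /cut/= EFinM [LHS]muleAC (muleACA (a x)).
Qed.

(** Both parts of P are sums of squares: each layer of the accepted part is a form [gauss_corr], and
    the rejection part is diagonal. The statement is additive because every term may be +oo. *)
Lemma rwm_positive (f g : T -> \bar R) : measurable_fun setT f -> measurable_fun setT g ->
  (forall x, 0 <= f x) -> (forall x, 0 <= g x) ->
  \int[pi]_x (f x * \int[P x]_y g y) + \int[pi]_x (f x * \int[P x]_y g y) <=
  \int[pi]_x (f x * \int[P x]_y f y) + \int[pi]_x (g x * \int[P x]_y g y).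
Proof.
move=> mf mg f0 g0; rewrite !rwm_bilinearE// addeACA [leRHS]addeACA; apply: leeD.
  have gen (u v w X Y Z : \bar R) : u = X -> v = Y -> w = Z ->
    X + X <= Y + Z -> u + u <= v + w by move=> -> -> ->.
  refine (gen _ _ _ _ _ _ (flow_layers mf mg f0 g0) (flow_layers mf mf f0 f0)
    (flow_layers mg mg g0 g0) _).
  have mcut (a : T -> \bar R) t : measurable_fun setT a -> measurable_fun setT (cut a t).
    move=> ma; apply: emeasurable_funM => //; apply/measurable_EFinP.
    exact: (measurableT_comp mind (measurable_pair1 t)).
  have cut0 (a : T -> \bar R) t x : (forall x, 0 <= a x) -> 0 <= cut a t x.
    by move=> a0; rewrite mule_ge0// lee_fin ler0n.
  have mJ (a b : T -> \bar R) : measurable_fun setT a -> measurable_fun setT b ->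
      (forall x, 0 <= a x) -> (forall x, 0 <= b x) ->
      measurable_fun setT (fun t : measurableTypeR R => gauss_corr (cut a t) (cut b t)).
    move=> ma mb a0 b0.
    pose K (tu : measurableTypeR R * (T * T)) := cut a tu.1 tu.2.1 *
      cut b tu.1 (prop tu.2.1 tu.2.2) * (q tu.2.2)%:E.
    have mK : measurable_fun setT K.
      apply: emeasurable_funM; last first.
        apply/measurable_EFinP; apply: measurable_fun_gauss_pdf.
        exact: (measurableT_comp measurable_snd measurable_snd).
      have mh : measurable_fun setT (fun tu : measurableTypeR R * (T * T) => tu.2.1).
        exact: (measurableT_comp measurable_fst measurable_snd).
      have mpp : measurable_fun setT (fun tu : measurableTypeR R * (T * T) =>
          prop tu.2.1 tu.2.2).
        exact: (measurableT_comp measurable_rwm_prop measurable_snd).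
      apply: emeasurable_funM; apply: emeasurable_funM.
      - exact: (measurableT_comp ma mh).
      - apply/measurable_EFinP; exact: measurable_ind_comp.
      - exact: (measurableT_comp mb mpp).
      - apply/measurable_EFinP; exact: measurable_ind_comp.
    have K0 tu : 0 <= K tu.
      by rewrite mule_ge0 ?lee_fin ?gauss_pdf_ge0// mule_ge0// cut0.
    pose K' (w : (measurableTypeR R * T) * T) := K (w.1.1, (w.1.2, w.2)).
    have mK' : measurable_fun setT K'.
      apply: (measurableT_comp mK); apply: measurable_fun_pair.
        exact: (measurableT_comp measurable_fst measurable_fst).
      apply: measurable_fun_pair => //.
      exact: (measurableT_comp measurable_snd measurable_fst).
    have mF := @measurable_fun_fubini_tonelli_F _ _ _ _ R L K' mK' (fun _ => K0 _).
    have F0 (tx : measurableTypeR R * T) : 0 <= fubini_F L K' tx.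
      by apply: integral_ge0 => z _; exact: K0.
    exact: (@measurable_fun_fubini_tonelli_F _ _ _ _ R L _ mF F0).
  have J0 (a b : T -> \bar R) t : (forall x, 0 <= a x) -> (forall x, 0 <= b x) ->
      0 <= gauss_corr (cut a t) (cut b t).
    move=> a0 b0; apply: integral_ge0 => x _; apply: integral_ge0 => z _.
    by rewrite mule_ge0 ?lee_fin ?gauss_pdf_ge0// mule_ge0// cut0.
  apply: ge0_le_integral_double => [|||t|t|t|t]; [exact: mJ|exact: mJ|exact: mJ|
    exact: J0|exact: J0|exact: J0|apply: gauss_corr_amgm; first exact: mcut].
  - exact: mcut.
  - by move=> x; exact: cut0.
  - by move=> x; exact: cut0.
have stay0 x : 0 <= (1 - rate x)%:E by rewrite lee_fin subr_ge0 rwm_rate_le1.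
have mstay : measurable_fun setT (fun x : T => (1 - rate x)%:E).
  apply/measurable_EFinP.
  by apply: measurable_funB => //; exact: measurable_rwm_rate.
have mI (a b : T -> \bar R) : measurable_fun setT a -> measurable_fun setT b ->
    measurable_fun setT (fun x => a x * b x * (1 - rate x)%:E).
  by move=> ma mb; apply: emeasurable_funM => //; exact: emeasurable_funM.
have I0 (a b : T -> \bar R) x : (forall x, 0 <= a x) -> (forall x, 0 <= b x) ->
    0 <= a x * b x * (1 - rate x)%:E.
  by move=> a0 b0; rewrite mule_ge0// mule_ge0.
apply: ge0_le_integral_double => [|||x|x|x|x]; [exact: mI|exact: mI|exact: mI|
  exact: I0|exact: I0|exact: I0|].
have D (u v : \bar R) : 0 <= u -> 0 <= v ->
    u * (1 - rate x)%:E + v * (1 - rate x)%:E = (u + v) * (1 - rate x)%:E.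
  by move=> u0 v0; rewrite ge0_muleDl.
rewrite !D ?mule_ge0//.
by apply: lee_wpmul2r => //; exact: amgm_ereal.
Qed.

End rwm_positivity.

(** * Square-integrable functions *)

Section square_integrable.
Context {dT : measure_display} {T : measurableType dT} {R : realType}.
Variable mu : {measure set T -> \bar R}.
Implicit Types (f g h : T -> R) (a : R).
Local Notation L2 f := (f \in Lfun mu 2%:E).
Local Notation dot := (l2dot mu).

Lemma Lfun2P f : L2 f <->
  measurable_fun setT f /\ (\int[mu]_x (f x ^+ 2)%:E < +oo)%E.
Proof.
split=> [f2|[mf f2]].
  have /integrable_lty := Lfun2_integrable_sqr f2; move=> /(_ measurableT) foo.
  by split => //; move: f2; rewrite inE => /andP[] /[!inE].
rewrite inE; apply/andP; split; rewrite inE//=.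
rewrite /finite_norm unlock; apply: poweR_lty; apply: le_lt_trans f2.
rewrite le_eqVlt; apply/orP; left; apply/eqP.
apply: eq_integral => x _ /=.
by rewrite powR_mulrn// real_normK ?num_real.
Qed.

Lemma Lfun2_measurable f : L2 f -> measurable_fun setT f.
Proof. by move=> /Lfun2P[]. Qed.

Lemma Lfun2_integrable_mul f g : L2 f -> L2 g ->
  mu.-integrable setT (EFin \o (fun x => f x * g x)).
Proof. by move=> f2 g2; apply/Lfun1_integrable; exact: Lfun2_mul_Lfun1. Qed.

Lemma Lfun2_integrable f : (mu setT \is a fin_num)%E -> L2 f ->
  mu.-integrable setT (EFin \o f).
Proof. by move=> mT f2; apply/Lfun1_integrable; exact: Lfun_subset12. Qed.

Lemma Lfun2_cst a : (mu setT \is a fin_num)%E -> L2 (cst a).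
Proof.
move=> mT; apply/Lfun2P; split => //.
rewrite [ltLHS](integral_cst mu measurableT (a ^+ 2)%:E).
rewrite lte_mul_pinfty ?lee_fin ?sqr_ge0//.
by move: mT; rewrite ge0_fin_numE.
Qed.

Lemma Lfun2_lin a f g : L2 f -> L2 g -> L2 (fun x => a * f x + g x).
Proof.
move=> f2 g2.
exact: ((@Lfun_submod_closed _ _ _ mu _ (lee1n 2)).2 a f g f2 g2).
Qed.

Lemma Lfun2_scale a f : L2 f -> L2 (fun x => a * f x).
Proof. move=> f2; have z2 : L2 (cst 0).
  apply/Lfun2P; split => //; under eq_integral do rewrite /cst/= expr0n/=.
  by rewrite integral0.
have := Lfun2_lin a f2 z2.
by rewrite (_ : (fun x => a * f x + _) = fun x => a * f x)//; apply/funext => x; rewrite addr0. Qed.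

Lemma Lfun2_sub f g : L2 f -> L2 g -> L2 (fun x => f x - g x).
Proof. move=> f2 g2; have := Lfun2_lin (-1) g2 f2.
rewrite (_ : (fun x => -1 * g x + _) = fun x => f x - g x)//.
by apply/funext => x; rewrite mulN1r addrC. Qed.

Lemma Lfun2_dom f g : measurable_fun setT f -> L2 g ->
  (forall x, `|f x| <= `|g x|) -> L2 f.
Proof.
move=> mf /Lfun2P[mg g2] fg; apply/Lfun2P; split => //.
apply: le_lt_trans g2; apply: ge0_le_integral => //.
- by move=> x _; rewrite lee_fin sqr_ge0.
- by apply/measurable_EFinP; exact: measurable_funX.
- by apply/measurable_EFinP; exact: measurable_funX.
- move=> x _; rewrite lee_fin -(real_normK (num_real (f x))).
  by rewrite -(real_normK (num_real (g x))) lerXn2r ?nnegrE.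
Qed.

Lemma l2norm_sqr f : L2 f -> l2norm mu f ^+ 2 = dot f f.
Proof.
move=> f2; rewrite /l2norm /l2dot /Rintegral.
under eq_integral do rewrite -expr2.
have N0 := Lnorm_ge0 mu 2%:E (EFin \o f).
have Noo : ('N[mu]_2%:E[EFin \o f] < +oo)%E.
  by move: f2; rewrite inE => /andP[_] /[!inE].
have Nfin : ('N[mu]_2%:E[EFin \o f] \is a fin_num)%E by rewrite ge0_fin_numE.
have := @poweR_Lnorm _ _ _ mu (EFin \o f) 2 (lt0r_neq0 (ltr0n R 2)).
rewrite -(fineK Nfin) poweR_EFin powR_mulrn ?fine_ge0// => H.
rewrite -[LHS]/(fine (_ ^+ 2)%:E) H; congr fine.
apply: eq_integral => x _ /=.
by rewrite powR_mulrn// real_normK ?num_real.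
Qed.

Lemma l2norm_ge0 f : 0 <= l2norm mu f.
Proof. exact: fine_ge0 (Lnorm_ge0 _ _ _). Qed.

Lemma l2norm_sqrt f : L2 f -> l2norm mu f = Num.sqrt (dot f f).
Proof. by move=> f2; rewrite -l2norm_sqr// sqrtr_sqr ger0_norm// l2norm_ge0. Qed.

Lemma l2dotC f g : dot f g = dot g f.
Proof. by apply: eq_Rintegral => x _; rewrite mulrC. Qed.

Lemma l2dot_ge0 f : 0 <= dot f f.
Proof. by apply: Rintegral_ge0 => x _; rewrite -expr2 sqr_ge0. Qed.

Lemma l2dot_lin a f g h : L2 f -> L2 g -> L2 h ->
  dot (fun x => a * f x + g x) h = a * dot f h + dot g h.
Proof.
move=> f2 g2 h2; rewrite /l2dot -RintegralZl//; last exact: Lfun2_integrable_mul.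
rewrite -RintegralD//.
- by apply: eq_Rintegral => x _; rewrite mulrDl mulrA.
- have := Lfun2_integrable_mul (Lfun2_scale a f2) h2.
  by apply: eq_integrable => // x _ /=; rewrite mulrA.
- exact: Lfun2_integrable_mul.
Qed.

Lemma l2dot_EFin f g : L2 f -> L2 g ->
  (\int[mu]_x (f x * g x)%:E = (dot f g)%:E)%E.
Proof.
move=> f2 g2; rewrite /l2dot /Rintegral fineK//.
exact: (integrable_fin_num measurableT (Lfun2_integrable_mul f2 g2)).
Qed.

Lemma l2dot_ae f f' g : measurable_fun setT f -> measurable_fun setT f' ->
  measurable_fun setT g -> f = f' %[ae mu] -> dot f g = dot f' g.
Proof.
move=> mf mf' mg ff'; congr fine; apply: ae_eq_integral => //.
- by apply/measurable_EFinP; exact: measurable_funM.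
- by apply/measurable_EFinP; exact: measurable_funM.
- by apply: filterS ff' => x /[apply] ->.
Qed.

Lemma l2dot_eq0 f : L2 f -> dot f f = 0 -> f = cst 0 %[ae mu].
Proof.
move=> f2 f0; have mf := Lfun2_measurable f2.
have : (\int[mu]_x `|(f x * f x)%:E| = 0)%E.
  rewrite -[RHS]/((0 : R)%:E) -f0 -l2dot_EFin//; apply: eq_integral => x _ /=.
  by rewrite ger0_norm// -expr2 sqr_ge0.
move/(ae_eq_integral_abs mu measurableT) => H.
have {H}/H : measurable_fun setT (fun x => (f x * f x)%:E).
  by apply/measurable_EFinP; exact: measurable_funM.
apply: filterS => x /[apply] -[] /eqP.
by rewrite mulf_eq0 orbb => /eqP.
Qed.

Lemma l2dot_ae0 f : measurable_fun setT f -> f = cst 0 %[ae mu] -> dot f f = 0.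
Proof.
move=> mf f0; rewrite (l2dot_ae mf (measurable_cst _) mf f0).
by rewrite /l2dot /cst/=; under eq_Rintegral do rewrite mul0r; rewrite Rintegral_cst// mul0r.
Qed.

Lemma l2dot_comb a b f g : L2 f -> L2 g ->
  dot (fun x => a * f x + b * g x) (fun x => a * f x + b * g x) =
  a ^+ 2 * dot f f + 2 * a * b * dot f g + b ^+ 2 * dot g g.
Proof.
move=> f2 g2; have b2 := Lfun2_scale b g2; have ab2 := Lfun2_lin a f2 b2.
have Z h : L2 h -> dot (fun x => b * g x) h = b * dot g h.
  by move=> h2; rewrite /l2dot -RintegralZl//; [apply: eq_Rintegral => x _; rewrite mulrA|
    exact: Lfun2_integrable_mul].
rewrite l2dot_lin// Z// (l2dotC f) (l2dotC g) !l2dot_lin// !Z//.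
by rewrite (l2dotC g f); ring.
Qed.

End square_integrable.

(** * The Markov operator of a reversible kernel *)

Section markov_operator.
Local Lemma bilin_comb (R : comPzRingType) (a b c e u v : R) :
  u = -1 * a + b -> v = -1 * c + e -> -1 * u + v = a - b - c + e.
Proof. by move=> -> ->; ring. Qed.

Local Lemma bilin_swap (R : comPzRingType) (a b c e a' b' c' e' : R) :
  a = a' -> b = b' -> c = c' -> e = e' -> a - b - c + e = a' - c' - b' + e'.
Proof. by move=> -> -> -> ->; ring. Qed.

Local Lemma bilin_ge0 (R : realFieldType) (a b c : R) :
  a + a <= b + c -> 0 <= c - a - a + b.
Proof. lra. Qed.

Context {dT : measure_display} {T : measurableType dT} {R : realType}.
Variables (mu : probability T R) (P : R.-pker T ~> T).
Implicit Types (f g h : T -> R) (a : R).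
Local Notation L2 f := (f \in Lfun mu 2%:E).
Local Notation dot := (l2dot mu).
Local Notation K := (markov_op P).
Hypothesis reversible : forall f g : T -> \bar R,
  measurable_fun setT f -> measurable_fun setT g ->
  (forall x, 0 <= f x)%E -> (forall x, 0 <= g x)%E ->
  (\int[mu]_x (g x * \int[P x]_y f y) = \int[mu]_x (f x * \int[P x]_y g y))%E.

Let muT : (mu setT \is a fin_num)%E.
Proof. by rewrite probability_setT. Qed.

Let PT x : P x setT = 1%E.
Proof. exact: prob_kernel. Qed.

Let PTfin x : (P x setT \is a fin_num)%E.
Proof. by rewrite PT. Qed.

Lemma measurable_integral_kernel (f : T -> \bar R) : measurable_fun setT f ->
  (forall x, 0 <= f x)%E -> measurable_fun setT (fun x => \int[P x]_y f y)%E.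
Proof.
move=> mf f0.
apply: (measurable_fun_integral_finite_kernel (f \o snd) P) => //=.
exact: measurableT_comp.
Qed.

Lemma measurable_markov_op f : measurable_fun setT f -> measurable_fun setT (K f).
Proof.
move=> mf; apply: (measurableT_comp (f := fine)) => //.
under eq_fun do rewrite integralE.
have mEf : measurable_fun setT (EFin \o f) by exact/measurable_EFinP.
apply: emeasurable_funB; apply: measurable_integral_kernel => //.
- exact: measurable_funepos.
- exact: measurable_funeneg.
Qed.

(** Reversibility tested against the constant 1 is invariance of [mu]. *)
Lemma integral_markov (f : T -> \bar R) : measurable_fun setT f ->
  (forall x, 0 <= f x)%E -> (\int[mu]_x \int[P x]_y f y = \int[mu]_x f x)%E.
Proof.
move=> mf f0.
have := reversible mf (measurable_cst 1%E) f0 (fun=> lee01).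
under eq_integral do rewrite mul1e.
move=> ->; apply: eq_integral => x _.
by rewrite integral_cst// PT !mule1.
Qed.

(** Jensen's inequality, as nonnegativity of the variance of f under [P x]. Where f is not square
    integrable for [P x], the right-hand side is +oo. *)
Lemma markov_op_sqr_le f x : measurable_fun setT f ->
  ((K f x ^+ 2)%:E <= \int[P x]_y (f y ^+ 2)%:E)%E.
Proof.
move=> mf; have [f2|] := boolP (f \in Lfun (P x) 2%:E); last first.
  move=> f2; rewrite (_ : integral _ _ _ = +oo%E) ?leey//.
  apply/eqP; apply: contraNT f2; rewrite -ltey => f2.
  exact/Lfun2P.
have one2 := Lfun2_cst 1 (PTfin x).
have := l2dot_ge0 (P x) (fun y => 1 * f y + (- K f x) * cst 1 y).
rewrite l2dot_comb// expr1n mul1r mulr1 sqrrN.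
have -> : l2dot (P x) f (cst 1) = K f x.
  by apply: eq_Rintegral => y _; rewrite mulr1.
have -> : l2dot (P x) (cst 1) (cst 1) = 1.
  by rewrite /l2dot/= Rintegral_cst// PT/= !mulr1.
move=> H; under eq_integral do rewrite expr2.
by rewrite l2dot_EFin// lee_fin; nra.
Qed.

Lemma Lfun2_markov f : L2 f -> L2 (K f).
Proof.
move=> /Lfun2P[mf f2]; have mK := measurable_markov_op mf.
have mf2 : measurable_fun setT (fun x => (f x ^+ 2)%:E).
  by apply/measurable_EFinP; exact: measurable_funX.
have f20 x : (0 <= (f x ^+ 2)%:E)%E by rewrite lee_fin sqr_ge0.
apply/Lfun2P; split=> //; apply: le_lt_trans f2.
rewrite -[leRHS]integral_markov//; apply: ge0_le_integral => //.
- by move=> x _; rewrite lee_fin sqr_ge0.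
- by apply/measurable_EFinP; exact: measurable_funX.
- exact: measurable_integral_kernel.
- by move=> x _; exact: markov_op_sqr_le.
Qed.

Lemma markov_op_contract f : L2 f -> dot (K f) (K f) <= dot f f.
Proof.
move=> f2; have [mf _] := (Lfun2P mu f).1 f2; have K2 := Lfun2_markov f2.
have mK := measurable_markov_op mf.
have mf2 : measurable_fun setT (fun x => (f x ^+ 2)%:E).
  by apply/measurable_EFinP; exact: measurable_funX.
have f20 x : (0 <= (f x ^+ 2)%:E)%E by rewrite lee_fin sqr_ge0.
rewrite -lee_fin -!l2dot_EFin//; under eq_integral do rewrite -expr2.
under [leRHS]eq_integral do rewrite -expr2.
rewrite -[leRHS]integral_markov//; apply: ge0_le_integral => //.
- by move=> x _; rewrite lee_fin sqr_ge0.
- by apply/measurable_EFinP; exact: measurable_funX.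
- exact: measurable_integral_kernel.
- by move=> x _; exact: markov_op_sqr_le.
Qed.

(** By invariance, the integral of f^2 under [P x] has a finite mean in x, hence is finite almost
    everywhere. Outside a null set the values of [markov_op] are therefore genuine integrals. *)
Lemma ae_Lfun2_kernel f : L2 f -> {ae mu, forall x, f \in Lfun (P x) 2%:E}.
Proof.
move=> /Lfun2P[mf f2].
have mf2 : measurable_fun setT (fun x => (f x ^+ 2)%:E).
  by apply/measurable_EFinP; exact: measurable_funX.
have f20 x : (0 <= (f x ^+ 2)%:E)%E by rewrite lee_fin sqr_ge0.
pose B x := (\int[P x]_y (f y ^+ 2)%:E)%E.
have B0 x : (0 <= B x)%E by exact: integral_ge0.
have mB : measurable_fun setT B by exact: measurable_integral_kernel.
have iB : mu.-integrable setT B.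
  apply/integrableP; split => //; under eq_integral do rewrite gee0_abs//.
  by rewrite integral_markov.
have := integrable_ae measurableT iB; apply: filterS => x /(_ I).
by rewrite ge0_fin_numE// => Bx; apply/Lfun2P.
Qed.

Lemma markov_op_lin a f g : L2 f -> L2 g ->
  K (fun x => a * f x + g x) = (fun x => a * K f x + K g x) %[ae mu].
Proof.
move=> f2 g2; apply: filterS2 (ae_Lfun2_kernel f2) (ae_Lfun2_kernel g2) => x fx gx _.
have If := Lfun2_integrable (PTfin x) fx.
rewrite /markov_op RintegralD// ?RintegralZl//.
- exact: (Lfun2_integrable (PTfin x) (Lfun2_scale a fx)).
- exact: (Lfun2_integrable (PTfin x) gx).
Qed.

Lemma ge0_l2dot_markov f g : L2 f -> L2 g -> (forall x, 0 <= f x) -> (forall x, 0 <= g x) ->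
  (\int[mu]_x ((f x)%:E * \int[P x]_y (g y)%:E) = (dot f (K g))%:E)%E.
Proof.
move=> f2 g2 f0 g0; have K2 := Lfun2_markov g2.
have [mf _] := (Lfun2P mu f).1 f2; have [mg _] := (Lfun2P mu g).1 g2.
have mK := measurable_markov_op mg.
rewrite -l2dot_EFin//; apply: ae_eq_integral => //.
- apply: emeasurable_funM; first exact/measurable_EFinP.
  by apply: measurable_integral_kernel => //; exact/measurable_EFinP.
- by apply/measurable_EFinP; exact: measurable_funM.
apply: filterS (ae_Lfun2_kernel g2) => x gx _.
rewrite EFinM /markov_op /Rintegral fineK//.
exact: (integrable_fin_num measurableT (Lfun2_integrable (PTfin x) gx)).
Qed.

Let pos f x : R := Num.max (f x) 0.

Let pos_ge0 f x : 0 <= pos f x. Proof. by rewrite le_max lexx orbT. Qed.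

Let pos_Lfun2 f : L2 f -> L2 (pos f).
Proof.
move=> f2; apply: (Lfun2_dom _ f2).
  exact: measurable_maxr (Lfun2_measurable f2) (measurable_cst _).
move=> x; rewrite (ger0_norm (pos_ge0 f x)) /pos ge_max normr_ge0 andbT; exact: ler_norm.
Qed.

Let neg_Lfun2 f : L2 f -> L2 (pos (fun x => - f x)).
Proof.
move=> f2; apply: pos_Lfun2; have := Lfun2_scale (-1) f2.
by rewrite (_ : (fun x => -1 * f x) = fun x => - f x)//; apply/funext => x; rewrite mulN1r.
Qed.

Let posneg f : f = fun x => -1 * pos (fun x => - f x) x + pos f x.
Proof.
by apply/funext => x; rewrite /pos; case: (leP (f x)); case: (leP (- f x)); lra.
Qed.

Let ge0_sym f g : L2 f -> L2 g -> (forall x, 0 <= f x) -> (forall x, 0 <= g x) ->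
  dot f (K g) = dot g (K f).
Proof.
move=> f2 g2 f0 g0; apply: EFin_inj; rewrite -(ge0_l2dot_markov f2 g2 f0 g0).
rewrite -(ge0_l2dot_markov g2 f2 g0 f0); apply: reversible => //.
- exact/measurable_EFinP/(Lfun2_measurable g2).
- exact/measurable_EFinP/(Lfun2_measurable f2).
Qed.

Lemma l2dot_markov_linr a f g h : L2 f -> L2 g -> L2 h ->
  dot h (K (fun x => a * f x + g x)) = a * dot h (K f) + dot h (K g).
Proof.
move=> f2 g2 h2; have Kf := Lfun2_markov f2; have Kg := Lfun2_markov g2.
have fg := Lfun2_lin a f2 g2.
rewrite l2dotC (l2dot_ae _ _ _ (markov_op_lin a f2 g2)).
- by rewrite l2dot_lin// !(l2dotC _ h).
- exact: Lfun2_measurable (Lfun2_markov fg).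
- exact: Lfun2_measurable (Lfun2_lin a Kf Kg).
- exact: Lfun2_measurable h2.
Qed.

Lemma l2dot_markov_linl a f g h : L2 f -> L2 g -> L2 h ->
  dot (fun x => a * f x + g x) (K h) = a * dot f (K h) + dot g (K h).
Proof. by move=> f2 g2 h2; rewrite l2dot_lin//; exact: Lfun2_markov. Qed.

Let bilin f f' g g' : L2 f -> L2 f' -> L2 g -> L2 g' ->
  dot (fun x => -1 * f x + f' x) (K (fun x => -1 * g x + g' x)) =
  dot f (K g) - dot f (K g') - dot f' (K g) + dot f' (K g').
Proof.
move=> f2 f'2 g2 g'2.
rewrite (l2dot_markov_linl (-1) f2 f'2 (Lfun2_lin (-1) g2 g'2)).
exact (bilin_comb (l2dot_markov_linr (-1) g2 g'2 f2)
  (l2dot_markov_linr (-1) g2 g'2 f'2)).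
Qed.

(** Both arguments are expanded in positive and negative parts, which reduces the claim to
    nonnegative functions. *)
Lemma l2dot_markovC f g : L2 f -> L2 g -> dot f (K g) = dot g (K f).
Proof.
move=> f2 g2; have fp := pos_Lfun2 f2; have fn := neg_Lfun2 f2.
have gp := pos_Lfun2 g2; have gn := neg_Lfun2 g2.
rewrite (posneg f) (posneg g) (bilin fn fp gn gp) (bilin gn gp fn fp).
have P0 := pos_ge0 f; have N0 := pos_ge0 (fun x => - f x).
have P'0 := pos_ge0 g; have N'0 := pos_ge0 (fun x => - g x).
exact (bilin_swap (ge0_sym fn gn N0 N'0) (ge0_sym fn gp N0 P'0)
  (ge0_sym fp gn P0 N'0) (ge0_sym fp gp P0 P'0)).
Qed.

Lemma integral_markov_op f : L2 f -> \int[mu]_x K f x = \int[mu]_x f x.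
Proof.
move=> f2; have one2 := Lfun2_cst 1 muT.
have -> : \int[mu]_x K f x = dot (cst 1) (K f).
  by apply: eq_Rintegral => x _; rewrite mul1r.
rewrite l2dot_markovC//; apply: eq_Rintegral => x _.
by rewrite /markov_op Rintegral_cst// PT/= !mulr1.
Qed.

(** Applied to the positive part f+ and the negative part f- of f, the premise reads 2 <f+, P f-> <=
    <f+, P f+> + <f-, P f->, which is 0 <= <f, P f>. *)
Lemma l2dot_markov_ge0 :
  (forall f g : T -> \bar R, measurable_fun setT f -> measurable_fun setT g ->
    (forall x, 0 <= f x)%E -> (forall x, 0 <= g x)%E ->
    (\int[mu]_x (f x * \int[P x]_y g y) + \int[mu]_x (f x * \int[P x]_y g y) <=
     \int[mu]_x (f x * \int[P x]_y f y) + \int[mu]_x (g x * \int[P x]_y g y))%E) ->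
  forall f, L2 f -> 0 <= dot f (K f).
Proof.
move=> positive f f2; have fp := pos_Lfun2 f2; have fn := neg_Lfun2 f2.
have := positive (EFin \o pos f) (EFin \o pos (fun x => - f x)).
move=> /(_ _ _ (fun=> pos_ge0 _ _) (fun=> pos_ge0 _ _)) H.
have {H}/H H : measurable_fun setT (EFin \o pos f).
  exact/measurable_EFinP/(Lfun2_measurable fp).
have {H}/H : measurable_fun setT (EFin \o pos (fun x => - f x)).
  exact/measurable_EFinP/(Lfun2_measurable fn).
have P0 := pos_ge0 f; have N0 := pos_ge0 (fun x => - f x).
rewrite (ge0_l2dot_markov fp fn P0 N0) (ge0_l2dot_markov fp fp P0 P0).
rewrite (ge0_l2dot_markov fn fn N0 N0) -!EFinD lee_fin => H.
rewrite (posneg f) (bilin fn fp fn fp) (ge0_sym fn fp N0 P0).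
exact (bilin_ge0 H).
Qed.

End markov_operator.

(** * Cheeger's inequality *)

Section median.
Context {dT : measure_display} {T : measurableType dT} {R : realType}.
Variable mu : probability T R.

(** The median m is the infimum of the points where the distribution function reaches 1/2. Right
    continuity gives the first bound; for the second, the events f <= m - 1/(n+1) have mass below
    1/2 and increase to f < m. *)
Lemma median_exists (f : T -> R) : measurable_fun setT f -> exists m : R,
  (mu [set x | (m < f x)%R] <= (2^-1)%:E)%E /\
  (mu [set x | (f x < m)%R] <= (2^-1)%:E)%E.
Proof.
move=> mf; pose X : {RV mu >-> R} := mfun_Sub (mem_set mf : f \in mfun).
have cdfE r : cdf X r = mu [set x | f x <= r].
  by rewrite /cdf /distribution /pushforward; congr (mu _); apply/seteqP; split => x /=;
    rewrite in_itv.
have mle r : measurable [set x | f x <= r].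
  by rewrite -[X in measurable X]setTI; exact: (measurable_fun_ler mf (measurable_cst r)).
have half : ((2^-1)%:E < 1 :> \bar R)%E by rewrite lte_fin invf_lt1// ltr1n.
have half0 : (0 < (2^-1)%:E :> \bar R)%E by rewrite lte_fin invr_gt0.
pose S : set R := [set r | ((2^-1)%:E <= cdf X r)%E].
have nS : S !=set0.
  apply: contrapT => /set0P/negP/negPn/eqP S0.
  have le r : (cdf X r <= (2^-1)%:E)%E.
    by rewrite leNgt; apply/negP => /ltW Sr; have : S r := Sr; rewrite S0.
  have : (1 <= (2^-1)%:E :> \bar R)%E.
    by apply: (cvge_le _ (cvg_cdfy1 X)); exact: nearW.
  by rewrite leNgt half.
have [r0 r0S] : exists r, (cdf X r < (2^-1)%:E)%E.
  apply: contrapT => /forallNP no.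
  have ge r : ((2^-1)%:E <= cdf X r)%E by rewrite leNgt; apply/negP/no.
  have : ((2^-1)%:E <= 0 :> \bar R)%E.
    by apply: (cvge_ge _ (cvg_cdfNy0 X)); exact: nearW.
  by rewrite leNgt half0.
have iS : has_inf S.
  split=> //; exists r0 => r Sr; rewrite leNgt; apply/negP => rr0.
  by have := le_trans Sr (cdf_nondecreasing X (ltW rr0)); rewrite leNgt r0S.
pose m := inf S; exists m.
have gtm (r : R) : m < r -> ((2^-1)%:E <= cdf X r)%E.
  move=> mr; have [s Ss sr] := inf_lt nS mr.
  by apply: le_trans Ss _; apply: cdf_nondecreasing; exact: ltW.
have ltm (r : R) : r < m -> (cdf X r < (2^-1)%:E)%E.
  move=> rm; rewrite ltNge; apply/negP => Sr.
  by have := ge_inf iS.2 Sr; rewrite leNgt rm.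
split.
  have Sm : ((2^-1)%:E <= cdf X m)%E.
    apply: (cvge_ge _ (@cdf_right_continuous _ _ _ _ X m)).
    by near=> r; apply: gtm; near: r; exact: nbhs_right_gt.
  have -> : [set x | m < f x] = ~` [set x | f x <= m].
    by apply/seteqP; split => x /=; rewrite real_ltNge ?num_real// => /negP.
  rewrite probability_setC; last exact: mle.
  rewrite cdfE in Sm; rewrite leeBlDr ?fin_num_measure//.
  have -> : (1 = (2^-1)%:E + (2^-1)%:E :> \bar R)%E by rewrite -EFinD; congr EFin; lra.
  exact: leeD.
pose F n := [set x | f x <= m - n.+1%:R^-1].
have FE : [set x | f x < m] = \bigcup_n F n.
  apply/seteqP; split => x /=.
    move=> fm; have /ltr_add_invr[n] : f x < m by [].
    by move=> h; exists n => //=; rewrite /F/= lerBrDr ltW.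
  by move=> [n _ /= /le_lt_trans]; apply; rewrite gtrBl invr_gt0.
rewrite FE; apply: (cvge_le _ (nondecreasing_cvg_mu _ _ _)).
- by apply: nearW => n /=; rewrite -cdfE ltW// ltm// gtrBl invr_gt0.
- by move=> n; exact: mle.
- by apply: bigcup_measurable => n _; exact: mle.
- move=> i j ij; apply/subsetPset => x /= /le_trans; apply.
  by rewrite lerD2l lerN2 lef_pV2 ?posrE// ler_nat.
Unshelve. all: by end_near. Qed.

End median.

Lemma integral_bool {dX : measure_display} {X : measurableType dX} {R : realType}
    (m : {measure set X -> \bar R}) (b : X -> bool) : measurable_fun setT b ->
  (\int[m]_x (b x)%:R%:E = m [set x | b x])%E.
Proof.
move=> mb; have mA : measurable [set x | b x].
  by rewrite -[X in measurable X]setTI; exact: (mb measurableT [set true]).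
transitivity (m ([set x | b x] `&` setT)); last by rewrite setIT.
rewrite -integral_indic//; apply: eq_integral => x _.
by rewrite indicE; congr (nat_of_bool _)%:R%:E; apply/idP/idP => [?|/set_mem//]; exact/mem_set.
Qed.

Section as_probability.
Context {dT : measure_display} {T : measurableType dT} {R : realType}.
Variables (m : {measure set T -> \bar R}) (m1 : m setT = 1%E).

(* The proof is an argument of the definition so that the instance below can
   depend on it. *)
Definition as_probability of m setT = 1%E : set T -> \bar R := m.

HB.instance Definition _ := Measure.copy (as_probability m1) m.

HB.instance Definition _ := Measure_isProbability.Build _ _ _ (as_probability m1) m1.

End as_probability.

(** * Level sets and the coarea formula *)

Section kernel_layers.
Context {R : realType}.

Definition layer (r t : R) : bool := (0 <= t) && (t < r).

(** Tells whether the level t separates a from b; the set of such levels has length |a - b| when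
    both are nonnegative. *)
Definition layer_diff (a b t : R) : R := (layer a t (+) layer b t)%:R.

Lemma layer_diff_ge0 a b t : 0 <= layer_diff a b t. Proof. exact: ler0n. Qed.

Lemma integral_layer (a : R) : 0 <= a ->
  (\int[@lebesgue_measure R]_t (layer a t)%:R%:E = a%:E)%E.
Proof.
move=> a0; pose I := `[0%R, a[%classic : set R.
transitivity (\int[@lebesgue_measure R]_t (\1_I t)%:E)%E.
  by apply: eq_integral => t _; rewrite indicE /I mem_setE in_itv.
transitivity (@lebesgue_measure R (I `&` setT)).
  by apply: integral_indic => //; exact: measurable_itv.
rewrite setIT /I lebesgue_measure_itv/= lte_fin; case: ltP => [_|a0'].
  by rewrite oppr0 adde0.
by congr EFin; apply/eqP; rewrite eq_le a0 a0'.
Qed.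

Lemma integral_layer_diff (a b : R) : 0 <= a -> 0 <= b ->
  (\int[@lebesgue_measure R]_t (layer_diff a b t)%:E = `|a - b|%:E)%E.
Proof.
wlog ab : a b / a <= b => [H a0 b0|a0 b0].
  have [/H->//|/ltW/H E] := leP a b.
  rewrite distrC -E//; apply: eq_integral => t _.
  by rewrite /layer_diff addbC.
pose I := `[a, b[%classic : set R.
transitivity (\int[@lebesgue_measure R]_t (\1_I t)%:E)%E.
  apply: eq_integral => t _; rewrite indicE /I mem_setE in_itv/= /layer_diff /layer.
  congr (nat_of_bool _)%:R%:E; have [t0|t0] := leP 0 t => /=.
    have [ta|ta] := ltP t a => /=; first by rewrite (lt_le_trans ta ab).
    by [].
  by apply/esym/negbTE; rewrite negb_and -ltNge (lt_le_trans t0 a0).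
transitivity (@lebesgue_measure R (I `&` setT)).
  by apply: integral_indic => //; exact: measurable_itv.
rewrite setIT /I lebesgue_measure_itv/= lte_fin; case: ltP => [ab'|ba].
  by rewrite distrC ger0_norm ?subr_ge0.
by rewrite (_ : a = b) ?subrr ?normr0//; apply/eqP; rewrite eq_le ab ba.
Qed.

Context {dT : measure_display} {T : measurableType dT}.

Lemma fubini_probability (m : {measure set T -> \bar R}) (F : T * measurableTypeR R -> \bar R) :
  forall m1 : m setT = 1%E, measurable_fun setT F -> (forall z, 0 <= F z)%E ->
  (\int[m]_y \int[@lebesgue_measure R]_t F (y, t) =
   \int[@lebesgue_measure R]_t \int[m]_y F (y, t))%E.
Proof.
move=> m1 mF F0.
exact: (@fubini_tonelli _ _ _ _ R (as_probability m1 : probability T R) (@lebesgue_measure R) F mF F0).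
Qed.

Context {dU : measure_display} {U : measurableType dU}.
Variable P : R.-pker T ~> T.

(** The kernel P with an additional parameter, the level t in the applications; it gives joint
    measurability in (x, t) of integrals under [P x]. *)
Definition kernel_fst (xu : T * U) : {measure set T -> \bar R} := P xu.1.

Let measurable_kernel_fst V : measurable V -> measurable_fun setT (kernel_fst ^~ V).
Proof.
by move=> mV; exact: (measurableT_comp (measurable_kernel P V mV) measurable_fst).
Qed.

HB.instance Definition _ := isKernel.Build _ _ _ _ R kernel_fst measurable_kernel_fst.

Let kernel_fst_setT xu : kernel_fst xu setT = 1%E.
Proof. exact: prob_kernel. Qed.

HB.instance Definition _ := Kernel_isProbability.Build _ _ _ _ R kernel_fst kernel_fst_setT.

End kernel_layers.

(** Young's inequality for |a - b| * (a + b). The weight k / 4 is chosen so that, once integrated,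
    the last term costs k / 2 times |u|^2, half of what the coarea bound provides. *)
Local Lemma diff_sqr_le (R : realFieldType) (k a b : R) : 0 < k -> 0 <= a -> 0 <= b ->
  `|a ^+ 2 - b ^+ 2| <= 2 / k * (a - b) ^+ 2 + k / 4 * (a ^+ 2 + b ^+ 2).
Proof.
move=> k0 a0 b0; rewrite subr_sqr normrM (ger0_norm (addr_ge0 a0 b0)).
have cE : `|a - b| ^+ 2 = (a - b) ^+ 2 by rewrite real_normK ?num_real.
set c := `|a - b| in cE *; rewrite -subr_ge0.
rewrite (_ : _ - _ = (4 * c - k * (a + b)) ^+ 2 / (8 * k) + k / 8 * (a - b) ^+ 2).
  apply: addr_ge0; apply: mulr_ge0; rewrite ?sqr_ge0 ?invr_ge0//.
    by rewrite mulr_ge0// ltW.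
  by rewrite divr_ge0// ltW.
by rewrite -[in LHS]cE; field; rewrite gt_eqF.
Qed.

Local Lemma cheeger_algebra (R : realFieldType) (k d v : R) : 0 < k ->
  k * d <= 2 / k * v + k / 4 * (d + d) -> k ^+ 2 / 4 * d <= v.
Proof.
move=> k0 le; have -> : v = k / 2 * (2 / k * v) by field; rewrite gt_eqF.
have -> : k ^+ 2 / 4 * d = k / 2 * (k * d - k / 4 * (d + d)) by field.
by apply: ler_wpM2l; [rewrite divr_ge0// ltW|rewrite lerBlDr].
Qed.

(** If a and b are on opposite sides of m, the left side is a sum of two squares of nonnegative
    numbers and the right side is the square of their sum. *)
Local Lemma sqr_posneg_le (R : realFieldType) (m a b : R) :
  (Num.max (a - m) 0 - Num.max (b - m) 0) ^+ 2 +
  (Num.max (m - a) 0 - Num.max (m - b) 0) ^+ 2 <= (a - b) ^+ 2.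
Proof.
by case: (leP (a - m)); case: (leP (m - a)); case: (leP (b - m)); case: (leP (m - b)); nra.
Qed.

Section cheeger.
Context {dT : measure_display} {T : measurableType dT} {R : realType}.
Variables (mu : probability T R) (P : R.-pker T ~> T).
Implicit Types (f g h u : T -> R) (a : R).
Local Notation L2 f := (f \in Lfun mu 2%:E).
Local Notation dot := (l2dot mu).
Local Notation K := (markov_op P).
Local Notation leb := (@lebesgue_measure R).
Local Open Scope ereal_scope.

Let muT : mu setT \is a fin_num.
Proof. by rewrite probability_setT. Qed.

Let PT x : P x setT = 1.
Proof. exact: prob_kernel. Qed.

Let measurable_integral2 (F : T * T -> \bar R) : measurable_fun setT F ->
  (forall z, 0 <= F z) -> measurable_fun setT (fun x => \int[P x]_y F (x, y)).
Proof. by move=> mF F0; exact: (measurable_fun_integral_finite_kernel F P). Qed.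

Let measurable_layer h : measurable_fun setT h ->
  measurable_fun setT (fun xt : T * measurableTypeR R => layer (h xt.1) xt.2).
Proof.
move=> mh; apply: measurable_and; first exact: measurable_fun_ler.
by apply: measurable_fun_ltr => //; exact: measurableT_comp.
Qed.

Let measurable_bool dX (X : measurableType dX) (b : X -> bool) : measurable_fun setT b ->
  measurable_fun setT (fun x => (b x)%:R : R).
Proof. by move=> mb; exact: (measurableT_comp (f := fun b : bool => b%:R : R)). Qed.

Let measurable_layer_diff h : measurable_fun setT h ->
  measurable_fun setT (fun w : (T * measurableTypeR R) * T =>
    (layer_diff (h w.1.1) (h w.2) w.1.2)%:E).
Proof.
move=> mh; apply/measurable_EFinP; apply: measurable_bool.
have m1 : measurable_fun setT (fun w : (T * measurableTypeR R) * T => layer (h w.1.1) w.1.2).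
  exact: (measurableT_comp (measurable_layer mh) measurable_fst).
have m2 : measurable_fun setT (fun w : (T * measurableTypeR R) * T => layer (h w.2) w.1.2).
  apply: (measurableT_comp (measurable_layer mh)
    (g := fun w : (T * measurableTypeR R) * T => (w.2, w.1.2))).
  apply: measurable_fun_pair => //; exact: (measurableT_comp measurable_snd measurable_fst).
rewrite (_ : (fun w => _) = fun w : (T * measurableTypeR R) * T =>
  (layer (h w.1.1) w.1.2 && ~~ layer (h w.2) w.1.2) ||
  (~~ layer (h w.1.1) w.1.2 && layer (h w.2) w.1.2)); last first.
  by apply/funext => w; case: layer; case: layer.
by apply: measurable_or; apply: measurable_and => //; exact: measurable_neg.
Qed.

Lemma kernel_coarea h : measurable_fun setT h -> (forall x, 0 <= h x)%R ->
  \int[mu]_x \int[P x]_y `|h x - h y|%:E =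
  \int[leb]_t \int[mu]_x \int[P x]_y (layer_diff (h x) (h y) t)%:E.
Proof.
move=> mh h0; pose W (w : (T * measurableTypeR R) * T) := (layer_diff (h w.1.1) (h w.2) w.1.2)%:E.
have mW : measurable_fun setT W by exact: measurable_layer_diff.
have W0 w : 0 <= W w by rewrite lee_fin layer_diff_ge0.
transitivity (\int[mu]_x \int[leb]_t \int[P x]_y W (x, t, y)).
  apply: eq_integral => x _.
  pose Wx (yt : T * measurableTypeR R) := W ((x, yt.2), yt.1).
  have mWx : measurable_fun setT Wx.
    apply: (measurableT_comp mW); apply: measurable_fun_pair => //.
    exact: measurable_fun_pair.
  rewrite -(fubini_probability (PT x) mWx (fun _ => W0 _)).
  by apply: eq_integral => y _; rewrite /Wx /W/= integral_layer_diff.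
have mF := measurable_fun_integral_finite_kernel W
  (@kernel_fst R _ T _ (measurableTypeR R) P) W0 mW.
apply: (fubini_probability (probability_setT mu) mF) => xt.
by apply: integral_ge0.
Qed.

Variable k : R.
Hypotheses (k_gt0 : (0 < k)%R) (flow_ge : forall A, measurable A ->
  k%:E * (mu A * mu (~` A)) <= \int[mu]_(x in A) P x (~` A)).

(** The flows in both directions are kept because [layer_diff] counts crossings of a level both
    ways. Together they exceed 2 k mu(A) (1 - mu(A)), and 1 - mu(A) >= 1/2. *)
Let flow_half A : measurable A -> mu A <= (2^-1)%:E ->
  k%:E * mu A <= \int[mu]_(x in A) P x (~` A) + \int[mu]_(x in ~` A) P x A.
Proof.
move=> mA A2; have mAc := measurableC mA.
have := leeD (flow_ge mA) (flow_ge mAc); rewrite setCK [mu (~` A) * _]muleC.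
apply: le_trans; rewrite -ge0_muleDr ?mule_ge0//; apply: lee_wpmul2l; first by rewrite lee_fin ltW.
rewrite probability_setC//.
have Afin : mu A \is a fin_num by exact: fin_num_measure.
rewrite -(fineK Afin) -!EFinB -!EFinM -EFinD lee_fin.
have : (fine (mu A) <= 2^-1)%R by rewrite -lee_fin fineK.
have := fine_ge0 (measure_ge0 mu A); nra.
Qed.

Let layer_flow h t : measurable_fun setT h ->
  mu [set x | layer (h x) t] <= (2^-1)%:E ->
  k%:E * \int[mu]_x (layer (h x) t)%:R%:E <=
  \int[mu]_x \int[P x]_y (layer_diff (h x) (h y) t)%:E.
Proof.
move=> mh; set A := [set x | _] => A2.
have mb : measurable_fun setT (fun x => layer (h x) t).
  exact: (measurableT_comp (measurable_layer mh) (measurable_pair2 t)).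
have mA : measurable A.
  rewrite -[A]setTI; exact: (mb measurableT [set true]).
have mAc := measurableC mA.
rewrite integral_bool//.
apply: le_trans (flow_half mA A2) _.
have mF : measurable_fun setT (fun x => \int[P x]_y (layer_diff (h x) (h y) t)%:E).
  apply: (measurable_integral2 (F := fun z => (layer_diff (h z.1) (h z.2) t)%:E)) => [|z].
    have mp : measurable_fun setT (fun z : T * T => (z.1, (t : measurableTypeR R), z.2)).
      by apply: measurable_fun_pair => //; apply: measurable_fun_pair.
    exact: (measurableT_comp (measurable_layer_diff mh) mp).
  by rewrite lee_fin layer_diff_ge0.
rewrite -[X in _ <= integral mu X _](setUv A) ge0_integral_setU//; last 3 first.
- by rewrite setUv.
- by move=> x _; apply: integral_ge0 => y _; rewrite lee_fin layer_diff_ge0.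
- by apply/disj_setPCl.
have mbN : measurable_fun setT (fun x => ~~ layer (h x) t) by exact: measurable_neg.
rewrite le_eqVlt; apply/orP; left; apply/eqP; congr (_ + _); apply: eq_integral => x /set_mem Ax.
  have -> : ~` A = [set y | ~~ layer (h y) t] by apply/seteqP; split => y /= /negP.
  rewrite -integral_bool//; apply: eq_integral => y _.
  by rewrite /layer_diff; move: Ax; rewrite /A/= => ->.
rewrite -integral_bool//; apply: eq_integral => y _.
by rewrite /layer_diff; move: Ax; rewrite /A/= => /negP/negbTE ->.
Qed.

Let integral_diff_ge h : measurable_fun setT h -> (forall x, 0 <= h x)%R ->
  mu [set x | (0 < h x)%R] <= (2^-1)%:E ->
  k%:E * \int[mu]_x (h x)%:E <= \int[mu]_x \int[P x]_y `|h x - h y|%:E.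
Proof.
move=> mh h0 h2; rewrite kernel_coarea//.
pose B (xt : T * measurableTypeR R) := ((layer (h xt.1) xt.2)%:R)%:E : \bar R.
have mB : measurable_fun setT B.
  by apply/measurable_EFinP; apply: measurable_bool; exact: measurable_layer.
have B0 xt : 0 <= B xt by rewrite lee_fin ler0n.
have -> : \int[mu]_x (h x)%:E = \int[leb]_t \int[mu]_x B (x, t).
  rewrite -(fubini_probability (probability_setT mu) mB B0).
  by apply: eq_integral => x _; rewrite /B/= integral_layer.
have IB0 t : 0 <= \int[mu]_x B (x, t) by exact: integral_ge0.
have mIB : measurable_fun setT (fun t => \int[mu]_x B (x, t)).
  exact: (@measurable_fun_fubini_tonelli_G _ _ _ _ R mu B mB B0).
rewrite -ge0_integralZl//; last by rewrite lee_fin ltW.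
apply: ge0_le_integral => //.
- by move=> t _; rewrite mule_ge0// lee_fin ltW.
- exact: measurable_funeM.
- have W0 (w : (T * measurableTypeR R) * T) : 0 <= (layer_diff (h w.1.1) (h w.2) w.1.2)%:E.
    by rewrite lee_fin layer_diff_ge0.
  have mF := measurable_fun_integral_finite_kernel _
    (@kernel_fst R _ T _ (measurableTypeR R) P) W0 (measurable_layer_diff mh).
  apply: (@measurable_fun_fubini_tonelli_G _ _ _ _ R mu _ mF) => xt.
  by apply: integral_ge0 => y _; exact: (W0 (xt, y)).
(* Every set [layer (h x) t] lies in {h > 0}, whose mass is at most 1/2. *)
move=> t _; apply: layer_flow => //; apply: le_trans h2.
have mp : measurable_fun setT (fun x => (0 < h x)%R) by exact: measurable_fun_ltr.
have mb : measurable_fun setT (fun x => layer (h x) t).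
  exact: (measurableT_comp (measurable_layer mh) (measurable_pair2 t)).
apply: le_measure; rewrite ?inE.
- rewrite -[X in measurable X]setTI; exact: (mb measurableT [set true]).
- rewrite -[X in measurable X]setTI; exact: (mp measurableT [set true]).
- by move=> x /= /andP[]; exact: le_lt_trans.
Qed.

Let var f := \int[mu]_x \int[P x]_y ((f x - f y) ^+ 2)%:E.

Let measurable_diff f : measurable_fun setT f ->
  measurable_fun setT (fun z : T * T => f z.1 - f z.2)%R.
Proof. by move=> mf; apply: measurable_funB; exact: measurableT_comp. Qed.

Let measurable_sqr_diff f : measurable_fun setT f ->
  measurable_fun setT (fun x => \int[P x]_y ((f x - f y) ^+ 2)%:E).
Proof.
move=> mf; apply: (measurable_integral2 (F := fun z => ((f z.1 - f z.2) ^+ 2)%:E)) => [|z].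
  by apply/measurable_EFinP; apply: measurable_funX; exact: measurable_diff.
by rewrite lee_fin sqr_ge0.
Qed.

Hypothesis reversible : forall f g : T -> \bar R,
  measurable_fun setT f -> measurable_fun setT g ->
  (forall x, 0 <= f x) -> (forall x, 0 <= g x) ->
  \int[mu]_x (g x * \int[P x]_y f y) = \int[mu]_x (f x * \int[P x]_y g y).

(* The coarea bound for [u ^+ 2] combined with
   [|a ^+ 2 - b ^+ 2| <= 2 / k * (a - b) ^+ 2 + k / 4 * (a ^+ 2 + b ^+ 2)]. *)
Let cheeger_half u : L2 u -> (forall x, 0 <= u x)%R ->
  mu [set x | (0 < u x)%R] <= (2^-1)%:E -> (k ^+ 2 / 4 * dot u u)%:E <= var u.
Proof.
move=> u2 u0 hu; have [mu_ _] := (Lfun2P mu u).1 u2.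
pose h x : R := (u x ^+ 2)%R.
have mh : measurable_fun setT h by exact: measurable_funX.
have mEh : measurable_fun setT (EFin \o h) by exact/measurable_EFinP.
have Eh0 x : 0 <= (h x)%:E by rewrite lee_fin sqr_ge0.
have h_half : mu [set x | (0 < h x)%R] <= (2^-1)%:E.
  apply: le_trans hu; rewrite le_eqVlt; apply/orP; left; apply/eqP; congr (mu _).
  apply/seteqP; split => x /=; rewrite /h exprn_even_gt0//= ?lt_neqAle ?u0 ?andbT ?(eq_sym 0%R)//.
have := integral_diff_ge mh (fun x => sqr_ge0 (u x)) h_half.
have IE : \int[mu]_x (h x)%:E = (dot u u)%:E.
  by rewrite -l2dot_EFin//; apply: eq_integral => x _; rewrite /h expr2.
rewrite IE => le1.
have var0 : 0 <= var u.
  by apply: integral_ge0 => x _; apply: integral_ge0 => y _; rewrite lee_fin sqr_ge0.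
have c0 : (0 <= 2 / k)%R by rewrite divr_ge0// ltW.
have c1 : (0 <= k / 4)%R by rewrite divr_ge0// ltW.
have le2 : \int[mu]_x \int[P x]_y `|h x - h y|%:E <=
    (2 / k)%:E * var u + (k / 4)%:E * ((dot u u)%:E + (dot u u)%:E).
  pose S x := \int[P x]_y ((u x - u y) ^+ 2)%:E.
  have S0 x : 0 <= S x by apply: integral_ge0 => y _; rewrite lee_fin sqr_ge0.
  have mS : measurable_fun setT S by exact: measurable_sqr_diff.
  pose B x := \int[P x]_y (h y)%:E.
  have B0 x : 0 <= B x by exact: integral_ge0.
  have mB : measurable_fun setT B by exact: measurable_integral_kernel.
  have IB : \int[mu]_x B x = (dot u u)%:E by rewrite -IE; exact: integral_markov.
  have -> : (2 / k)%:E * var u + (k / 4)%:E * ((dot u u)%:E + (dot u u)%:E) =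
      \int[mu]_x ((2 / k)%:E * S x + (k / 4)%:E * ((h x)%:E + B x)).
    rewrite ge0_integralD//; last 4 first.
    - by move=> x _; rewrite mule_ge0 ?lee_fin.
    - exact: measurable_funeM.
    - by move=> x _; rewrite mule_ge0 ?lee_fin// adde_ge0.
    - by apply: measurable_funeM; exact: emeasurable_funD.
    rewrite ge0_integralZl ?lee_fin//; congr (_ + _).
    rewrite ge0_integralZl ?lee_fin//; last 2 first.
    - exact: emeasurable_funD.
    - by move=> x _; rewrite adde_ge0.
    by rewrite ge0_integralD// IE IB.
  apply: ge0_le_integral => //.
  - by move=> x _; apply: integral_ge0.
  - apply: (measurable_integral2 (F := fun z => `|h z.1 - h z.2|%:E)) => //.
    by apply/measurable_EFinP; apply: measurableT_comp => //; exact: measurable_diff.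
  - apply: emeasurable_funD; apply: measurable_funeM => //; exact: emeasurable_funD.
  move=> x _.
  have msq : measurable_fun setT (fun y => ((u x - u y) ^+ 2)%:E).
    apply/measurable_EFinP; apply: measurable_funX; exact: measurable_funB.
  have -> : (2 / k)%:E * S x + (k / 4)%:E * ((h x)%:E + B x) =
      \int[P x]_y ((2 / k)%:E * ((u x - u y) ^+ 2)%:E + (k / 4)%:E * ((h x)%:E + (h y)%:E)).
    rewrite ge0_integralD//; last 4 first.
    - by move=> y _; rewrite mule_ge0 ?lee_fin ?sqr_ge0.
    - exact: measurable_funeM.
    - by move=> y _; apply: mule_ge0; [rewrite lee_fin|exact: adde_ge0].
    - by apply: measurable_funeM; exact: emeasurable_funD.
    rewrite ge0_integralZl ?lee_fin//; last by move=> y _; rewrite lee_fin sqr_ge0.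
    congr (_ + _); rewrite ge0_integralZl ?lee_fin//; last 2 first.
    - exact: emeasurable_funD.
    - by move=> y _; rewrite adde_ge0.
    by rewrite ge0_integralD// integral_cst// PT mule1.
  apply: ge0_le_integral => //.
  - apply/measurable_EFinP; apply: measurableT_comp => //; exact: measurable_funB.
  - apply: emeasurable_funD; apply: measurable_funeM => //; exact: emeasurable_funD.
  by move=> y _; have := diff_sqr_le k_gt0 (u0 x) (u0 y); rewrite -lee_fin.
move: (le_trans le1 le2) var0; case: (var u) => [v| |]// le v0; last by rewrite leey.
rewrite lee_fin; apply: (cheeger_algebra k_gt0); by rewrite -lee_fin.
Qed.

Let var_ge f : L2 f -> (\int[mu]_x f x = 0)%R -> (k ^+ 2 / 4 * dot f f)%:E <= var f.
Proof.
move=> f2 f0; have [mf _] := (Lfun2P mu f).1 f2.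
have [m [m1 m2]] := median_exists mu mf.
pose u x := Num.max (f x - m)%R 0%R; pose v x := Num.max (m - f x)%R 0%R.
have one2 : L2 (cst 1%R) by exact: Lfun2_cst.
have fm2 : L2 (fun x => f x - m)%R by exact: (Lfun2_sub f2 (Lfun2_cst m muT)).
have pos2 g : measurable_fun setT g -> (forall x, `|g x| <= `|f x - m|)%R -> L2 (fun x => Num.max (g x) 0)%R.
  move=> mg gf; apply: (Lfun2_dom _ fm2); first exact: measurable_maxr.
  move=> x; apply: le_trans (gf x); rewrite ger0_norm ?le_max ?lexx ?orbT//.
  by rewrite ge_max normr_ge0 andbT ler_norm.
have u2 : L2 u by apply: pos2 => //; exact: measurable_funB.
have v2 : L2 v by apply: pos2 => [|x]; [exact: measurable_funB|rewrite distrC].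
have u0 x : (0 <= u x)%R by rewrite le_max lexx orbT.
have v0 x : (0 <= v x)%R by rewrite le_max lexx orbT.
have lu : (k ^+ 2 / 4 * dot u u)%:E <= var u.
  apply: cheeger_half => //; rewrite (_ : [set x | _] = [set x | (m < f x)%R])//.
  by apply/seteqP; split => x /=; rewrite lt_max ltxx orbF subr_gt0.
have lv : (k ^+ 2 / 4 * dot v v)%:E <= var v.
  apply: cheeger_half => //; rewrite (_ : [set x | _] = [set x | (f x < m)%R])//.
  by apply/seteqP; split => x /=; rewrite lt_max ltxx orbF subr_gt0.
(* The right-hand side is |f - m|^2, which equals |f|^2 + m^2 because f has mean 0. *)
have duv : (dot f f <= dot u u + dot v v)%R.
  have -> : (dot u u + dot v v = dot (fun x => f x - m) (fun x => f x - m))%R.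
    rewrite /l2dot -RintegralD//; last 2 first.
    - exact: Lfun2_integrable_mul.
    - exact: Lfun2_integrable_mul.
    apply: eq_Rintegral => x _; rewrite /u /v.
    by case: (leP (f x - m)%R); case: (leP (m - f x)%R); nra.
  have -> : (fun x => f x - m)%R = (fun x => 1 * f x + (- m) * cst 1 x)%R.
    by apply/funext => x; rewrite mul1r mulr1.
  rewrite l2dot_comb// (_ : dot f (cst 1%R) = 0)%R; last first.
    by rewrite -f0; apply: eq_Rintegral => x _; rewrite mulr1.
  rewrite (_ : dot (cst 1%R) (cst 1%R) = 1)%R; last first.
    rewrite /l2dot /= Rintegral_cst//.
    by rewrite !mul1r; exact: (congr1 fine (probability_setT mu)).
  by rewrite expr1n mul1r mulr0 addr0 sqrrN mulr1 lerDl sqr_ge0.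
apply: le_trans (_ : var u + var v <= _).
  apply: le_trans (leeD lu lv); rewrite -EFinD lee_fin -mulrDr ler_wpM2l//.
  by rewrite divr_ge0// sqr_ge0.
have sq0 (g : T -> R) x y : 0 <= ((g x - g y) ^+ 2)%:E by rewrite lee_fin sqr_ge0.
have I0 (g : T -> R) x : 0 <= \int[P x]_y ((g x - g y) ^+ 2)%:E by exact: integral_ge0.
have mu_ := Lfun2_measurable u2; have mv := Lfun2_measurable v2.
have msq (g : T -> R) x : measurable_fun setT g -> measurable_fun setT (fun y => ((g x - g y) ^+ 2)%:E).
  by move=> mg; apply/measurable_EFinP; apply: measurable_funX; exact: measurable_funB.
rewrite /var -(ge0_integralD mu measurableT (fun x _ => I0 u x) (measurable_sqr_diff mu_)
  (fun x _ => I0 v x) (measurable_sqr_diff mv)).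
apply: ge0_le_integral => //.
- by move=> x _; rewrite adde_ge0.
- by apply: emeasurable_funD; exact: measurable_sqr_diff.
- exact: measurable_sqr_diff.
move=> x _; rewrite -ge0_integralD//; [|exact: msq|exact: msq].
apply: ge0_le_integral => //.
- by move=> y _; rewrite adde_ge0.
- by apply: emeasurable_funD; exact: msq.
- exact: msq.
by move=> y _; rewrite -EFinD lee_fin; exact: sqr_posneg_le.
Qed.

(** Expanding the square; invariance turns the mean of the integral of f^2 under [P x] into |f|^2.
    The factor 2 here halves the constant k^2 / 4 of [var_ge]. *)
Let var_energy f : L2 f -> var f = (2 * (dot f f - dot f (K f)))%:E.
Proof.
move=> f2; have [mf _] := (Lfun2P mu f).1 f2; have K2 := Lfun2_markov reversible f2.
have mK := measurable_markov_op P mf.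
have mf2 : measurable_fun setT (fun x => (f x ^+ 2)%:E).
  by apply/measurable_EFinP; exact: measurable_funX.
have f20 x : 0 <= (f x ^+ 2)%:E by rewrite lee_fin sqr_ge0.
pose B x := \int[P x]_y (f y ^+ 2)%:E.
have B0 x : 0 <= B x by exact: integral_ge0.
have mB : measurable_fun setT B by exact: measurable_integral_kernel.
have IB : \int[mu]_x B x = (dot f f)%:E.
  rewrite [LHS](integral_markov reversible mf2 f20).
  transitivity (\int[mu]_x (f x * f x)%:E); last by rewrite l2dot_EFin.
  by apply: eq_integral => x _; rewrite expr2.
pose g x : R := (f x * f x - 2 * (f x * K f x))%R.
have ifK := Lfun2_integrable_mul f2 K2.
have iff := Lfun2_integrable_mul f2 f2.
have i2fK : mu.-integrable setT (fun x => (2 * (f x * K f x))%:E).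
  by have := integrableZl measurableT 2%R ifK; apply: eq_integrable.
have ig : mu.-integrable setT (EFin \o g).
  by have := integrableB measurableT iff i2fK; apply: eq_integrable.
have Ig : \int[mu]_x (g x)%:E = (dot f f - 2 * dot f (K f))%:E.
  transitivity (\int[mu]_x (f x * f x)%:E - \int[mu]_x (2 * (f x * K f x))%:E).
    by rewrite -integralB.
  rewrite EFinB l2dot_EFin//; congr (_ - _).
  under eq_integral do rewrite EFinM.
  by rewrite integralZl// l2dot_EFin.
have iB : mu.-integrable setT B.
  apply/integrableP; split => //; under eq_integral do rewrite gee0_abs//.
  by rewrite IB ltry.
transitivity (\int[mu]_x ((g x)%:E + B x)).
  apply: ae_eq_integral => //.
  - exact: measurable_sqr_diff.
  - apply: emeasurable_funD => //; exact: measurable_int ig.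
  apply: filterS (ae_Lfun2_kernel reversible f2) => x fx _.
  have PTx : P x setT \is a fin_num by rewrite PT.
  have one2 := Lfun2_cst 1%R PTx.
  transitivity (l2dot (P x) (fun y => (-1) * f y + f x * cst 1 y)%R
      (fun y => (-1) * f y + f x * cst 1 y)%R)%:E.
    rewrite -l2dot_EFin//; last 2 first.
    - exact: (Lfun2_lin _ fx (Lfun2_scale (f x) one2)).
    - exact: (Lfun2_lin _ fx (Lfun2_scale (f x) one2)).
    by apply: eq_integral => y _; congr EFin; rewrite /cst; ring.
  rewrite l2dot_comb// (_ : l2dot (P x) f (cst 1%R) = K f x); last first.
    by apply: eq_Rintegral => y _; rewrite mulr1.
  rewrite (_ : l2dot (P x) (cst 1%R) (cst 1%R) = 1%R); last first.
    by rewrite /l2dot /= Rintegral_cst// [P x _]PT/= !mulr1.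
  rewrite /B (_ : (fun y => (f y ^+ 2)%:E) = (fun y => (f y * f y)%:E)); last first.
    by apply/funext => y; rewrite expr2.
  by rewrite l2dot_EFin// -EFinD; congr EFin; rewrite /g; ring.
by rewrite integralD// Ig IB -EFinD; congr EFin; ring.
Qed.

Lemma cheeger f : L20 mu f -> (k ^+ 2 / 8 * dot f f <= dot (f \- K f) f)%R.
Proof.
move=> [f2 f0]; have := var_ge f2 f0; rewrite var_energy// lee_fin.
have K2 := Lfun2_markov reversible f2.
have -> : (dot (f \- K f) f = dot f f - dot f (K f))%R.
  have -> : (f \- K f = fun x => (-1) * K f x + f x)%R by apply/funext => x /=; ring.
  by rewrite l2dot_lin// (l2dotC _ (K f)); ring.
lra.
Qed.

End cheeger.

(** * The spectrum of a positive reversible kernel *)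

Local Lemma discriminant_le (R : realFieldType) (a b c : R) : 0 <= c ->
  (forall t, 0 <= a + 2 * t * b + t ^+ 2 * c) -> b ^+ 2 <= a * c.
Proof.
move=> c_ge0 H; have a0 := H 0; rewrite mulr0 mul0r expr0n/= mul0r !addr0 in a0.
have [c0|c0] := eqVneq c 0.
  rewrite c0 mulr0; have [->|b0] := eqVneq b 0; first by rewrite expr0n.
  (* With c = 0 the form is affine in t, and this t gives it the value -1. *)
  have := H (- (a + 1) / (2 * b)); rewrite c0 mulr0 addr0.
  have -> : a + 2 * (- (a + 1) / (2 * b)) * b = -1 by field.
  by rewrite ler0N1.
have c_gt0 : 0 < c by rewrite lt_neqAle eq_sym c0.
have := H (- b / c).
have -> : a + 2 * (- b / c) * b + (- b / c) ^+ 2 * c = (a * c - b ^+ 2) / c by field.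
by rewrite pmulr_lge0 ?invr_gt0// subr_ge0.
Qed.

Local Lemma weighted_sum_sqr_le (R : realFieldType) (g p : nat -> R) (m n : nat) :
  (forall k, 0 < p k) ->
  (\sum_(m <= k < n) g k) ^+ 2 <=
  (\sum_(m <= k < n) (p k)^-1 * g k ^+ 2) * \sum_(m <= k < n) p k.
Proof.
move=> p0; apply: discriminant_le => [|t].
  by apply: sumr_ge0 => k _; exact: ltW.
rewrite (_ : _ + _ = \sum_(m <= k < n) (p k)^-1 * (g k + t * p k) ^+ 2).
  by apply: sumr_ge0 => k _; rewrite mulr_ge0 ?sqr_ge0// invr_ge0 ltW.
rewrite !mulr_sumr -!big_split/=; apply: eq_bigr => k _.
by field; rewrite gt_eqF.
Qed.

(* Square-summability with the weights [q ^- k] makes the series converge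
   pointwise almost everywhere, by Cauchy-Schwarz, without Riesz-Fischer. *)
Section series_completeness.
Context {dT : measure_display} {T : measurableType dT} {R : realType}.
Variable mu : probability T R.
Local Notation L2 f := (f \in Lfun mu 2%:E).
Local Notation dot := (l2dot mu).
Variables (g : nat -> T -> R) (q C : R).
Hypotheses (q0 : 0 < q) (q1 : q < 1) (g2 : forall k, L2 (g k))
  (gC : forall k, dot (g k) (g k) <= C * (q ^+ k) ^+ 2).

Let a k x : R := (q ^+ k)^-1 * g k x ^+ 2.
Let a_ge0 k x : 0 <= a k x.
Proof. by rewrite mulr_ge0 ?sqr_ge0// invr_ge0 exprn_ge0// ltW. Qed.

Let W x : \bar R := (\sum_(0 <= k <oo) (a k x)%:E)%E.

Let mg k : measurable_fun setT (g k).
Proof. exact: Lfun2_measurable (g2 k). Qed.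

Let ma k : measurable_fun setT (fun x => (a k x)%:E).
Proof.
apply/measurable_EFinP; apply: measurable_funM => //; exact: measurable_funX.
Qed.

Let mW : measurable_fun setT W.
Proof. by apply: ge0_emeasurable_sum => // k x _ _; rewrite lee_fin. Qed.

Let W_ge0 x : (0 <= W x)%E.
Proof. by apply: nneseries_ge0 => k _ _; rewrite lee_fin. Qed.

Let C0 : 0 <= C.
Proof. by apply: le_trans (l2dot_ge0 mu (g 0%N)) _; rewrite (le_trans (gC 0))// expr0 expr1n mulr1. Qed.

Let geo_le m n : \sum_(m <= k < n) q ^+ k <= q ^+ m / (1 - q).
Proof.
have q1' : 0 < 1 - q by rewrite subr_gt0.
suff H k : \sum_(m <= i < m + k) q ^+ i = q ^+ m * ((1 - q ^+ k) / (1 - q)).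
  have [nm|mn] := leqP n m.
    by rewrite big_geq// divr_ge0 ?exprn_ge0// ltW.
  rewrite -(subnKC (ltnW mn)) H ler_wpM2l ?exprn_ge0//; first exact: ltW.
  by rewrite ler_pdivrMr// mulVf ?gt_eqF// gerBl exprn_ge0// ltW.
elim: k => [|k IH]; first by rewrite addn0 big_geq// expr0 subrr mul0r mulr0.
rewrite addnS big_nat_recr ?leq_addr//= IH exprD exprS; field.
by rewrite gt_eqF.
Qed.

Let int_W : (\int[mu]_x W x <= (C / (1 - q))%:E)%E.
Proof.
rewrite integral_nneseries//; last by move=> k x _; rewrite lee_fin.
apply: lime_le; first by apply: is_cvg_nneseries => k _ _; apply: integral_ge0 => x _; rewrite lee_fin.
apply: nearW => n.
apply: (@le_trans _ _ (\sum_(0 <= k < n) (C * q ^+ k)%:E)%E).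
  apply: lee_sum => k _.
  have qk : 0 < q ^+ k by exact: exprn_gt0.
  under eq_integral do rewrite /a expr2 EFinM.
  rewrite ge0_integralZl//; last 3 first.
  - by apply/measurable_EFinP; exact: measurable_funM.
  - by move=> x _; rewrite lee_fin -expr2 sqr_ge0.
  - by rewrite lee_fin invr_ge0 ltW.
  rewrite l2dot_EFin// -EFinM lee_fin.
  by rewrite ler_pdivrMl// (le_trans (gC k))// expr2; lra.
rewrite sumEFin lee_fin -mulr_sumr ler_wpM2l//.
by rewrite (le_trans (geo_le 0 n))// expr0 div1r.
Qed.

Let A := [set x | (W x < +oo)%E].

Let mA : measurable A.
Proof. by rewrite -[A]setTI; exact: emeasurable_fun_infty_o. Qed.

Let s n x : R := \sum_(0 <= k < n) g k x.

Let partial_a_le x n m : A x -> \sum_(m <= k < n) a k x <= fine (W x).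
Proof.
move=> Ax; rewrite -lee_fin fineK; last by rewrite ge0_fin_numE.
have [nm|mn] := leqP n m; first by rewrite big_geq.
apply: (@le_trans _ _ (\sum_(0 <= k < n) (a k x)%:E)%E).
  rewrite -sumEFin [leRHS](@big_cat_nat _ _ _ m)//=; last exact: ltnW.
  by rewrite leeDr// sume_ge0// => k _; rewrite lee_fin.
by apply: nneseries_lim_ge => k _ _; rewrite lee_fin.
Qed.

Let tail_le x m n : A x ->
  (\sum_(m <= k < n) g k x) ^+ 2 <= q ^+ m / (1 - q) * fine (W x).
Proof.
move=> Ax; have qk k : 0 < q ^+ k by exact: exprn_gt0.
apply: le_trans (weighted_sum_sqr_le (fun k => g k x) m n qk) _.
rewrite [leRHS]mulrC ler_pM//.
- by apply: sumr_ge0 => k _; exact: a_ge0.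
- by apply: sumr_ge0 => k _; rewrite ltW.
- exact: partial_a_le.
Qed.

Let cvg_s x : A x -> cvgn (fun n => s n x).
Proof.
move=> Ax; apply: (@normed_cvg _ _ (fun k => g k x)).
apply: nondecreasing_is_cvgn.
  by apply: nondecreasing_series => k _ _; exact: normr_ge0.
exists ((1 - q)^-1 + fine (W x)) => _ [n _ <-].
rewrite /series/=.
(* By AM-GM, |g k x| <= q^k + g k x ^ 2 / q^k, and both terms are summable. *)
apply: (@le_trans _ _ (\sum_(0 <= k < n) (q ^+ k + a k x))).
  apply: ler_sum => k _; rewrite /a.
  have qk : 0 < q ^+ k by exact: exprn_gt0.
  have := sqr_ge0 (q ^+ k - `|g k x|); rewrite -(real_normK (num_real (g k x))).
  set u := `|g k x|; set p := q ^+ k in qk * => H.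
  have u0 : 0 <= u by exact: normr_ge0.
  rewrite -(ler_pM2l qk) mulrDr mulrA mulfV ?gt_eqF// mul1r; nra.
rewrite big_split/= lerD//; last exact: partial_a_le.
by rewrite (le_trans (geo_le 0 n))// expr0 div1r.
Qed.

Let f x : R := if x \in A then limn (fun n => s n x) else 0.

Let ms n : measurable_fun setT (s n).
Proof. by apply: measurable_sum. Qed.

Let mf : measurable_fun setT f.
Proof.
(* The indicator makes the partial sums converge at every point, not only on A. *)
apply: (@measurable_fun_cvg _ _ _ _ (fun n x => \1_A x * s n x)).
  by move=> n; apply: measurable_funM => //; exact: measurable_indic.
move=> x _; rewrite /f indicE; case: ifPn => [/set_mem Ax|_].
  rewrite (_ : (fun n => _) = (fun n => s n x)); last by apply/funext => n; rewrite mul1r.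
  exact: cvg_s.
rewrite (_ : (fun n => _) = (fun n => 0)); first exact: cvg_cst.
by apply/funext => n; rewrite mul0r.
Qed.

Let f_tail n x : A x -> (f x - s n x) ^+ 2 <= q ^+ n / (1 - q) * fine (W x).
Proof.
move=> Ax; rewrite /f mem_set//; have Sx := cvg_s Ax.
have cv : (fun m => (s m x - s n x) ^+ 2) @ \oo --> (limn (fun m => s m x) - s n x) ^+ 2.
  have cd : (fun m => s m x - s n x) @ \oo --> limn (fun m => s m x) - s n x.
    by apply: cvgB => //; exact: cvg_cst.
  by rewrite expr2; under eq_fun do rewrite expr2; exact: cvgM.
rewrite -(cvg_lim _ cv)//; apply: limr_le; first exact: cvgP cv.
near=> m.
rewrite /s (@big_cat_nat _ _ _ n)//=; last by near: m; exact: nbhs_infty_ge.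
by rewrite addrAC subrr add0r; exact: tail_le.
Unshelve. all: by end_near. Qed.

Let ae_A : {ae mu, forall x, A x}.
Proof.
have iW : mu.-integrable setT W.
  apply/integrableP; split => //; under eq_integral do rewrite gee0_abs//.
  by rewrite (le_lt_trans int_W)// ltry.
have := integrable_ae measurableT iW; apply: filterS => x /(_ I).
by rewrite ge0_fin_numE.
Qed.

Lemma L2_series_cvg : exists2 f, L2 f & forall n,
  dot (fun x => f x - \sum_(0 <= k < n) g k x) (fun x => f x - \sum_(0 <= k < n) g k x)
  <= C / (1 - q) ^+ 2 * q ^+ n.
Proof.
have int_le n : (\int[mu]_x ((f x - s n x) ^+ 2)%:E <= (C / (1 - q) ^+ 2 * q ^+ n)%:E)%E.
  apply: (@le_trans _ _ (\int[mu]_x ((q ^+ n / (1 - q))%:E * W x))%E).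
    apply: ae_ge0_le_integral => //.
    - by move=> x _; rewrite lee_fin sqr_ge0.
    - by apply/measurable_EFinP; apply: measurable_funX; exact: measurable_funB.
    - by move=> x _; rewrite mule_ge0// lee_fin divr_ge0 ?exprn_ge0 ?subr_ge0// ltW.
    - exact: measurable_funeM.
    apply: filterS ae_A => x Ax _.
    have Wf : (W x \is a fin_num)%E by rewrite ge0_fin_numE.
    by rewrite -(fineK Wf) -EFinM lee_fin; exact: f_tail.
  have c0 : 0 <= q ^+ n / (1 - q) by rewrite divr_ge0 ?exprn_ge0 ?subr_ge0// ltW.
  rewrite ge0_integralZl ?lee_fin//.
  apply: le_trans (lee_wpmul2l _ int_W) _; first by rewrite lee_fin.
  rewrite -EFinM lee_fin le_eqVlt; apply/orP; left; apply/eqP; field.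
  by rewrite gt_eqF// subr_gt0.
have f2 : L2 f.
  apply/Lfun2P; split=> //; have := int_le 0%N.
  have s0 x : s 0%N x = 0 by rewrite /s big_geq.
  rewrite (_ : (fun x => ((f x - s 0 x) ^+ 2)%:E) = fun x => (f x ^+ 2)%:E); last first.
    by apply/funext => x; rewrite s0 subr0.
  by move=> /le_lt_trans; apply; rewrite ltry.
have s2 n : L2 (s n).
  elim: n => [|n IH].
    rewrite (_ : s 0%N = cst 0); first by apply: Lfun2_cst; exact: fin_num_measure.
    by apply/funext => x; rewrite /s big_geq.
  rewrite (_ : s n.+1 = fun x => 1 * g n x + s n x); first exact: Lfun2_lin.
  by apply/funext => x; rewrite /s big_nat_recr//= mul1r addrC.
exists f => // n; have fs := Lfun2_sub f2 (s2 n).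
rewrite -lee_fin -l2dot_EFin//; apply: le_trans (int_le n).
by under [leRHS]eq_integral do rewrite expr2.
Qed.

End series_completeness.

(** * Norm bounds, resolvent and bottom of the gap *)

Section spectrum.
Context {dT : measure_display} {T : measurableType dT} {R : realType}.
Variables (mu : probability T R) (P : R.-pker T ~> T).
Implicit Types (f g h : T -> R) (a b c : R).
Local Notation L2 f := (f \in Lfun mu 2%:E).
Local Notation dot := (l2dot mu).
Local Notation nrm := (l2norm mu).
Local Notation K := (markov_op P).
Local Notation S := (shifted_op P).
Hypothesis reversible : forall f g : T -> \bar R,
  measurable_fun setT f -> measurable_fun setT g ->
  (forall x, 0 <= f x)%E -> (forall x, 0 <= g x)%E ->
  (\int[mu]_x (g x * \int[P x]_y f y) = \int[mu]_x (f x * \int[P x]_y g y))%E.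
Hypothesis positive : forall f g : T -> \bar R,
  measurable_fun setT f -> measurable_fun setT g ->
  (forall x, 0 <= f x)%E -> (forall x, 0 <= g x)%E ->
  (\int[mu]_x (f x * \int[P x]_y g y) + \int[mu]_x (f x * \int[P x]_y g y) <=
   \int[mu]_x (f x * \int[P x]_y f y) + \int[mu]_x (g x * \int[P x]_y g y))%E.

Let muT : (mu setT \is a fin_num)%E.
Proof. by rewrite probability_setT. Qed.

Let K2 f (f2 : L2 f) : L2 (K f) := Lfun2_markov reversible f2.
Let KC f g (f2 : L2 f) (g2 : L2 g) : dot f (K g) = dot g (K f) :=
  l2dot_markovC reversible f2 g2.
Let K0 f (f2 : L2 f) : 0 <= dot f (K f) := l2dot_markov_ge0 reversible positive f2.

Lemma L20_lin a f g : L20 mu f -> L20 mu g -> L20 mu (fun x => a * f x + g x).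
Proof.
move=> [f2 f0] [g2 g0]; split; first exact: Lfun2_lin.
rewrite RintegralD ?RintegralZl ?f0 ?g0 ?mulr0 ?addr0//.
- exact: (Lfun2_integrable muT f2).
- exact: (Lfun2_integrable muT (Lfun2_scale a f2)).
- exact: (Lfun2_integrable muT g2).
Qed.

Lemma L20_cst0 : L20 mu (cst 0).
Proof. by split; [exact: Lfun2_cst|rewrite Rintegral_cst// mul0r]. Qed.

Lemma L20_scale a f : L20 mu f -> L20 mu (fun x => a * f x).
Proof.
move=> f0; have := L20_lin a f0 L20_cst0.
by rewrite (_ : (fun x => a * f x + _) = fun x => a * f x)//; apply/funext => x; rewrite addr0.
Qed.

Lemma L20_markov f : L20 mu f -> L20 mu (K f).
Proof. by move=> [f2 f0]; split; [exact: K2|rewrite integral_markov_op]. Qed.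

Let shiftedE c f : S c f = fun x => (-1) * K f x + c * f x.
Proof. by apply/funext => x; rewrite /shifted_op mulN1r addrC. Qed.

Lemma L20_shifted c f : L20 mu f -> L20 mu (S c f).
Proof.
by move=> f0; rewrite shiftedE; apply: L20_lin; [exact: L20_markov|exact: L20_scale].
Qed.

Let dotZ a f g : L2 f -> L2 g -> dot (fun x => a * f x) g = a * dot f g.
Proof.
move=> f2 g2; rewrite /l2dot -RintegralZl//; last exact: Lfun2_integrable_mul.
by apply: eq_Rintegral => x _; rewrite mulrA.
Qed.

Lemma l2dot_shifted c f g : L2 f -> L2 g -> dot (S c f) g = c * dot f g - dot g (K f).
Proof.
move=> f2 g2; rewrite shiftedE l2dot_lin//; [|exact: K2|exact: Lfun2_scale].
by rewrite dotZ// (l2dotC _ (K f)) mulN1r addrC.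
Qed.

(* Cauchy-Schwarz for the form [c * <f, g> + e * <f, P g>] whenever it is
   positive semidefinite. *)
Lemma form_cauchy_schwarz c e f g :
  (forall h, L20 mu h -> 0 <= c * dot h h + e * dot h (K h)) ->
  L20 mu f -> L20 mu g ->
  (c * dot f g + e * dot f (K g)) ^+ 2 <=
  (c * dot f f + e * dot f (K f)) * (c * dot g g + e * dot g (K g)).
Proof.
move=> H f0 g0; have [[f2 _] [g2 _]] := (f0, g0).
apply: discriminant_le => [|t]; first exact: H.
have tg := L20_lin t g0 f0; have := H _ tg.
have tg2 := Lfun2_lin t g2 f2.
rewrite (l2dot_lin t g2 f2 tg2) (l2dotC mu g) (l2dotC mu f) (l2dot_lin t g2 f2 g2).
rewrite (l2dot_lin t g2 f2 f2) (l2dotC mu g f).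
rewrite (l2dot_lin t g2 f2 (K2 tg2)) (KC g2 tg2) (KC f2 tg2).
rewrite (l2dot_lin t g2 f2 (K2 g2)) (l2dot_lin t g2 f2 (K2 f2)) (KC g2 f2).
move: (dot f f) (dot f g) (dot g g) (dot f (K f)) (dot f (K g)) (dot g (K g)).
move=> ff fg gg kff kfg kgg; congr (0 <= _); ring.
Qed.

Let dot_cs f g : L20 mu f -> L20 mu g -> dot f g ^+ 2 <= dot f f * dot g g.
Proof.
have E (u v : R) : 1 * u + 0 * v = u by rewrite mul1r mul0r addr0.
move=> f0 g0; rewrite -(E (dot f g) (dot f (K g))) -(E (dot f f) (dot f (K f))).
rewrite -(E (dot g g) (dot g (K g))); apply: form_cauchy_schwarz => // h _.
rewrite E; exact: l2dot_ge0.
Qed.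

Let form_cs f g : L20 mu f -> L20 mu g -> dot f (K g) ^+ 2 <= dot f (K f) * dot g (K g).
Proof.
have E (u v : R) : 0 * u + 1 * v = v by rewrite mul1r mul0r add0r.
move=> f0 g0; rewrite -(E (dot f g) (dot f (K g))) -(E (dot f f) (dot f (K f))).
rewrite -(E (dot g g) (dot g (K g))); apply: form_cauchy_schwarz => // h [h2 _].
rewrite E; exact: K0.
Qed.

Lemma l2dot_markov_le f : L20 mu f -> dot f (K f) <= dot f f.
Proof.
move=> f0; have [f2 _] := f0; have := dot_cs f0 (L20_markov f0).
have := markov_op_contract reversible f2; have := K0 f2; have := l2dot_ge0 mu f.
move: (dot f f) (dot f (K f)) (dot (K f) (K f)) => F q N F0 q0 NF qFN.
rewrite -(ler_sqr q0 F0) (le_trans qFN)// expr2 ler_wpM2l//.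
Qed.

Section bounded_form.
Variable b : R.
Hypotheses (b0 : 0 <= b) (form_le : forall f, L20 mu f -> dot f (K f) <= b * dot f f).

(** Cauchy-Schwarz for the positive form <., P .> at f and P f gives |P f|^4 <= <f, P f> <P f, P P
    f>, at most b |f|^2 times b |P f|^2. Positivity thus turns a bound on the form into one on the
    operator norm. *)
Lemma markov_op_norm_le f : L20 mu f -> dot (K f) (K f) <= b ^+ 2 * dot f f.
Proof.
move=> f0; have Kf0 := L20_markov f0; have [f2 _] := f0.
have := form_cs f0 Kf0; rewrite (KC f2 (K2 f2)).
have := form_le f0; have := form_le Kf0; have := K0 f2; have := K0 (K2 f2).
have := l2dot_ge0 mu (K f); have := l2dot_ge0 mu f.
move: (dot f f) (dot f (K f)) (dot (K f) (K f)) (dot (K f) (K (K f))) => F q N r.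
move=> F0 N0 r0 q0 rN qF H.
have [->|Nn0] := eqVneq N 0; first by rewrite mulr_ge0// sqr_ge0.
have N_gt0 : 0 < N by rewrite lt_neqAle eq_sym Nn0.
rewrite -(ler_pM2r N_gt0) -expr2 (le_trans H)//.
by rewrite (_ : b ^+ 2 * F * N = (b * F) * (b * N)); [exact: ler_pM|ring].
Qed.

(** Pair (c - P) f with f: by Cauchy-Schwarz |(c - P) f| |f| >= |c| |f|^2 - <f, P f>. *)
Lemma shifted_norm_ge c f : b < `|c| -> L20 mu f ->
  (`|c| - b) ^+ 2 * dot f f <= dot (S c f) (S c f).
Proof.
move=> bc f0; have [f2 _] := f0; have Sf0 := L20_shifted c f0; have [Sf2 _] := Sf0.
have := dot_cs Sf0 f0; rewrite (l2dot_shifted c f2 f2).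
have := form_le f0; have := K0 f2; have := l2dot_ge0 mu f; have := l2dot_ge0 mu (S c f).
move: (dot f f) (dot f (K f)) (dot (S c f) (S c f)) => F q N N0 F0 q0 qF H.
have [->|Fn0] := eqVneq F 0; first by rewrite mulr0.
have F_gt0 : 0 < F by rewrite lt_neqAle eq_sym Fn0.
rewrite -(ler_pM2r F_gt0) (le_trans _ H)//.
have -> : (`|c| - b) ^+ 2 * F * F = ((`|c| - b) * F) ^+ 2 by ring.
rewrite -[leRHS]real_normK ?num_real// lerXn2r ?nnegrE ?normr_ge0//.
  by rewrite mulr_ge0// subr_ge0 ltW.
apply: le_trans (lerB_normD _ _); rewrite normrN normrM (ger0_norm F0) (ger0_norm q0).
by rewrite mulrBl lerD2l lerN2.
Qed.

(** Write S = b - P, whose form is positive. Cauchy-Schwarz for it at f and S f gives |S f|^4 <= <S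
    f, f> <S S f, S f>, and the last factor is at most b |S f|^2 since P is positive. *)
Lemma shifted_norm_le f : L20 mu f ->
  dot (S b f) (S b f) <= b * (b * dot f f - dot f (K f)).
Proof.
move=> f0; have [f2 _] := f0; have Sf0 := L20_shifted b f0; have [Sf2 _] := Sf0.
have H h : L20 mu h -> 0 <= b * dot h h + (-1) * dot h (K h).
  by move=> h0; rewrite mulN1r subr_ge0 form_le.
have := form_cauchy_schwarz H f0 Sf0.
have -> : b * dot f (S b f) + -1 * dot f (K (S b f)) = dot (S b f) (S b f).
  rewrite (l2dot_shifted b f2 Sf2) (KC f2 Sf2); ring.
rewrite !mulN1r; have := form_le f0; have := K0 Sf2; have := l2dot_ge0 mu (S b f).
move: (dot f f) (dot f (K f)) (dot (S b f) (S b f)) (dot (S b f) (K (S b f))) => F q N r.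
move=> N0 r0 qF le.
have [->|Nn0] := eqVneq N 0; first by rewrite mulr_ge0// subr_ge0.
have N_gt0 : 0 < N by rewrite lt_neqAle eq_sym Nn0.
rewrite -(ler_pM2r N_gt0) -expr2 (le_trans le)//.
rewrite (_ : b * (b * F - q) * N = (b * F - q) * (b * N)); last ring.
by rewrite ler_wpM2l ?subr_ge0// gerBl.
Qed.

Let sqr_integral_le f : L2 f -> (\int[mu]_x f x) ^+ 2 <= dot f f.
Proof.
move=> f2; have one2 : L2 (cst 1) by exact: Lfun2_cst.
have E : dot f (cst 1) = \int[mu]_x f x.
  by apply: eq_Rintegral => x _; rewrite mulr1.
have E1 : dot (cst 1) (cst 1) = 1.
  by rewrite /l2dot /= Rintegral_cst// !mul1r; exact: (congr1 fine (probability_setT mu)).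
have := l2dot_ge0 mu (fun x => 1 * f x + (- \int[mu]_x f x) * cst 1 x).
rewrite (l2dot_comb _ _ f2 one2) E E1; move: (dot f f) (\int[mu]_x f x) => u v.
by rewrite expr1n mul1r mulr1 sqrrN mulr1 -mulrA mulNr -expr2; lra.
Qed.

Let dot_ae2 f g : L2 f -> L2 g -> f = g %[ae mu] -> dot f f = dot g g.
Proof.
move=> f2 g2 fg; have mf := Lfun2_measurable f2; have mg := Lfun2_measurable g2.
by rewrite (l2dot_ae mf mg mf fg) l2dotC (l2dot_ae mf mg mg fg).
Qed.

Let dotD_le f g : L2 f -> L2 g ->
  dot (fun x => f x + g x) (fun x => f x + g x) <= 2 * dot f f + 2 * dot g g.
Proof.
move=> f2 g2; have := l2dot_ge0 mu (fun x => 1 * f x + (-1) * g x).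
have -> : (fun x => f x + g x) = fun x => 1 * f x + 1 * g x.
  by apply/funext => x; rewrite !mul1r.
rewrite !l2dot_comb//.
move: (dot f f) (dot f g) (dot g g) => u v w H.
lra.
Qed.

Lemma neumann_solve c h : b < `|c| -> L20 mu h ->
  exists2 f, L20 mu f & S c f = h %[ae mu].
Proof.
move=> bc h0; have c_gt0 : 0 < `|c| := le_lt_trans b0 bc.
have cn0 : c != 0 by rewrite -normr_gt0.
(* The midpoint of b / |c| and 1: it stays positive when b = 0, as the weights q^-k of the series
   require. *)
pose q : R := (b + `|c|) / (2 * `|c|).
have c2_gt0 : 0 < 2 * `|c| by rewrite mulr_gt0.
have q_gt0 : 0 < q by rewrite divr_gt0// ltr_wpDl.
have q1 : q < 1 by rewrite ltr_pdivrMr// mul1r mulr_natl mulr2n ltrD2r.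
have bq : b / `|c| <= q.
  by rewrite /q ler_pdivrMr// mulrAC ler_pdivlMr//; nra.
pose fix G k : T -> R := if k is k'.+1 then fun x => c^-1 * K (G k') x else fun x => c^-1 * h x.
have G0 k : L20 mu (G k).
  by elim: k => [|k IH]; apply: L20_scale => //; exact: L20_markov.
have G2 k : L2 (G k) by have [] := G0 k.
pose C := dot (G 0%N) (G 0%N).
have GC k : dot (G k) (G k) <= C * (q ^+ k) ^+ 2.
  elim: k => [|k IH]; first by rewrite expr0 expr1n mulr1.
  have -> : dot (G k.+1) (G k.+1) = (`|c|^-1) ^+ 2 * dot (K (G k)) (K (G k)).
    rewrite /= dotZ; [|exact: K2|exact: (G2 k.+1)].
    rewrite l2dotC dotZ; [|exact: K2|exact: K2].
    by rewrite mulrA -expr2 !exprVn real_normK ?num_real.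
  apply: (@le_trans _ _ (q ^+ 2 * dot (G k) (G k))).
    apply: (@le_trans _ _ (`|c|^-1 ^+ 2 * (b ^+ 2 * dot (G k) (G k)))).
      by rewrite ler_wpM2l ?sqr_ge0//; exact: markov_op_norm_le.
    rewrite mulrA -exprMn ler_wpM2r ?l2dot_ge0// mulrC lerXn2r ?nnegrE//.
      by rewrite divr_ge0// ltW.
    by rewrite ltW.
  have -> : C * (q ^+ k.+1) ^+ 2 = q ^+ 2 * (C * (q ^+ k) ^+ 2) by rewrite (exprS q k); ring.
  exact: (ler_wpM2l (sqr_ge0 q) IH).
have [f f2 fS] := L2_series_cvg q_gt0 q1 G2 GC.
pose s n x : R := \sum_(0 <= k < n) G k x.
have sS n : s n.+1 = fun x => 1 * s n x + G n x.
  by apply/funext => x; rewrite /s big_nat_recr//= mul1r.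
have sz : s 0%N = cst 0 by apply/funext => x; rewrite /s big_geq.
have s0 n : L20 mu (s n).
  by elim: n => [|n IH]; [rewrite sz; exact: L20_cst0|rewrite sS; exact: L20_lin].
have s2 n : L2 (s n) by have [] := s0 n.
(* Telescoping, as c * G k - P (G k) = c * (G k - G k.+1) and c * G 0 = h. *)
have Ss n : S c (s n) = (fun x => h x - c * G n x) %[ae mu].
  elim: n => [|n IH].
    apply: nearW => x _; rewrite sz /shifted_op /markov_op /cst /= Rintegral_cst// mul0r mulr0.
    by rewrite mulrA mulfV// mul1r !subrr.
  have Kae := markov_op_lin reversible 1 (s2 n) (G2 n).
  apply: filterS2 IH Kae => x /(_ I) IH /(_ I) Kx _.
  rewrite /shifted_op sS Kx; move: IH; rewrite /shifted_op /= => IH.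
  by rewrite [c * (c^-1 * _)]mulrA mulfV// !mul1r mulrDr opprD addrACA IH; ring.
pose r n x : R := f x - s n x.
have r2 n : L2 (r n) by exact: Lfun2_sub.
pose D := C / (1 - q) ^+ 2.
have rD n : dot (r n) (r n) <= D * q ^+ n by exact: fS.
have D0 : 0 <= D.
  by have := rD 0%N; rewrite expr0 mulr1; apply: le_trans; exact: l2dot_ge0.
have Cge0 : 0 <= C by exact: l2dot_ge0.
have small (x M : R) : 0 <= M -> (forall n, x <= M * q ^+ n) -> x <= 0.
  move=> M0 H; rewrite leNgt; apply/negP => x0.
  have qcvg : (fun n => M * q ^+ n) @ \oo --> M * 0.
    by apply: cvgM; [exact: cvg_cst|apply: cvg_expr; rewrite ger0_norm// ltW].
  have : x <= M * 0.
    by rewrite -(cvg_lim _ qcvg)//; apply: limr_ge; [exact: cvgP qcvg|exact: nearW].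
  by rewrite mulr0 leNgt x0.
(* The partial sums have mean 0, and the mean is continuous for the L^2 norm. *)
have f0 : L20 mu f.
  split=> //; apply/eqP; rewrite -sqrf_eq0 eq_le sqr_ge0 andbT.
  apply: (small _ _ D0) => n; apply: le_trans (rD n).
  have [_ sn0] := s0 n.
  have -> : \int[mu]_x f x = \int[mu]_x r n x.
    rewrite RintegralB ?sn0 ?subr0//; first exact: (Lfun2_integrable muT f2).
    exact: (Lfun2_integrable muT (s2 n)).
  exact: sqr_integral_le.
exists f => //.
have Sf2 : L2 (S c f) by have [] := L20_shifted c f0.
have [h2 _] := h0.
suff : dot (fun x => S c f x - h x) (fun x => S c f x - h x) <= 0.
  move=> le; have : (fun x => S c f x - h x) = cst 0 %[ae mu].
    apply: l2dot_eq0; first exact: Lfun2_sub.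
    by apply/eqP; rewrite eq_le le l2dot_ge0.
  by apply: filterS => x /[apply]/eqP; rewrite subr_eq0 => /eqP.
(* Almost everywhere S c f - h = S c (r n) - c * G n, and both terms have squared norm of order q^n;
   M collects the constants. *)
pose M := 2 * (2 * c ^+ 2 * D + 2 * D) + 2 * c ^+ 2 * C.
apply: (small _ M) => [|n].
  have c20 : 0 <= 2 * c ^+ 2 by apply: mulr_ge0 => //; exact: sqr_ge0.
  rewrite /M; apply: addr_ge0; last exact: mulr_ge0.
  by apply: mulr_ge0 => //; apply: addr_ge0; exact: mulr_ge0.
have Sr2 : L2 (S c (r n)).
  by rewrite shiftedE; apply: Lfun2_lin; [exact: K2|exact: Lfun2_scale].
have cG2 : L2 (fun x => - c * G n x) by exact: Lfun2_scale.
have E : (fun x => S c f x - h x) = (fun x => S c (r n) x + - c * G n x) %[ae mu].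
  have Kae := markov_op_lin reversible 1 (r2 n) (s2 n).
  have fE : f = fun x => 1 * r n x + s n x by apply/funext => x; rewrite mul1r /r subrK.
  rewrite -fE in Kae; apply: filterS2 (Ss n) Kae => x /(_ I) Sx /(_ I) Kx _.
  rewrite /shifted_op in Sx *; rewrite Kx; rewrite /r in Kx *; move: Sx => /eqP.
  rewrite subr_eq => /eqP Sx.
  have -> : c * f x - (1 * K (fun x0 => f x0 - s n x0) x + K (s n) x) - h x =
    c * (f x - s n x) - K (fun x0 => f x0 - s n x0) x + (c * s n x - K (s n) x - h x) by ring.
  by rewrite Sx; ring.
have F2 : L2 (fun x => S c (r n) x + - c * G n x).
  have := Lfun2_lin (- c) (G2 n) Sr2.
  rewrite (_ : (fun x => - c * G n x + _) = fun x => S c (r n) x + - c * G n x)//.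
  by apply/funext => x; rewrite addrC.
rewrite (dot_ae2 (Lfun2_sub Sf2 h2) F2 E).
have Z e g : L2 g -> dot (fun x => e * g x) (fun x => e * g x) = e ^+ 2 * dot g g.
  move=> g2; rewrite (dotZ e g2 (Lfun2_scale e g2)) l2dotC (dotZ e g2 g2).
  by rewrite mulrA expr2.
have B1 : dot (S c (r n)) (S c (r n)) <= 2 * (D * q ^+ n) + 2 * (c ^+ 2 * (D * q ^+ n)).
  rewrite shiftedE.
  apply: le_trans (dotD_le (Lfun2_scale (-1) (K2 (r2 n))) (Lfun2_scale c (r2 n))) _.
  rewrite (Z _ _ (K2 (r2 n))) (Z _ _ (r2 n)) sqrrN expr1n mul1r.
  have Kr := markov_op_contract reversible (r2 n).
  apply: lerD; apply: ler_wpM2l => //; first exact: le_trans Kr (rD n).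
  exact: (ler_wpM2l (sqr_ge0 c) (rD n)).
have B2 : dot (fun x => - c * G n x) (fun x => - c * G n x) <= c ^+ 2 * (C * q ^+ n).
  rewrite (Z _ _ (G2 n)) sqrrN; apply: ler_wpM2l; first exact: sqr_ge0.
  apply: le_trans (GC n) _; apply: ler_wpM2l => //; rewrite expr2.
  have qn0 : 0 <= q ^+ n by apply: exprn_ge0; exact: ltW.
  by rewrite ler_piMl// exprn_ile1// ltW.
apply: le_trans (dotD_le Sr2 cG2) _.
have -> : M * q ^+ n = 2 * (2 * (D * q ^+ n) + 2 * (c ^+ 2 * (D * q ^+ n))) +
    2 * (c ^+ 2 * (C * q ^+ n)) by rewrite /M; ring.
by apply: lerD; apply: ler_wpM2l.
Qed.

Lemma in_resolvent_gt c : b < `|c| -> in_resolvent mu P c.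
Proof.
move=> bc; have d0 : 0 < `|c| - b by rewrite subr_gt0.
split=> [f f0 Sf|h h0|].
- have [f2 _] := f0; have [Sf2 _] := L20_shifted c f0.
  apply: l2dot_eq0 => //; apply/eqP; rewrite eq_le l2dot_ge0 andbT.
  rewrite -(pmulr_rle0 _ (exprn_gt0 2 d0)) (le_trans (shifted_norm_ge bc f0))//.
  by rewrite (l2dot_ae0 (Lfun2_measurable Sf2) Sf).
- exact: neumann_solve.
- exists (`|c| - b)^-1 => f f0.
  have [f2 _] := f0; have [Sf2 _] := L20_shifted c f0.
  rewrite ler_pdivlMl// !l2norm_sqrt// -[X in X * _](ger0_norm (ltW d0)).
  rewrite -sqrtr_sqr -sqrtrM ?sqr_ge0//.
  exact: (ler_wsqrtr (shifted_norm_ge bc f0)).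
Qed.

End bounded_form.

Lemma l2norm_eq0 f : L2 f -> f = cst 0 %[ae mu] -> nrm f = 0.
Proof.
by move=> f2 f0; rewrite l2norm_sqrt// (l2dot_ae0 (Lfun2_measurable f2) f0) sqrtr0.
Qed.

Let nonzero := [set f | L20 mu f /\ ~ (f = cst 0 %[ae mu])].

Let nonzero_gt0 f : nonzero f -> 0 < dot f f.
Proof.
move=> [[f2 f0] fn]; rewrite lt_neqAle l2dot_ge0 andbT eq_sym.
by apply/eqP => /(l2dot_eq0 f2).
Qed.

Let ratio f : R := dot f (K f) / dot f f.

Let right_gapE : right_gap mu P = ereal_inf [set (1 - ratio f)%:E | f in nonzero].
Proof.
congr ereal_inf; apply/seteqP; split => _ [f nf <-]; exists f => //;
  have [[f2 f0] _] := nf; have F0 := nonzero_gt0 nf; congr EFin;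
  rewrite l2norm_sqr// (_ : f \- K f = S 1 f) ?l2dot_shifted// ?mul1r.
- by rewrite /ratio mulrBl mulfV ?gt_eqF.
- by apply/funext => x; rewrite /shifted_op mul1r.
- by rewrite /ratio mulrBl mulfV ?gt_eqF.
- by apply/funext => x; rewrite /shifted_op mul1r.
Qed.

Theorem spectral_gap_right_gap : spectral_gap mu P = right_gap mu P.
Proof.
rewrite right_gapE /spectral_gap.
(* If L^2_0 is trivial, the spectrum is empty and both gaps are +oo, by the conventions for the
   supremum and infimum of the empty set. *)
have [/set0P[f1 nf1]|none] := pselect (nonzero != set0); last first.
  have allz f : L20 mu f -> f = cst 0 %[ae mu].
    by move=> f0; apply: contrapT => fn; apply: none; apply/set0P; exists f.
  have -> : nonzero = set0 by apply: contrapT => /eqP.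
  have -> : spectrum0 mu P = set0.
    rewrite -subset0 => c; apply; split => [f f0 _|h h0|].
    - exact: allz.
    - exists (cst 0); first exact: L20_cst0.
      by apply: filterS2 (allz _ h0) (allz _ (L20_shifted c L20_cst0)) => x hx Sx xT;
        rewrite hx// Sx.
    - by exists 0 => f f0; have [f2 _] := f0; rewrite mul0r l2norm_eq0//; exact: allz.
  by rewrite !image_set0 ereal_sup0 ereal_inf0.
pose A := ratio @` nonzero.
have A1 : ubound A 1.
  move=> _ [f nf <-]; have [f0 _] := nf.
  by rewrite ler_pdivrMr ?nonzero_gt0// mul1r l2dot_markov_le.
have supA : has_sup A by split; [exists (ratio f1); exists f1|exists 1].
pose b := sup A.
have b_ge0 : 0 <= b.
  apply: le_trans (_ : ratio f1 <= _); last by apply: ub_le_sup; [exists 1|exists f1].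
  by have [[f2 _] _] := nf1; rewrite divr_ge0 ?l2dot_ge0// K0.
have form_le f : L20 mu f -> dot f (K f) <= b * dot f f.
  move=> f0; have [fz|fn] := pselect (f = cst 0 %[ae mu]).
    have [f2 _] := f0; have F0 := l2dot_ae0 (Lfun2_measurable f2) fz.
    by rewrite F0 mulr0 -F0 l2dot_markov_le.
  rewrite -ler_pdivrMr ?nonzero_gt0//.
  by apply: ub_le_sup; [exists 1|exists f].
(* If b were in the resolvent set, the bounded inverse and [shifted_norm_le] would give 1 <= M * (b
   - ratio f) for every nonzero f, so that b - 1 / M would be an upper bound of the ratios below
   their supremum b. *)
have b_spec : spectrum0 mu P b.
  move=> [_ _ [C CS]]; pose M := C ^+ 2 * b.
  have M0 : 0 <= M by rewrite mulr_ge0 ?sqr_ge0.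
  have le f : nonzero f -> 1 <= M * (b - ratio f).
    move=> nf; have [f0 _] := nf; have F0 := nonzero_gt0 nf; have [f2 _] := f0.
    have [Sf2 _] := L20_shifted b f0.
    rewrite -(ler_pM2r F0) mul1r -mulrA mulrBl /ratio divfK ?gt_eqF//.
    have nC := CS f f0; rewrite -l2norm_sqr//.
    apply: (@le_trans _ _ (C ^+ 2 * dot (S b f) (S b f))).
      rewrite -[X in _ * X]l2norm_sqr// -exprMn lerXn2r ?nnegrE ?l2norm_ge0//.
      by rewrite (le_trans _ nC)// l2norm_ge0.
    rewrite l2norm_sqr// /M -[leRHS]mulrA; apply: (ler_wpM2l (sqr_ge0 C)).
    exact: shifted_norm_le.
  have M_gt0 : 0 < M.
    rewrite lt_neqAle M0 andbT eq_sym; apply/eqP => Mz.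
    by have := le f1 nf1; rewrite Mz mul0r ler10.
  have : b <= b - M^-1.
    apply: ge_sup; first by exists (ratio f1); exists f1.
    move=> _ [f nf <-]; rewrite lerBrDr -lerBrDl.
    by rewrite -[X in X <= _]mulr1 ler_pdivrMl// le.
  by rewrite lerBrDr gerDl invr_le0 leNgt M_gt0.
have -> : ereal_sup [set `|c|%:E | c in spectrum0 mu P] = b%:E.
  apply/eqP; rewrite eq_le; apply/andP; split.
    apply: ge_ereal_sup => _ [c cs <-]; rewrite lee_fin leNgt; apply/negP => bc.
    exact: cs (in_resolvent_gt b_ge0 form_le bc).
  by apply: ereal_sup_ubound; exists b => //; rewrite ger0_norm.
apply/eqP; rewrite -EFinB eq_le; apply/andP; split.
  apply: le_ereal_inf_tmp => _ [f nf <-]; rewrite lee_fin lerD2l lerN2.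
  by apply: ub_le_sup; [exists 1|exists f].
apply/lee_addgt0Pr => e e0.
have [_ [f nf <-] be] := sup_adherent e0 supA.
apply: (@le_trans _ _ (1 - ratio f)%:E); first by apply: ereal_inf_lbound; exists f.
by rewrite -EFinD lee_fin; move: be; rewrite -/b; lra.
Qed.

End spectrum.

(** * The spectral gap of Random Walk Metropolis *)

Section as_kernel.
Context {dT : measure_display} {T : measurableType dT} {R : realType}.
Variables (P : T -> {measure set T -> \bar R})
  (mP : forall A, measurable A -> measurable_fun setT (P ^~ A))
  (P1 : forall x, P x setT = 1%E).

Definition as_kernel of (forall A, measurable A -> measurable_fun setT (P ^~ A)) &
  (forall x, P x setT = 1%E) : T -> {measure set T -> \bar R} := P.

HB.instance Definition _ := isKernel.Build _ _ _ _ R (as_kernel mP P1) mP.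

HB.instance Definition _ := Kernel_isProbability.Build _ _ _ _ R (as_kernel mP P1) P1.

End as_kernel.

Section rwm_gap.
Context {R : realType} {d : nat}.
Variables (s0 s : R).
Hypotheses (d_gt0 : (0 < d)%N) (s0_gt0 : 0 < s0) (s_gt0 : 0 < s).
Local Notation T := (d.-tuple R).
Local Notation pi := (gauss s0 : {measure set T -> \bar R}).
Local Notation P := (rwm_gauss s0 s : T -> {measure set T -> \bar R}).

Let pi1 : pi setT = 1%E.
Proof. by apply: gauss_setT; rewrite gt_eqF. Qed.

Let P1 x : P x setT = 1%E.
Proof. exact: probability_setT. Qed.

Let mP A : measurable A -> measurable_fun setT (P ^~ A).
Proof. exact: measurable_rwm. Qed.

Let mu : probability T R := as_probability pi1.
Let K : R.-pker T ~> T := as_kernel mP P1.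

Let k : R := 216 / 10 ^+ 5 * expR (- (s / s0) ^+ 2) * (s / s0 * (Num.sqrt d%:R)^-1).

Let k_gt0 : 0 < k.
Proof.
apply: mulr_gt0; first by apply: mulr_gt0; [exact: divr_gt0|exact: expR_gt0].
by rewrite divr_gt0 ?divr_gt0// sqrtr_gt0 ltr0n.
Qed.

Lemma conductance_rwm_ge : (k%:E <= conductance pi P)%E.
Proof.
apply: le_ereal_inf_tmp => _ [A [mA pos] <-].
have E : otimes pi (fun=> pi) A (~` A) = (pi A * pi (~` A))%E.
  by rewrite /otimes integral_cst// muleC.
rewrite E; have fin : (pi A * pi (~` A) \is a fin_num)%E.
  by rewrite fin_numM ?fin_num_measure//; exact: measurableC.
rewrite -(fineK fin) lte_fin in pos *.
rewrite inver gt_eqF// lee_pdivlMr// fineK//.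
exact: rwm_flow_ge.
Qed.

Lemma spectral_gap_rwm : spectral_gap pi P = right_gap pi P.
Proof.
apply: (@spectral_gap_right_gap _ _ _ mu K).
- by move=> f g mf mg f0 g0; exact: rwm_reversible.
- by move=> f g mf mg f0 g0; exact: rwm_positive.
Qed.

Lemma right_gap_rwm_ge : ((k ^+ 2 / 8)%:E <= right_gap pi P)%E.
Proof.
apply: le_ereal_inf_tmp => _ [f [f0 fn] <-]; have [f2 _] := f0.
have F_gt0 : 0 < l2dot pi f f.
  rewrite lt_neqAle l2dot_ge0 andbT eq_sym; apply/eqP => /(l2dot_eq0 f2); exact: fn.
rewrite lee_fin l2norm_sqr// ler_pdivlMr//.
apply: (@cheeger _ _ _ mu K _ k_gt0 _ _ f f0).
- by move=> A mA; exact: rwm_flow_ge.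
- by move=> g h mg mh g0 h0; exact: rwm_reversible.
Qed.

End rwm_gap.

(** 216^2 / 8 = 5832 leaves the margin 2 / 10^10 over 583 / 10^9; x and y stand for exp(- E) and
    exp(- vs^2). *)
Local Lemma gap_constant_le (R : realFieldType) (x y c : R) : 0 <= x -> x <= y ->
  583 / 10 ^+ 9 * x ^+ 2 * c ^+ 2 <= (216 / 10 ^+ 5 * y * c) ^+ 2 / 8.
Proof.
move=> x0 xy; have x2y2 : x ^+ 2 <= y ^+ 2 by rewrite lerXn2r ?nnegrE// (le_trans x0).
have -> : (216 / 10 ^+ 5 * y * c) ^+ 2 / 8 =
  583 / 10 ^+ 9 * y ^+ 2 * c ^+ 2 + 2 / 10 ^+ 10 * (y * c) ^+ 2 by field.
apply: ler_wpDr; first by apply: mulr_ge0; [exact: divr_ge0|exact: sqr_ge0].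
apply: ler_wpM2r; first exact: sqr_ge0.
exact: (ler_wpM2l (divr_ge0 (ler0n _ _) (exprn_ge0 _ (ler0n _ _))) x2y2).
Qed.

Theorem theorem110 (R : realType) (d : nat) (sigma0 vs sigma : R)
    (hd : (0 < d)%N) (hsigma0 : 0 < sigma0) (hvs : 0 < vs)
    (hsigma : sigma = vs * sigma0) :
  let pi : {measure set (d.-tuple R) -> \bar R} := gauss sigma0 in
  let P : d.-tuple R -> {measure set (d.-tuple R) -> \bar R} :=
    rwm_gauss sigma0 sigma in
  let sqrtd := Num.sqrt d%:R : R in
  let E := vs ^+ 2 * (1 + 2 * sqrtd^-1 + 2 * d%:R^-1) in
  [/\ ((216 / 10 ^+ 5 * expR (- E) * (vs * sqrtd^-1))%:E
         <= conductance pi P)%E,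
      spectral_gap pi P = right_gap pi P
    & ((583 / 10 ^+ 9 * expR (- (2 * E)) * (vs ^+ 2 * d%:R^-1))%:E
         <= right_gap pi P)%E].
Proof.
move=> pi P sqrtd E.
have s_gt0 : 0 < sigma by rewrite hsigma mulr_gt0.
have svs : sigma / sigma0 = vs by rewrite hsigma mulfK// gt_eqF.
have sqrtd_gt0 : 0 < sqrtd by rewrite sqrtr_gt0 ltr0n.
have c0 : 0 <= vs * sqrtd^-1 by rewrite mulr_ge0 ?invr_ge0// ltW.
(* The bounds established for the kernel have exponent vs^2; the bracket in E is at least 1, so they
   imply the stated ones. *)
have EE : vs ^+ 2 <= E.
  rewrite ler_peMr ?sqr_ge0// -addrA lerDl.
  by rewrite addr_ge0// mulr_ge0 ?invr_ge0// ltW.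
have expE : expR (- E) <= expR (- vs ^+ 2) by rewrite ler_expR lerN2.
split.
- have := conductance_rwm_ge hd hsigma0 s_gt0; apply: le_trans.
  by rewrite svs lee_fin ler_wpM2r// ler_wpM2l.
- exact: spectral_gap_rwm.
- have := right_gap_rwm_ge hd hsigma0 s_gt0; apply: le_trans.
  rewrite svs lee_fin.
  have -> : expR (- (2 * E)) = expR (- E) ^+ 2 by rewrite -expRM_natl mulrN.
  have -> : d%:R^-1 = sqrtd^-1 ^+ 2 :> R by rewrite exprVn sqr_sqrtr.
  have e0 := expR_ge0 (- E).
  rewrite -[_ ^+ 2 * _ ^+ 2]exprMn; exact: gap_constant_le.
Qed.
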